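(* Let $n\ge 30$, let $q\in(0,\infty)$, and let $w\in D_n$ be Mallows distributed with parameter $q$. Let $\mu$ and $\sigma^2$ denote the mean and variance of $\mathrm{des}(w)+\mathrm{des}(w^{-1})$, and let $Z$ denote a standard normal random variable. Then for all piecewise continuously differentiable functions $h:\mathbb{R}\to\mathbb{R}$, $$\left|\mathbb{E}\,h\!\left(\frac{\mathrm{des}(w)+\mathrm{des}(w^{-1})-\mu}{\sigma}\right)-\mathbb{E}\,h(Z)\right|\le\left(768\|h\|_\infty+666\|h'\|_\infty\max(q^{-1/2},q^{1/2})\right)n^{-1/2}.$$
   Context: $[\pm n]=\{-n,\dots,-1,1,\dots,n\}$. $D_n$ is the group of bijections $w$ of $[\pm n]$ with $w(-i)=-w(i)$ for all $i$ that send an even number of positive integers to negative integers. It is a Coxeter group with generators $s_0,s_1,\dots,s_{n-1}$, where $s_i=(i\ \ i+1)(-i\ \ -i-1)$ for $1\le i\le n-1$ and $s_0=(-1\ \ 2)(-2\ \ 1)$. The length $\ell(w)$ is the minimal number of generators in a product equal to $w$; $w$ has a descent at $s_i$ if $\ell(ws_i)<\ell(w)$; and $\mathrm{des}(w)$ is the number of generators at which $w$ has a descent. The Mallows distribution with parameter $q$ on a finite Coxeter group $W$ is $\mu_q^W(w)=q^{\ell(w)}/\sum_{v\in W}q^{\ell(v)}$. $\|\cdot\|_\infty$ is the supremum norm. *)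

(* Defs.v *)
From mathcomp Require Import all_boot all_order all_algebra all_fingroup.
From mathcomp Require Import all_classical all_reals all_analysis.

Set Implicit Arguments.
Unset Strict Implicit.
Unset Printing Implicit Defensive.

Import Order.TTheory GRing.Theory Num.Theory.
Import numFieldNormedType.Exports.

Local Open Scope ring_scope.

Section WordLength.
Variables (gT : finGroupType) (S : {set gT}).

Definition is_word_of (w : gT) (k : nat) : bool :=
  [exists t : k.-tuple gT,
    all (fun s => s \in S) t && (w == \prod_(s <- t) s)%g].

Lemma gen_is_word_of (w : gT) : w \in <<S>>%g -> exists k, is_word_of w k.
Proof.
move=> /gen_prodgP[k [c cS ->]]; exists k; apply/existsP.
exists [tuple c i | i < k]; apply/andP; split.
  by apply/allP => x /mapP[i _ ->].
by rewrite big_map val_ord_tuple enumT; apply/eqP; apply: eq_bigl.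
Qed.

(* The default 0 is only taken outside the group generated by S. *)
Definition word_length (w : gT) : nat :=
  if @idP (w \in <<S>>%g) is ReflectT wS then ex_minn (gen_is_word_of wS)
  else 0%N.

Definition mallows {R : realType} (W : {set gT}) (q : R) (w : gT) : R :=
  q ^+ word_length w / \sum_(v in W) q ^+ word_length v.

End WordLength.

(* (i, false) encodes the integer i + 1 and (i, true) encodes - (i + 1), so
   that this type is {-n, ..., -1, 1, ..., n}. *)
Definition signed_point (n : nat) : finType := ('I_n * bool)%type.

Definition neg_point n (x : signed_point n) : signed_point n := (x.1, ~~ x.2).

Definition Dgroup (n : nat) : {set {perm signed_point n}} :=
  [set w : {perm signed_point n} |
    [forall x, w (neg_point x) == neg_point (w x)] &&
    ~~ odd #|[set i : 'I_n | (w (i, false)).2]|].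

(* Because points are numbered from 0, s_i swaps positions i - 1 and i for
   0 < i < n. The cyclic ordS and ord_pred never wrap around here if 1 < n. *)
Definition Dgenerator n (i : 'I_n) : {perm signed_point n} :=
  if i == 0%N :> nat then
    (tperm (i, true) (ordS i, false) * tperm (ordS i, true) (i, false))%g
  else
    (tperm (ord_pred i, false) (i, false)
      * tperm (ord_pred i, true) (i, true))%g.

Definition Dgenerators (n : nat) : {set {perm signed_point n}} :=
  [set Dgenerator i | i : 'I_n].

Definition Dlength n (w : {perm signed_point n}) : nat :=
  word_length (Dgenerators n) w.

(* The product of permutations is (s * w) x = w (s x), so (s * w)%g is the
   composite usually written w s. *)
Definition des n (w : {perm signed_point n}) : nat :=
  #|[set s in Dgenerators n | (Dlength (s * w)%g < Dlength w)%N]|.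

Definition two_sided_des n (w : {perm signed_point n}) : nat :=
  (des w + des w^-1%g)%N.

Section MallowsExpectation.
Variables (R : realType) (n : nat) (q : R).

Definition Dexpectation (X : {perm signed_point n} -> R) : R :=
  \sum_(w in Dgroup n) mallows (Dgenerators n) (Dgroup n) q w * X w.

Definition Dvariance (X : {perm signed_point n} -> R) : R :=
  Dexpectation (fun w => (X w - Dexpectation X) ^+ 2).

End MallowsExpectation.

Section PiecewiseC1.
Local Open Scope classical_set_scope.
Variable R : realType.

(* h is continuous and, between consecutive points of a locally finite set of
   breakpoints, it is C^1 up to the endpoints. Continuity of h is part of the
   notion: no jumps are allowed at the breakpoints. *)
Definition piecewise_C1 (h : R -> R) : Prop :=
  continuous h /\
  exists B : set R,
    [/\ forall a b : R, finite_set (B `&` `[a, b]),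
        forall x, ~ B x -> derivable h x 1 /\ {for x, continuous h^`()} &
        forall x, B x -> cvg (h^`() @ x^'-) /\ cvg (h^`() @ x^'+)].

Local Open Scope ereal_scope.

Definition supnorm_on (A : set R) (f : R -> R) : \bar R :=
  ereal_sup [set `|f x|%:E | x in A].

Definition supnorm (f : R -> R) : \bar R := supnorm_on setT f.

(* h^`() is a junk value where h is not derivable, so the supremum ranges over
   the points of derivability only. *)
Definition supnorm_derive (h : R -> R) : \bar R :=
  supnorm_on [set x | derivable h x 1] h^`().

End PiecewiseC1.

(* Main.v *)
(* Let X = des w + des w^-1, and let J_i be the change of X from the shorter to
   the longer of w and s_i w. Pairing w with s_i w turns E[(X - mu) F(X)] into
   2q/(1+q) times the sum over i of E[F(X(s_i w)) - F(X(w)); s_i is an ascent],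
   so that Stein's method applies without any coupling: with Y = sum_i J_i and
   v = q/(1+q)^2 one gets Var X = 2 v E Y, and since |J_i| <= 2 the error is at most
   |g|_oo sqrt(Var Y) / E Y + O(n v Lip(g) / sigma^3), where g = f' and f solves
   Stein's equation.
   Up to bounded terms, Y is n minus the number of changes between ascent and
   descent in the one-line notation plus the number of its consecutive entries
   that differ by 1. An element of D_n is a set of negative values together with an
   independent type A Mallows permutation, whose Lehmer code has independent
   truncated geometric entries, so the Efron-Stein inequality gives
   Var Y = O(n), while E Y >= n/3 - 8/3 because every pattern of three letters is
   monotone with probability at least 1/3.
   The bounds on f and g follow by comparing F(x) = int_(-oo)^x (h - E h(Z)) phi with
   explicit barriers b phi. *)

From HB Require Import structures.
Require Import Defs.
From mathcomp Require Import all_boot all_order all_algebra all_fingroup.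
From mathcomp Require Import zify ring lra.
From mathcomp Require Import all_classical all_reals all_analysis measurable_realfun.

Set Implicit Arguments.
Unset Strict Implicit.
Unset Printing Implicit Defensive.

Import Order.TTheory GRing.Theory Num.Theory.
Import numFieldNormedType.Exports.

Local Open Scope ring_scope.

(** * The Efron-Stein inequality for independent codes *)

(** The obstacle is uniformity in [q]. Both [E Y] and [Var Y] are compared with [n] alone, so the
    first error term is free of [q]; in the second, [v] over [sigma ^+ 3] leaves [v^(-1/2)], which
    equals [q^(1/2) + q^(-1/2)], and this is where the maximum in the bound comes from. For [Var Y],
    bounded differences fail: one changed code entry moves a letter across a stretch of the word,
    and all the adjacencies in that stretch may be affected. Their number has a bounded second
    moment, because the chance that an entry falls below a given slot cancels the bound on the
    chance of an adjacency in that slot. Reversing words exchanges [q] and its inverse, so [q <= 1]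
    may be assumed there. The set of negative values is independent of the permutation, but it
    decides which slots of the word count, hence adjacencies carry a mask. The conditional mean
    given that set varies by O(1) in mean square: the lost slots are charged to the values of the
    rarer sign, about [[n]_b] of them with [b = min(q, 1/q)], while a slot holds an adjacency with
    probability at most [4 / [n]_b]. *)

Lemma set_nth_rcons (T : Type) (x0 : T) s c k c' :
  set_nth x0 (rcons s c) k c' =
  if (k < size s)%N then rcons (set_nth x0 s k c') c
  else if k == size s then rcons s c' else set_nth x0 (rcons s c) k c'.
Proof.
elim: s k => [|y s IH] [|k] //=; rewrite eqSS ltnS.
by rewrite IH; case: ifP => // _; case: ifP.
Qed.

Section Codes.
Variables (R : realFieldType) (d : nat -> nat) (p : nat -> nat -> R).

(** Expectation over independent entries, entry [k] having law [p k] on the numbers below [d k]. The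
    last entry is averaged first, to match the growth of codes by [rcons]. *)
Fixpoint code_mean (n : nat) (F : seq nat -> R) : R :=
  if n is m.+1 then
    code_mean m (fun s => \sum_(c < d m) p m c * F (rcons s c))
  else F [::].

Definition is_code (s : seq nat) := all (fun i => nth 0%N s i < d i)%N (iota 0 (size s)).

Lemma is_code_rcons s c : is_code (rcons s c) = is_code s && (c < d (size s))%N.
Proof.
rewrite /is_code size_rcons -addn1 iotaD all_cat /= add0n andbT nth_rcons ltnn eqxx.
congr (_ && _); apply: eq_in_all => i; rewrite mem_iota => /andP[_ ilt].
by rewrite nth_rcons ilt.
Qed.

Lemma eq_code_mean n F G :
  (forall s, size s = n -> is_code s -> F s = G s) ->
  code_mean n F = code_mean n G.
Proof.
elim: n F G => [|n IH] F G FG /=; first exact: FG.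
apply: IH => s sn sc; apply: eq_bigr => c _; congr (_ * _).
by apply: FG; rewrite ?size_rcons ?sn// is_code_rcons sc sn ltn_ord.
Qed.

Lemma code_meanD n F G :
  code_mean n (fun s => F s + G s) = code_mean n F + code_mean n G.
Proof.
elim: n F G => [|n IH] F G //=; rewrite -IH; apply: eq_code_mean => s _ _.
by rewrite -big_split/=; apply: eq_bigr => c _; rewrite mulrDr.
Qed.

Lemma code_meanZ n a F :
  code_mean n (fun s => a * F s) = a * code_mean n F.
Proof.
elim: n F => [|n IH] F //=; rewrite -IH; apply: eq_code_mean => s _ _.
by rewrite mulr_sumr; apply: eq_bigr => c _; rewrite mulrCA.
Qed.

Lemma code_mean0 n : code_mean n (fun=> 0) = 0.
Proof.
by rewrite -[RHS](mul0r (code_mean n (fun=> 0))) -code_meanZ; apply: eq_code_mean => s _ _; rewrite mul0r.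
Qed.

Lemma code_mean_sum n (I : Type) (r : seq I) (P : pred I) (F : I -> seq nat -> R) :
  code_mean n (fun s => \sum_(i <- r | P i) F i s)
  = \sum_(i <- r | P i) code_mean n (F i).
Proof.
elim: r => [|i r IH].
  by rewrite big_nil -[RHS](code_mean0 n); apply: eq_code_mean => s _ _; rewrite big_nil.
rewrite big_cons; case: ifP => Pi.
  rewrite -IH -code_meanD; apply: eq_code_mean => s _ _.
  by rewrite big_cons Pi.
by rewrite -IH; apply: eq_code_mean => s _ _; rewrite big_cons Pi.
Qed.

Hypothesis p_ge0 : forall k c, 0 <= p k c.

Lemma ler_code_mean n F G :
  (forall s, size s = n -> is_code s -> F s <= G s) ->
  code_mean n F <= code_mean n G.
Proof.
elim: n F G => [|n IH] F G FG /=; first exact: FG.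
apply: IH => s sn sc; apply: ler_sum => c _; apply: ler_wpM2l => //.
by apply: FG; rewrite ?size_rcons ?sn// is_code_rcons sc sn ltn_ord.
Qed.

Hypothesis p_sum1 : forall k, \sum_(c < d k) p k c = 1.

Lemma code_mean_cst n a : code_mean n (fun=> a) = a.
Proof.
elim: n a => [|n IH] a //=; rewrite -[RHS]IH; apply: eq_code_mean => s _ _.
by rewrite -mulr_suml p_sum1 mul1r.
Qed.

(** The entries after [k] average out because each law has total mass 1. *)
Lemma code_mean_take n k (G : seq nat -> nat -> R) : (k < n)%N ->
  code_mean n (fun s => G (take k s) (nth 0%N s k))
  = code_mean k (fun s => \sum_(c < d k) p k c * G s c).
Proof.
elim: n => // n IH; rewrite ltnS leq_eqVlt => /predU1P[->|kn].
  rewrite /=; apply: eq_code_mean => s sn _; apply: eq_bigr => c _.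
  by rewrite nth_rcons -cats1 take_size_cat// sn ltnn eqxx.
rewrite -(IH kn) /=; apply: eq_code_mean => s sn _.
rewrite -[RHS]mul1r -(p_sum1 n) mulr_suml; apply: eq_bigr => c _; congr (_ * _).
by rewrite nth_rcons sn kn -cats1 takel_cat// sn ltnW.
Qed.

Lemma convex_sqr m (w x : 'I_m -> R) : (forall i, 0 <= w i) -> \sum_i w i = 1 ->
  (\sum_i w i * x i) ^+ 2 <= \sum_i w i * x i ^+ 2.
Proof.
move=> w0 w1; set a := \sum_i w i * x i.
have : 0 <= \sum_i w i * (x i - a) ^+ 2.
  by apply: sumr_ge0 => i _; rewrite mulr_ge0// sqr_ge0.
rewrite (eq_bigr (fun i => w i * x i ^+ 2 - 2 * a * (w i * x i) + a ^+ 2 * w i)); last first.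
  by move=> i _; ring.
rewrite big_split/= sumrB -!mulr_sumr w1 -/a; lra.
Qed.

Lemma variance_pairs m (w x : 'I_m -> R) : \sum_i w i = 1 ->
  \sum_i w i * x i ^+ 2 - (\sum_i w i * x i) ^+ 2
  = 2^-1 * \sum_i w i * \sum_j w j * (x i - x j) ^+ 2.
Proof.
move=> w1; set a := \sum_i w i * x i; set s := \sum_i w i * x i ^+ 2.
rewrite (eq_bigr (fun i => w i * x i ^+ 2 - 2 * a * (w i * x i) + s * w i)); last first.
  move=> i _; rewrite (eq_bigr (fun j => x i ^+ 2 * w j - 2 * x i * (w j * x j) + w j * x j ^+ 2)).
    by rewrite big_split/= sumrB -!mulr_sumr w1 -/a -/s; ring.
  by move=> j _; ring.
rewrite big_split/= sumrB -!mulr_sumr w1 -/a -/s; by field.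
Qed.

(** Law of total variance, by induction. The conditional variance of the last entry is its own term,
    by [variance_pairs]; the average [Fb] over the last entry falls under the induction hypothesis,
    and averaging only shrinks the earlier terms, by [convex_sqr]. *)
Theorem efron_stein n F :
  code_mean n (fun s => F s ^+ 2) - code_mean n F ^+ 2
  <= 2^-1 * \sum_(k < n) code_mean n (fun s =>
       \sum_(c < d k) p k c * (F s - F (set_nth 0%N s k c)) ^+ 2).
Proof.
elim: n F => [|n IH] F /=; first by rewrite big_ord0 mulr0 subrr.
set Fb := fun s : seq nat => \sum_(c < d n) p n c * F (rcons s c).
have -> : code_mean n (fun s : seq nat => \sum_(c < d n) p n c * F (rcons s c) ^+ 2)
   = code_mean n (fun s => Fb s ^+ 2)
     + 2^-1 * code_mean n (fun s : seq nat => \sum_(c < d n) p n c *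
         \sum_(c' < d n) p n c' * (F (rcons s c) - F (rcons s c')) ^+ 2).
  rewrite -code_meanZ -code_meanD; apply: eq_code_mean => s _ _.
  by rewrite -(variance_pairs _ (p_sum1 n)) addrC subrK.
rewrite big_ord_recr/= mulrDr addrAC; apply: lerD; last first.
  rewrite ler_pM2l ?invr_gt0//.
  apply: ler_code_mean => s sn _.
  apply: ler_sum => c _; apply: ler_wpM2l => //.
  apply: ler_sum => c' _; apply: ler_wpM2l => //.
  by rewrite set_nth_rcons sn ltnn eqxx.
apply: le_trans (IH Fb) _; rewrite ler_pM2l ?invr_gt0//; apply: ler_sum => k _.
apply: ler_code_mean => s sn _.
rewrite [leRHS](eq_bigr (fun c : 'I_(d n) => \sum_(c' < d k) p k c' *
  (p n c * (F (rcons s c) - F (rcons (set_nth 0%N s k c') c)) ^+ 2))); last first.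
  move=> c _; rewrite mulr_sumr; apply: eq_bigr => c' _; rewrite mulrCA.
  by rewrite set_nth_rcons sn ltn_ord.
rewrite exchange_big/=; apply: ler_sum => c' _.
rewrite -mulr_sumr ler_wpM2l// /Fb -sumrB.
rewrite (eq_bigr (fun c : 'I_(d n) => p n c * (F (rcons s c) - F (rcons (set_nth 0%N s k c') c)))).
  exact: convex_sqr.
by move=> c _; rewrite mulrBr.
Qed.

End Codes.

(** * Mallows words *)

Section Words.
Local Open Scope nat_scope.

Definition insert_at (r x : nat) (L : seq nat) := take r L ++ x :: drop r L.

(* The entry c of a code is the number of letters to the right of the new
   largest letter at the time when it is inserted. *)
Definition word (s : seq nat) : seq nat :=
  foldl (fun L c => insert_at (size L - c) (size L) L) [::] s.

Lemma size_insert_at r x L : size (insert_at r x L) = (size L).+1.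
Proof. by rewrite size_cat/= addnS -size_cat cat_take_drop. Qed.

Lemma size_word s : size (word s) = size s.
Proof.
by elim/last_ind: s => // s c IH; rewrite /word foldl_rcons size_insert_at -/(word s) IH size_rcons.
Qed.

Lemma word_rcons s c : word (rcons s c) = insert_at (size s - c) (size s) (word s).
Proof. by rewrite /word foldl_rcons -/(word s) size_word. Qed.

Lemma word_perm_iota s : perm_eq (word s) (iota 0 (size s)).
Proof.
elim/last_ind: s => // s c IH; rewrite word_rcons size_rcons -addn1 iotaD/= add0n.
apply: (@perm_trans _ (size s :: word s)).
  by rewrite /insert_at perm_catC/= perm_cons perm_catC cat_take_drop.
by rewrite perm_sym perm_catC/= perm_cons perm_sym.
Qed.

Lemma word_lt s x : x \in word s -> x < size s.
Proof. by rewrite (perm_mem (word_perm_iota s)) mem_iota. Qed.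

Lemma nth_insert_at r x L j : r <= size L ->
  nth 0 (insert_at r x L) j =
  if j < r then nth 0 L j else if j == r then x else nth 0 L j.-1.
Proof.
move=> rL; rewrite nth_cat size_takel//; case: ltnP => [jr|rj].
  by rewrite nth_take.
case: eqVneq => [->|jr]; first by rewrite subnn.
have {}rj : r < j by rewrite ltn_neqAle eq_sym jr.
rewrite -[j - r](@prednK (j - r)) ?subn_gt0//= nth_drop; congr nth; lia.
Qed.

Definition adjacent (x y : nat) := (x == y.+1) || (y == x.+1).

(** The mask [g] selects the slots that count. The mask used in the end is [order_mask A]: the slots
    at which the next larger value of the signed permutation is the next integer. *)
Fixpoint adjacencies (g : nat -> bool) (L : seq nat) : nat :=
  if L is x :: L' then
    (if L' is y :: _ then g 0 && adjacent x y else false)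
      + adjacencies (g \o succn) L'
  else 0.

Lemma adjacenciesE g L : adjacencies g L =
  \sum_(j < size L) [&& g j, j.+1 < size L & adjacent (nth 0 L j) (nth 0 L j.+1)].
Proof.
elim: L g => [|x L IH] g; first by rewrite big_ord0.
rewrite big_ord_recl [LHS]/= IH/=; congr (_ + _).
by case: L {IH} => [|y L]; rewrite /= ?andbF.
Qed.

Lemma leq_adjacencies (g g' h : nat -> bool) L : (forall j, j < size L -> g j -> g' j || h j) ->
  adjacencies g L <= adjacencies g' L + adjacencies h L.
Proof.
move=> ggh; rewrite !adjacenciesE -big_split/=; apply: leq_sum => j _.
by move: (ggh j (ltn_ord j)); case: (g j) => //= /(_ isT); case: (_ && _); case: (g' j); case: (h j).
Qed.

Lemma eq_adjacencies (g g' : nat -> bool) L : (forall j, j < size L -> g j = g' j) ->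
  adjacencies g L = adjacencies g' L.
Proof. by move=> gg; rewrite !adjacenciesE; apply: eq_bigr => j _; rewrite gg. Qed.

Lemma adjacencies0 L : adjacencies (fun=> false) L = 0.
Proof. by rewrite adjacenciesE big1. Qed.

Lemma adjacencies_single i L : adjacencies (pred1 i) L <= 1.
Proof.
elim: L i => // x L IH [|i] /=.
  by rewrite (@eq_adjacencies _ (fun=> false))// adjacencies0 addn0; case: L {IH} => // y L; case: adjacent.
by apply: leq_trans (IH i); case: L {IH}.
Qed.

(* The mask induced on a word by the deletion of the letter in slot r. *)
Definition delete_slot (r : nat) (g : nat -> bool) (j : nat) : bool :=
  if j.+1 < r then g j else if j.+1 == r then false else g j.+1.

Lemma adjacencies_insert g r x L : r <= size L ->
  adjacencies g (insert_at r x L) =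
  adjacencies (delete_slot r g) L
  + ([&& 0 < r, g r.-1 & adjacent (nth 0 L r.-1) x]
     + [&& r < size L, g r & adjacent x (nth 0 L r)]).
Proof.
elim: L g r => [|y L IH] g [|r]//=; rewrite /insert_at/=.
  by move=> _; rewrite add0n addnC.
rewrite ltnS => rL; have := IH (g \o succn) r rL; rewrite /insert_at/= => ->.
case: L IH rL => [|z L] IH; first by case: r => //= _; rewrite take0/= addn0.
case: r => [|r] /= rL.
  by rewrite !add0n addnCA.
have -> : delete_slot r.+2 g 0 = g 0 by [].
by rewrite -!addnA ltnS.
Qed.

(** A new largest letter can only be adjacent to the previous largest one, which the entry [c0] put
    at index [m.-1 - c0]. The gain of an insertion therefore depends on two successive entries
    only. *)
Definition insertion_gain (g : nat -> bool) (m c0 c : nat) : nat :=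
  [&& 0 < m - c, g (m - c).-1 & (m - c).-1 == m.-1 - c0]
  + [&& m - c < m, g (m - c) & m - c == m.-1 - c0].

Lemma insertion_gain_le1 g m c0 c : insertion_gain g m c0 c <= 1.
Proof. by rewrite /insertion_gain; do 2!case: andP => //=; lia. Qed.

Lemma adjacencies_word_rcons2 g s c0 c :
  adjacencies g (word (rcons (rcons s c0) c)) =
  adjacencies (delete_slot ((size s).+1 - c) g) (word (rcons s c0))
  + insertion_gain g (size s).+1 c0 c.
Proof.
have key i : i <= size s ->
  adjacent (nth 0 (word (rcons s c0)) i) (size s).+1 = (i == size s - c0).
  move=> is_; rewrite word_rcons nth_insert_at ?size_word ?leq_subr//.
  rewrite /adjacent; case: (ltngtP i (size s - c0)) => [ilt|igt|_].
  - have := @word_lt s (nth 0 (word s) i); rewrite mem_nth ?size_word; last by lia.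
    by move=> /(_ isT); lia.
  - have := @word_lt s (nth 0 (word s) i.-1); rewrite mem_nth ?size_word; last by lia.
    by move=> /(_ isT); lia.
  - by rewrite eqSS eqxx orbT.
rewrite word_rcons adjacencies_insert ?size_word ?leq_subr// size_rcons.
congr (_ + (nat_of_bool _ + nat_of_bool _)).
  by case: (posnP ((size s).+1 - c)) => //= ?; rewrite key//; lia.
case: ltnP => //= ?; rewrite /adjacent orbC -/(adjacent _ _) key//; lia.
Qed.

(** The adjacencies of [a] between the two places where the entries [c] and [c'] insert the next
    letter. Slots are counted from the right end, as code entries are. *)
Definition window (c' c : nat) (a : seq nat) : nat :=
  adjacencies (fun j => c' < size a - j <= c) a.

Definition close (b x y : nat) := (x <= y + b) && (y <= x + b).

Lemma delete_slot_close g r r' a : r <= r' ->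
  close (1 + adjacencies (fun j => r <= j < r') a)
    (adjacencies (delete_slot r g) a) (adjacencies (delete_slot r' g) a).
Proof.
move=> rr; set h := fun j => r <= j.+1 <= r'.
have hle : adjacencies h a <= 1 + adjacencies (fun j => r <= j < r') a.
  apply: (@leq_trans (adjacencies (pred1 r.-1) a + adjacencies (fun j => r <= j < r') a)).
    by apply: leq_adjacencies => j _; rewrite /h/=; lia.
  by rewrite leq_add2r adjacencies_single.
apply/andP; split; (apply: leq_trans (leq_add (leqnn _) hle); apply: leq_adjacencies) => j _;
  by rewrite /delete_slot /h; case: (ltngtP j.+1 r) => ?; case: (ltngtP j.+1 r') => ?;
    case: (g j); case: (g j.+1) => //=; lia.
Qed.

(** The masks induced by the two insertions differ between the two places only, which costs
    [1 + window]; the moved letter and the letter inserted next change their gains by at most 1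
    each. Every later gain depends on entries common to both codes. *)
Lemma adjacencies_change g s1 c' c s2 : c' <= c ->
  close (3 + window c' c (word s1))
    (adjacencies g (word (s1 ++ c :: s2))) (adjacencies g (word (s1 ++ c' :: s2))).
Proof.
move=> cc; have base g0 : close (2 + window c' c (word s1))
    (adjacencies g0 (word (rcons s1 c))) (adjacencies g0 (word (rcons s1 c'))).
  have rr : size s1 - c <= size s1 - c' by lia.
  have := delete_slot_close g0 (word s1) rr.
  rewrite (@eq_adjacencies (fun j => size s1 - c <= j < size s1 - c')
    (fun j => c' < size (word s1) - j <= c)); last by move=> j _; rewrite size_word; lia.
  rewrite -/(window c' c (word s1)) /close.
  case/lastP: s1 rr => [|s1 c0] rr; first by rewrite /word/=; lia.
  rewrite !adjacencies_word_rcons2 size_rcons.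
  have := insertion_gain_le1 g0 (size s1).+1 c0 c.
  have := insertion_gain_le1 g0 (size s1).+1 c0 c'.
  by lia.
elim/last_ind: s2 g => [|s2 c2 IH] g.
  by rewrite !cats1; move: (base g); rewrite /close; lia.
rewrite -!rcons_cons -!rcons_cat.
case/lastP: s2 IH => [|s2 c1] IH.
  rewrite !cats1 !adjacencies_word_rcons2.
  have := insertion_gain_le1 g (size s1).+1 c c2.
  have := insertion_gain_le1 g (size s1).+1 c' c2.
  by move: (base (delete_slot ((size s1).+1 - c2) g)); rewrite /close; lia.
rewrite -!rcons_cons -!rcons_cat !adjacencies_word_rcons2 !size_cat/=.
move: (IH (delete_slot ((size s1 + (size s2).+1).+1 - c2) g)).
by rewrite -!rcons_cons -!rcons_cat /close; lia.
Qed.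

End Words.

(** * q-numbers and truncated geometric weights *)

Section QNumbers.
Variable R : realFieldType.
Implicit Type q : R.

Definition qnat q (n : nat) : R := \sum_(i < n) q ^+ i.

Lemma qnatS q n : qnat q n.+1 = qnat q n + q ^+ n.
Proof. by rewrite /qnat big_ord_recr. Qed.

Lemma qnat_ge0 q n : 0 <= q -> 0 <= qnat q n.
Proof. by move=> q0; apply: sumr_ge0 => i _; apply: exprn_ge0. Qed.

Lemma qnatS_ge1 q n : 0 <= q -> 1 <= qnat q n.+1.
Proof.
by move=> q0; rewrite /qnat big_ord_recl expr0 lerDl sumr_ge0// => i _; rewrite exprn_ge0.
Qed.

Lemma qnatS_gt0 q n : 0 <= q -> 0 < qnat q n.+1.
Proof. by move=> q0; apply: lt_le_trans (qnatS_ge1 n q0). Qed.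

Lemma ler_qnat q m n : 0 <= q -> (m <= n)%N -> qnat q m <= qnat q n.
Proof.
move=> q0; elim: n => [|n IH]; first by rewrite leqn0 => /eqP->.
rewrite leq_eqVlt => /predU1P[->//|/IH mn].
by rewrite qnatS (le_trans mn)// lerDl exprn_ge0.
Qed.

Lemma qnat_inv q m : q != 0 -> q ^+ m * qnat q^-1 m.+1 = qnat q m.+1.
Proof.
move=> q0; rewrite /qnat mulr_sumr (reindex_inj rev_ord_inj)/=.
apply: eq_bigr => i _; rewrite exprVn subSS.
have -> : q ^+ m = q ^+ i * q ^+ (m - i) by rewrite -exprD subnKC ?leq_ord.
by rewrite mulfK// expf_neq0.
Qed.

Definition code_weight q (k c : nat) : R := q ^+ c / qnat q k.+1.

Lemma code_weight_ge0 q k c : 0 <= q -> 0 <= code_weight q k c.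
Proof. by move=> q0; rewrite divr_ge0 ?exprn_ge0// qnat_ge0. Qed.

Lemma code_weight_sum q k : 0 <= q -> \sum_(c < k.+1) code_weight q k c = 1.
Proof. by move=> q0; rewrite -mulr_suml divff// gt_eqF// qnatS_gt0. Qed.

Lemma code_weight_inv q k c : 0 < q -> (c <= k)%N ->
  code_weight q^-1 k c = code_weight q k (k - c).
Proof.
move=> q0 ck; have qn0 : q != 0 by rewrite gt_eqF.
rewrite /code_weight -(qnat_inv k qn0) exprVn.
have -> : q ^+ k = q ^+ (k - c) * q ^+ c by rewrite -exprD subnK.
by rewrite !invfM mulrA mulrA divff ?expf_neq0// mul1r.
Qed.

Lemma code_weight_le q k c : 0 < q -> q <= 1 -> (c <= k)%N ->
  code_weight q k c <= (qnat q k.+1)^-1.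
Proof.
move=> /ltW q0 q1 ck; rewrite /code_weight ler_piMl ?invr_ge0 ?qnat_ge0//.
by rewrite exprn_ile1.
Qed.

Lemma qnat_double q n : 0 <= q -> q <= 1 -> qnat q n.*2 <= 2 * qnat q n.
Proof.
move=> q0 q1; elim: n => [|n IH]; first by rewrite /qnat !big_ord0 mulr0.
rewrite doubleS 2!qnatS [qnat q n.+1]qnatS.
have : q ^+ n.*2 <= q ^+ n by rewrite ler_wiXn2l// -addnn leq_addr.
have : q ^+ n.*2.+1 <= q ^+ n by rewrite ler_wiXn2l// -addnn -addnS leq_addr.
lra.
Qed.

(** Half of the exponent is spent: the [uphalf M] first powers in [qnat q M] are each at least
    [q ^+ uphalf M], and [q ^+ M./2] is kept for a later summation. *)
Lemma ler_mulrn_qnat q M : 0 <= q -> q <= 1 ->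
  M%:R * q ^+ M <= 2 * q ^+ M./2 * qnat q M.
Proof.
move=> q0 q1; case: M => [|M]; first by rewrite mul0r mulr_ge0 ?qnat_ge0// mulr_ge0 ?exprn_ge0.
have h : (uphalf M.+1)%:R * q ^+ (uphalf M.+1) <= qnat q M.+1.
  apply: le_trans (ler_qnat q0 (_ : (uphalf M.+1 <= M.+1)%N)); last by lia.
  rewrite -[X in X%:R](card_ord (uphalf M.+1)) mulr_natl -sumr_const.
  by apply: ler_sum => i _; rewrite ler_wiXn2l// ltnW.
have -> : q ^+ M.+1 = q ^+ M.+1./2 * q ^+ uphalf M.+1.
  by rewrite -exprD; congr (q ^+ _); lia.
rewrite mulrCA [2 * _]mulrC -[leRHS]mulrA ler_wpM2l ?exprn_ge0//.
apply: (@le_trans _ _ ((2 * (uphalf M.+1)%:R) * q ^+ (uphalf M.+1))).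
  by rewrite ler_wpM2r ?exprn_ge0// -natrM ler_nat; lia.
by rewrite -mulrA ler_pM2l.
Qed.

Lemma sum_half_powers q k : 0 <= q -> q <= 1 -> \sum_(M < k) q ^+ M./2 <= 2 * qnat q k.
Proof.
move=> q0 q1; apply: (@le_trans _ _ (\sum_(M < k.*2) q ^+ M./2)).
  rewrite -(big_mkord xpredT (fun M => q ^+ M./2)) -(big_mkord xpredT (fun M => q ^+ M./2)).
  rewrite [leRHS](big_cat_nat _ (n := k))//=; last by lia.
  by rewrite lerDl sumr_ge0// => i _; rewrite exprn_ge0.
elim: k => [|k IH]; first by rewrite !big_ord0 mulr_ge0 ?qnat_ge0.
rewrite doubleS 2!big_ord_recr/= qnatS.
have -> : k.*2./2 = k by lia. have -> : (uphalf k.*2) = k by lia. lra.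
Qed.

End QNumbers.

Lemma code_meanS (R : realFieldType) d (p : nat -> nat -> R) n F :
  code_mean d p n.+1 F = \sum_(c < d n) p n c * code_mean d p n (fun s => F (rcons s c)).
Proof.
rewrite /= code_mean_sum; apply: eq_bigr => c _.
by rewrite code_meanZ.
Qed.

(** * Expectations over Mallows words *)

Section WordMean.
Variable R : realFieldType.
Implicit Types (q : R) (F G : seq nat -> R).

Definition word_mean q n F := code_mean succn (code_weight q) n (fun s => F (word s)).

Lemma ler_word_mean q n F G : 0 <= q ->
  (forall L, perm_eq L (iota 0 n) -> F L <= G L) -> word_mean q n F <= word_mean q n G.
Proof.
move=> q0 FG; apply: ler_code_mean => [k c|s sn _]; first exact: code_weight_ge0.
by apply: FG; rewrite -sn word_perm_iota.
Qed.

Lemma eq_word_mean q n F G :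
  (forall L, perm_eq L (iota 0 n) -> F L = G L) -> word_mean q n F = word_mean q n G.
Proof.
move=> FG; apply: eq_code_mean => s sn _.
by apply: FG; rewrite -sn word_perm_iota.
Qed.

Lemma word_meanD q n F G :
  word_mean q n (fun s => F s + G s) = word_mean q n F + word_mean q n G.
Proof. exact: code_meanD. Qed.

Lemma word_meanZ q n a F : word_mean q n (fun s => a * F s) = a * word_mean q n F.
Proof. exact: code_meanZ. Qed.

Lemma word_mean_sum q n (I : Type) (r : seq I) (P : pred I) (F : I -> seq nat -> R) :
  word_mean q n (fun s => \sum_(i <- r | P i) F i s)
  = \sum_(i <- r | P i) word_mean q n (F i).
Proof. exact: code_mean_sum. Qed.

Lemma word_mean_cst q n a : 0 <= q -> word_mean q n (fun=> a) = a.
Proof. by move=> q0; apply: code_mean_cst => k; rewrite code_weight_sum. Qed.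

Lemma word_meanS q n F : word_mean q n.+1 F =
  \sum_(c < n.+1) code_weight q n c * word_mean q n (fun L => F (insert_at (n - c) n L)).
Proof.
rewrite /word_mean code_meanS; apply: eq_bigr => c _; congr (_ * _).
by apply: eq_code_mean => s sn _; rewrite word_rcons sn.
Qed.

Lemma map_insert_at f r x L : map f (insert_at r x L) = insert_at r (f x) (map f L).
Proof. by rewrite /insert_at map_cat/= map_take map_drop. Qed.

Lemma map_bump_id n L : perm_eq L (iota 0 n) -> map (bump n) L = L.
Proof.
move=> pL; rewrite -[RHS]map_id; apply/eq_in_map => x.
by rewrite (perm_mem pL) mem_iota /bump add0n => /andP[_ xn]; rewrite leqNgt xn.
Qed.

(* The first letter of a Mallows word is independent of the pattern of the
   other letters. *)
Lemma word_mean_head q n F : word_mean q n.+1 F =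
  \sum_(r < n.+1) code_weight q n r * word_mean q n (fun L => F ((r : nat) :: map (bump r) L)).
Proof.
elim: n F => [|n IH] F; first by rewrite word_meanS !big_ord1.
rewrite word_meanS big_ord_recr [RHS]big_ord_recr/=; congr (_ + _); last first.
  congr (_ * _); apply: eq_word_mean => L pL.
  by rewrite subnn /insert_at take0 drop0/= map_bump_id.
rewrite (eq_bigr (fun c : 'I_n.+1 => \sum_(r < n.+1) code_weight q n.+1 c * code_weight q n r *
   word_mean q n (fun L => F ((r : nat) :: insert_at (n - c) n.+1 (map (bump r) L))))); last first.
  move=> c _; rewrite IH mulr_sumr; apply: eq_bigr => r _; rewrite mulrA; congr (_ * _).
  apply: eq_word_mean => L _; congr F.
  by rewrite subSn ?leq_ord// /insert_at.
rewrite exchange_big/=; apply: eq_bigr => r _.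
rewrite word_meanS mulr_sumr; apply: eq_bigr => c _; rewrite mulrA; congr (_ * _).
  by rewrite /code_weight; ring.
apply: eq_word_mean => L _; rewrite map_insert_at; congr (F (_ :: insert_at _ _ _)).
by rewrite /bump leq_ord.
Qed.

Lemma rev_insert_at r x L : (r <= size L)%N ->
  insert_at r x (rev L) = rev (insert_at (size L - r) x L).
Proof.
move=> rL; rewrite /insert_at rev_cat rev_cons take_rev drop_rev -cats1 -catA/=.
by [].
Qed.

(** Reversing a word replaces each entry [c] of rank [k] by [k - c], and this reflects the geometric
    weights. *)
Lemma word_mean_rev q n F : 0 < q ->
  word_mean q n F = word_mean q^-1 n (fun L => F (rev L)).
Proof.
move=> q0; elim: n F => [|n IH] F //.
rewrite !word_meanS (reindex_inj rev_ord_inj)/=; apply: eq_bigr => c _.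
rewrite code_weight_inv ?leq_ord// subSS IH; congr (_ * _).
apply: eq_word_mean => L pL; congr F.
have sL : size L = n by rewrite (perm_size pL) size_iota.
by rewrite rev_insert_at ?sL ?leq_subr// !subKn ?leq_ord ?leq_subr.
Qed.

Lemma adjacent_bump r x y : adjacent (bump r x) (bump r y) -> adjacent x y.
Proof. by rewrite /adjacent /bump; lia. Qed.

(** A mask indexed by the distance to the right end does not shift when letters are put in front. *)
Definition suffix_adjacencies (chi : nat -> bool) (L : seq nat) : nat :=
  adjacencies (fun j => chi (size L - j)%N) L.

(** Only an inequality: relabelling by [bump r] pulls the letters [r - 1] and [r] apart, so it may
    destroy an adjacency, but it creates none. *)
Lemma suffix_adjacencies_head chi r L :
  (suffix_adjacencies chi (r :: map (bump r) L) <=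
   [&& chi (size L).+1, L != [::] & adjacent r (bump r (head 0 L))] + suffix_adjacencies chi L)%N.
Proof.
rewrite /suffix_adjacencies /= size_map subn0; apply: leq_add.
  by case: L => //= y L; case: chi.
rewrite !adjacenciesE size_map; apply: leq_sum => j _ /=; rewrite subSS.
case: chi => //=; case: ltnP => //= jL.
rewrite !(nth_map 0%N)// ; first by have := @adjacent_bump r (nth 0 L j) (nth 0 L j.+1)%N; case: adjacent => // /(_ isT)->.
Qed.

Section Moments.
Variables (q : R) (atom : nat -> R).
Hypothesis q0 : 0 <= q.
Hypothesis atomP : forall k c, (c <= k)%N -> code_weight q k c <= atom k.+1.

Lemma atom_ge0 k : 0 <= atom k.+1.
Proof. by apply: le_trans (atomP (leq0n k)); exact: code_weight_ge0. Qed.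

(** Given the pattern with head [x], a new first letter [r] is adjacent to its neighbour only for
    [r = x] and [r = x.+1]. *)
Lemma head_adjacent_weight k L :
  \sum_(r < k.+1) code_weight q k r * ((L != [::]) && adjacent r (bump r (head 0%N L)))%:R
  <= 2 * atom k.+1.
Proof.
case: L => [|x L] /=.
  by rewrite big1 ?mulr_ge0 ?atom_ge0// => r _; rewrite mulr0.
apply: (@le_trans _ _ (\sum_(r < k.+1) ((r == x :> nat)%:R * atom k.+1 + (r == x.+1 :> nat)%:R * atom k.+1))).
  apply: ler_sum => r _; rewrite -mulrDl -natrD.
  have [h|_] := boolP (adjacent r (bump r x)); last first.
    by rewrite mulr0 mulr_ge0 ?ler0n// atom_ge0.
  rewrite mulr1 (_ : (_ + _)%N = 1%N) ?mul1r ?atomP ?leq_ord//.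
  by move: h; rewrite /adjacent /bump; lia.
rewrite big_split/= -!mulr_suml -mulrDl ler_wpM2r ?atom_ge0//.
have le1 y : \sum_(i < k.+1) (i == y :> nat)%:R <= 1 :> R.
  rewrite -natr_sum lern1; have [yk|yk] := ltnP y k.+1.
    by rewrite (bigD1 (Ordinal yk))//= eqxx big1// => i /negbTE; rewrite -val_eqE/= => ->.
  by rewrite big1// => i _; rewrite ltn_eqF// (leq_trans _ yk).
by have := le1 x; have := le1 x.+1; lra.
Qed.

Definition atom_sum (chi : nat -> bool) n : R := \sum_(M < n) (chi M.+1)%:R * (2 * atom M.+1).

Lemma atom_sum_ge0 chi n : 0 <= atom_sum chi n.
Proof. by apply: sumr_ge0 => M _; rewrite !mulr_ge0 ?ler0n ?atom_ge0. Qed.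

Lemma mean_suffix_adjacencies chi n :
  word_mean q n (fun L => (suffix_adjacencies chi L)%:R) <= atom_sum chi n.
Proof.
elim: n => [|n IH]; first by rewrite /word_mean /= /atom_sum big_ord0.
rewrite /atom_sum big_ord_recr/= -/(atom_sum chi n) word_mean_head.
apply: (@le_trans _ _ (\sum_(r < n.+1) code_weight q n r * word_mean q n (fun L =>
   (chi n.+1)%:R * ((L != [::]) && adjacent r (bump r (head 0%N L)))%:R + (suffix_adjacencies chi L)%:R))).
  apply: ler_sum => r _; apply: ler_wpM2l; first exact: code_weight_ge0.
  apply: ler_word_mean => // L pL; rewrite -natrM -natrD ler_nat mulnb.
  by have := suffix_adjacencies_head chi r L; rewrite (perm_size pL) size_iota.
under eq_bigr do rewrite word_meanD mulrDr.
rewrite big_split/= -mulr_suml code_weight_sum// mul1r [leRHS]addrC lerD//.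
under eq_bigr do rewrite word_meanZ mulrCA -word_meanZ.
rewrite -mulr_sumr -word_mean_sum ler_wpM2l ?ler0n//.
rewrite -[leRHS](word_mean_cst n _ q0); apply: ler_word_mean => // L _.
exact: head_adjacent_weight.
Qed.

(* The proof reveals the letters from right to left: given the pattern of the
   last M - 1 letters, the slot before them holds an adjacency with
   probability at most 2 * atom M. *)
Lemma mean_suffix_adjacencies_sqr chi n :
  word_mean q n (fun L => (suffix_adjacencies chi L)%:R ^+ 2)
  <= atom_sum chi n + atom_sum chi n ^+ 2.
Proof.
elim: n => [|n IH]; first by rewrite /word_mean /= /atom_sum big_ord0 add0r.
rewrite /atom_sum !big_ord_recr/= -!/(atom_sum chi n) word_mean_head.
set a := atom_sum chi n; set e := _ * (2 * _).
have e0 : 0 <= e by rewrite !mulr_ge0 ?ler0n ?atom_ge0.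
have a0 : 0 <= a := atom_sum_ge0 chi n.
apply: (@le_trans _ _ (\sum_(r < n.+1) code_weight q n r * word_mean q n (fun L =>
   (chi n.+1)%:R * (((L != [::]) && adjacent r (bump r (head 0%N L)))%:R
     * (1 + 2 * (suffix_adjacencies chi L)%:R)) + (suffix_adjacencies chi L)%:R ^+ 2))).
  apply: ler_sum => r _; apply: ler_wpM2l; first exact: code_weight_ge0.
  apply: ler_word_mean => // L pL; rewrite mulrA -natrM -!natrX -natrM -(natrD _ 1) -natrM -natrD ler_nat mulnb.
  have := suffix_adjacencies_head chi r L; rewrite (perm_size pL) size_iota.
  case: (_ && _) => /= h; last by rewrite mul0n add0n leq_sqr.
  by move: h; rewrite add1n -leq_sqr => /leq_trans->//; rewrite -add1n sqrnD; lia.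
under eq_bigr do rewrite word_meanD mulrDr.
rewrite big_split/= -mulr_suml code_weight_sum// mul1r.
suff : \sum_(r < n.+1) code_weight q n r * word_mean q n (fun L =>
   (chi n.+1)%:R * (((L != [::]) && adjacent r (bump r (head 0%N L)))%:R
     * (1 + 2 * (suffix_adjacencies chi L)%:R))) <= e * (1 + 2 * a).
  by have : 0 <= e ^+ 2 by [rewrite sqr_ge0]; move: IH; rewrite -/a; lra.
under eq_bigr do rewrite word_meanZ mulrCA -word_meanZ.
rewrite -mulr_sumr -word_mean_sum /e -mulrA ler_wpM2l ?ler0n//.
apply: (@le_trans _ _ (word_mean q n (fun L => 2 * atom n.+1 * (1 + 2 * (suffix_adjacencies chi L)%:R)))).
  apply: ler_word_mean => // L _; under eq_bigr do rewrite mulrA.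
  by rewrite -mulr_suml ler_wpM2r ?head_adjacent_weight// addr_ge0// mulr_ge0.
rewrite word_meanZ ler_wpM2l ?mulr_ge0 ?atom_ge0//.
rewrite word_meanD word_mean_cst// word_meanZ lerD2l ler_pM2l//.
exact: mean_suffix_adjacencies.
Qed.

End Moments.
End WordMean.

Lemma adjacencies_slots g L : adjacencies g L =
  (\sum_(j < (size L).-1) (g j && adjacent (nth 0%N L j) (nth 0%N L j.+1)))%N.
Proof.
rewrite adjacenciesE; case: L => [|x L]; first by rewrite !big_ord0.
rewrite big_ord_recr/= ltnn andbF addn0; apply: eq_bigr => j _.
by rewrite ltnS ltn_ord.
Qed.

Lemma adjacentC x y : adjacent x y = adjacent y x.
Proof. by rewrite /adjacent orbC. Qed.

Lemma adjacencies_rev g L :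
  adjacencies g (rev L) = adjacencies (fun j => g (size L - j.+2)%N) L.
Proof.
rewrite !adjacencies_slots size_rev (reindex_inj rev_ord_inj)/=.
apply: eq_bigr => j _; have jL := ltn_ord j.
rewrite !nth_rev; [|lia..]; rewrite adjacentC.
by congr (g _ && adjacent (nth _ _ _) (nth _ _ _)); lia.
Qed.

(** * Variance of masked adjacencies, uniformly in q *)

Section Window.
Variables (R : realFieldType) (q : R).
Hypotheses (q0 : 0 < q) (q1 : q <= 1).
Let q0' : 0 <= q := ltW q0.

Let atom (m : nat) : R := (qnat q m)^-1.

Let atomP k c : (c <= k)%N -> code_weight q k c <= atom k.+1.
Proof. by move=> ck; apply: code_weight_le. Qed.

Lemma code_weight_below k m : (m <= k.+1)%N ->
  \sum_(c < k.+1) code_weight q k c * (c < m)%N%:R = qnat q m / qnat q k.+1.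
Proof.
move=> mk; rewrite /qnat mulr_suml (big_ord_widen _ (fun i => q ^+ i / qnat q k.+1) mk).
by rewrite [RHS]big_mkcond/=; apply: eq_bigr => c _; case: ifP => _; rewrite ?mulr1 ?mulr0.
Qed.

Lemma code_weight_above k m :
  \sum_(c < k.+1) code_weight q k c * (m <= c)%N%:R <= q ^+ m.
Proof.
have h K : \sum_(c < K) q ^+ c * (m <= c)%N%:R = q ^+ m * qnat q (K - m).
  elim: K => [|K IH]; first by rewrite big_ord0 /qnat big_ord0 mulr0.
  rewrite big_ord_recr/= IH; case: leqP => mK.
    by rewrite subSn// qnatS mulrDr -exprD subnKC// mulr1.
  by rewrite mulr0 addr0; congr (_ * qnat _ _); lia.
under eq_bigr do rewrite /code_weight mulrAC.
rewrite -mulr_suml h -mulrA ler_piMr ?exprn_ge0//.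
by rewrite ler_pdivrMr ?qnatS_gt0// mul1r ler_qnat// leq_subr.
Qed.

Lemma sqr_sum_le k (a : nat -> R) : (forall i, 0 <= a i) ->
  (\sum_(i < k) a i) ^+ 2 <= 2 * \sum_(i < k) a i * \sum_(j < i.+1) a j.
Proof.
move=> a0; elim: k => [|k IH]; first by rewrite !big_ord0 expr0n mulr0.
rewrite 2!big_ord_recr/= big_ord_recr/=; have := a0 k.
have : 0 <= \sum_(i < k) a i by exact: sumr_ge0.
move: IH; set x := \sum_(i < k) a i; set y := \sum_(i < k) _; nra.
Qed.

(** The bound of [mean_suffix_adjacencies] for the mean of [window c' c] over words of length
    [k]. *)
Let spread k c' c : R := atom_sum atom (fun M => (c' < M <= c)%N) k.

(** Summed slot by slot: the probability [qnat q M.+1 / qnat q k.+1] that [c'] is below the slot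
    cancels the factor [atom M.+1], and the probability that [c] is above it is at most [q ^+ M.+1].
    What remains is a geometric sum. *)
Lemma mean_spread k :
  \sum_(c < k.+1) code_weight q k c * (\sum_(c' < k.+1) code_weight q k c' * spread k c' c) <= 2.
Proof.
have Kgt0 : 0 < qnat q k.+1 by exact: qnatS_gt0.
rewrite (eq_bigr (fun c : 'I_k.+1 => \sum_(M < k) 2 * atom M.+1 *
   (\sum_(c' < k.+1) code_weight q k c' * (c' < M.+1)%N%:R) * (code_weight q k c * (M.+1 <= c)%N%:R))); last first.
  move=> c _; rewrite mulr_sumr.
  under eq_bigr do rewrite /spread /atom_sum mulr_sumr mulr_sumr.
  rewrite exchange_big/=; apply: eq_bigr => M _.
  rewrite mulr_sumr mulr_suml; apply: eq_bigr => c' _.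
  by rewrite -mulnb natrM; ring.
rewrite exchange_big/=.
apply: (@le_trans _ _ (\sum_(M < k) 2 / qnat q k.+1 * q ^+ M.+1)).
  apply: ler_sum => M _; rewrite -mulr_sumr code_weight_below; last by have := ltn_ord M; lia.
  have -> : 2 * atom M.+1 * (qnat q M.+1 / qnat q k.+1) = 2 / qnat q k.+1.
    by rewrite /atom -mulrA mulKf// gt_eqF// qnatS_gt0.
  by rewrite ler_wpM2l ?divr_ge0 ?code_weight_above// ltW.
rewrite -mulr_sumr mulrAC ler_pdivrMr// ler_pM2l//.
rewrite [leRHS]/qnat big_ord_recl/= lerDr// .
Qed.

(** The square is a sum over pairs of slots [M <= M']. The atom of [M] cancels as in [mean_spread],
    so the [M'.+1] choices of [M] give [M'.+1] equal bounds, which [ler_mulrn_qnat] absorbs at the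
    price of half the exponent. The constant is 8 * 2 * 2: the 8 from [sqr_sum_le] and two slot
    bounds, one 2 from [ler_mulrn_qnat], one from [sum_half_powers]. *)
Lemma mean_spread_sqr k :
  \sum_(c < k.+1) code_weight q k c * (\sum_(c' < k.+1) code_weight q k c' * spread k c' c ^+ 2) <= 32.
Proof.
have Kgt0 : 0 < qnat q k.+1 by exact: qnatS_gt0.
have at0 M : 0 <= atom M.+1 by rewrite invr_ge0 qnat_ge0.
apply: (@le_trans _ _ (\sum_(c < k.+1) \sum_(M' < k) \sum_(M < M'.+1) 8 * atom M.+1 * atom M'.+1 *
   (\sum_(c' < k.+1) code_weight q k c' * (c' < M.+1)%N%:R) * (code_weight q k c * (M'.+1 <= c)%N%:R))).
  apply: ler_sum => c _.
  apply: (@le_trans _ _ (code_weight q k c * (\sum_(c' < k.+1) code_weight q k c' *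
     (2 * \sum_(M' < k) ((c' < M'.+1 <= c)%N%:R * (2 * atom M'.+1)) *
        \sum_(M < M'.+1) ((c' < M.+1 <= c)%N%:R * (2 * atom M.+1)))))).
    rewrite ler_wpM2l ?code_weight_ge0//; apply: ler_sum => c' _.
    rewrite ler_wpM2l ?code_weight_ge0//.
    by apply: (@sqr_sum_le k (fun M => (c' < M.+1 <= c)%N%:R * (2 * atom M.+1))) => i; rewrite !mulr_ge0 ?ler0n.
  rewrite mulr_sumr.
  under eq_bigr do rewrite !mulr_sumr.
  rewrite exchange_big/=; apply: ler_sum => M' _.
  under eq_bigr do rewrite !mulr_sumr.
  rewrite exchange_big/=; apply: ler_sum => M _.
  rewrite mulr_sumr mulr_suml; apply: ler_sum => c' _.
  set w := code_weight q k c; set w' := code_weight q k c'.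
  rewrite [leLHS](_ : _ = (8 * atom M.+1 * atom M'.+1 * w' * w) *
     ((c' < M'.+1 <= c)%N%:R * (c' < M.+1 <= c)%N%:R)); last by ring.
  rewrite [leRHS](_ : _ = (8 * atom M.+1 * atom M'.+1 * w' * w) *
     ((c' < M.+1)%N%:R * (M'.+1 <= c)%N%:R)); last by ring.
  have w0 : 0 <= w := code_weight_ge0 _ _ q0'.
  have w'0 : 0 <= w' := code_weight_ge0 _ _ q0'.
  rewrite ler_wpM2l//; first by do 4?[apply: mulr_ge0 => //].
  by rewrite -!natrM !mulnb ler_nat; lia.
rewrite exchange_big/=.
apply: (@le_trans _ _ (\sum_(M' < k) 16 / qnat q k.+1 * q ^+ (M'.+1)./2)).
  apply: ler_sum => M' _; rewrite exchange_big/=.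
  apply: (@le_trans _ _ (\sum_(M < M'.+1) 8 / qnat q k.+1 * (atom M'.+1 * q ^+ M'.+1))).
    apply: ler_sum => M _; rewrite -mulr_sumr code_weight_below; last by have := ltn_ord M; have := ltn_ord M'; lia.
    have -> : 8 * atom M.+1 * atom M'.+1 * (qnat q M.+1 / qnat q k.+1) = 8 / qnat q k.+1 * atom M'.+1.
      rewrite /atom; field; rewrite ?gt_eqF ?qnatS_gt0//.
    rewrite [leRHS]mulrA ler_wpM2l ?code_weight_above//.
    by rewrite mulr_ge0// divr_ge0// ltW.
  rewrite sumr_const card_ord -mulrnAr.
  have -> : 16 / qnat q k.+1 = 8 / qnat q k.+1 * 2 by field; rewrite gt_eqF.
  rewrite -[leRHS]mulrA ler_wpM2l ?divr_ge0 ?(ltW Kgt0)//.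
  rewrite -mulr_natl mulrCA mulrC ler_pdivrMr ?qnatS_gt0// .
  exact: ler_mulrn_qnat.
rewrite -mulr_sumr mulrAC ler_pdivrMr//.
have := sum_half_powers k.+1 q0' q1; rewrite big_ord_recl/= expr0.
rewrite (eq_bigr (fun i : 'I_k => q ^+ uphalf i))//.
by lra.
Qed.

Lemma mean_window_sqr k c' c :
  word_mean q k (fun a => (window c' c a)%:R ^+ 2) <= spread k c' c + spread k c' c ^+ 2.
Proof. exact: (mean_suffix_adjacencies_sqr q0' atomP). Qed.

Lemma mean_window_sqr_sum k :
  \sum_(c < k.+1) code_weight q k c * (\sum_(c' < k.+1) code_weight q k c' *
     word_mean q k (fun a => (window c' c a)%:R ^+ 2)) <= 34.
Proof.
apply: (@le_trans _ _ (\sum_(c < k.+1) code_weight q k c * (\sum_(c' < k.+1) code_weight q k c' *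
    (spread k c' c + spread k c' c ^+ 2)))).
  apply: ler_sum => c _; rewrite ler_wpM2l ?code_weight_ge0//; apply: ler_sum => c' _.
  by rewrite ler_wpM2l ?code_weight_ge0// mean_window_sqr.
under eq_bigr do (under eq_bigr do rewrite mulrDr); under eq_bigr do rewrite big_split/= mulrDr.
by rewrite big_split/=; have := mean_spread k; have := mean_spread_sqr k; lra.
Qed.

Lemma close_sqr b x y : close b x y -> (x%:R - y%:R : R) ^+ 2 <= b%:R ^+ 2.
Proof.
move=> /andP[]; rewrite -!(ler_nat R) !natrD => xy yx.
by rewrite -subr_ge0 subr_sqr mulr_ge0//; lra.
Qed.

Let count g L : R := (adjacencies g L)%:R.

(** From [(3 + w)^2 <= 18 + 2 w^2]. Both windows appear because either of the old and the new entry
    may be the larger one. *)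
Lemma change_sqr g s k c : (k < size s)%N ->
  (count g (word s) - count g (word (set_nth 0%N s k c))) ^+ 2
  <= 18 + 2 * (window c (nth 0%N s k) (word (take k s)))%:R ^+ 2
        + 2 * (window (nth 0%N s k) c (word (take k s)))%:R ^+ 2.
Proof.
move=> ks; set c0 := nth 0%N s k; set w := word (take k s).
have es : s = take k s ++ c0 :: drop k.+1 s.
  by rewrite -drop_nth// cat_take_drop.
have -> : set_nth 0%N s k c = take k s ++ c :: drop k.+1 s by rewrite set_nthE ks.
rewrite [in count g (word s)]es.
have key c1 c2 : (c1 <= c2)%N ->
    (count g (word (take k s ++ c2 :: drop k.+1 s)) -
     count g (word (take k s ++ c1 :: drop k.+1 s))) ^+ 2
    <= 18 + 2 * (window c1 c2 w)%:R ^+ 2.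
  move=> cc; apply: le_trans (close_sqr (adjacencies_change g (take k s) (drop k.+1 s) cc)) _.
  rewrite natrD -/w; have := sqr_ge0 ((window c1 c2 w)%:R - 3 : R); lra.
have [cc|/ltnW cc] := leqP c c0.
  by apply: le_trans (key _ _ cc) _; rewrite lerDl mulr_ge0// sqr_ge0.
rewrite -opprB sqrrN; apply: le_trans (key _ _ cc) _.
by have := sqr_ge0 ((window c c0 w)%:R : R); lra.
Qed.

Lemma variance_adjacencies_le1 g n :
  word_mean q n (fun L => count g L ^+ 2) - word_mean q n (count g) ^+ 2 <= 77 * n%:R.
Proof.
apply: le_trans (efron_stein _ _ _ _) _.
- by move=> k c; exact: code_weight_ge0.
- by move=> k; exact: code_weight_sum.
(* The contribution of one entry is 154 = 18 + 2 * 34 + 2 * 34, where 34 is the bound of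
   [mean_window_sqr_sum], used once for each order of the old and the new entry. *)
rewrite (_ : 77 * n%:R = 2^-1 * \sum_(k < n) 154); last first.
  by rewrite sumr_const card_ord -mulr_natr; field.
rewrite ler_pM2l ?invr_gt0//; apply: ler_sum => k _.
pose G (a : seq nat) (c0 : nat) : R := \sum_(c < k.+1) code_weight q k c *
  (18 + 2 * (window c c0 (word a))%:R ^+ 2 + 2 * (window c0 c (word a))%:R ^+ 2).
apply: (@le_trans _ _ (code_mean succn (code_weight q) n
  (fun s => G (take k s) (nth 0%N s k)))).
  apply: ler_code_mean => [k' c|s sn _]; first exact: code_weight_ge0.
  apply: ler_sum => c _; rewrite ler_wpM2l ?code_weight_ge0//.
  by apply: change_sqr; rewrite sn.
rewrite code_mean_take//; last by move=> k'; exact: code_weight_sum.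
rewrite code_mean_sum.
have e c0 : code_mean succn (code_weight q) k (fun s => code_weight q k c0 * G s c0)
  = code_weight q k c0 * (\sum_(c < k.+1) code_weight q k c *
     (18 + 2 * word_mean q k (fun a => (window c c0 a)%:R ^+ 2)
         + 2 * word_mean q k (fun a => (window c0 c a)%:R ^+ 2))).
  rewrite code_meanZ /G code_mean_sum; congr (_ * _); apply: eq_bigr => c _.
  rewrite code_meanZ; congr (_ * _); rewrite code_meanD code_meanD !code_meanZ.
  by rewrite code_mean_cst// => k'; exact: code_weight_sum.
under eq_bigr => c0 _ do rewrite e.
rewrite (eq_bigr (fun c0 : 'I_k.+1 => code_weight q k c0 * 18
  + 2 * (code_weight q k c0 * \sum_(c < k.+1) code_weight q k c * word_mean q k (fun a => (window c c0 a)%:R ^+ 2))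
  + 2 * (\sum_(c < k.+1) code_weight q k c * (code_weight q k c0 * word_mean q k (fun a => (window c0 c a)%:R ^+ 2))))); last first.
  move=> c0 _; rewrite (eq_bigr (fun c : 'I_k.+1 => code_weight q k c * 18
   + 2 * (code_weight q k c * word_mean q k (fun a => (window c c0 a)%:R ^+ 2))
   + 2 * (code_weight q k c * word_mean q k (fun a => (window c0 c a)%:R ^+ 2)))); last by move=> c _; ring.
  rewrite !big_split/= -mulr_suml -!mulr_sumr code_weight_sum// mul1r !mulrDr.
  congr (_ + _ + _); rewrite mulrCA// mulr_sumr; congr (_ * _).
  by apply: eq_bigr => c _; rewrite mulrCA.
rewrite !big_split/= -mulr_suml -!mulr_sumr code_weight_sum// mul1r.
rewrite [X in _ + 2 * X]exchange_big/=.
under [X in _ + 2 * X]eq_bigr do rewrite -mulr_sumr.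
by have := mean_window_sqr_sum k; lra.
Qed.

End Window.

Section VarianceAdjacencies.
Variables (R : realFieldType) (q : R).
Hypothesis q0 : 0 < q.

Lemma variance_adjacencies g n :
  word_mean q n (fun L => (adjacencies g L)%:R ^+ 2)
  - word_mean q n (fun L => (adjacencies g L)%:R) ^+ 2 <= 77 * n%:R.
Proof.
have [q1|/ltW q1] := leP q 1; first exact: variance_adjacencies_le1.
have qi0 : 0 < q^-1 by rewrite invr_gt0.
rewrite !(word_mean_rev n _ q0).
have e (f : nat -> R) : word_mean q^-1 n (fun L => f (adjacencies g (rev L)))
    = word_mean q^-1 n (fun L => f (adjacencies (fun j => g (n - j.+2)%N) L)).
  apply: eq_word_mean => L pL; rewrite adjacencies_rev.
  by rewrite (perm_size pL) size_iota.
rewrite (e (fun m => m%:R ^+ 2)) (e (fun m => m%:R)).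
by apply: variance_adjacencies_le1 => //; rewrite invf_le1.
Qed.

(** One end of the word is at distance at least [n / 2] from the slot; after a reversal if necessary
    it is the right one. Then the suffix bound [2 / qnat b (n - j)] applies, and [qnat_double]
    doubles it. Since reversal inverts [q], the base [b] has to serve both [q] and its inverse. *)
Lemma word_mean_slot j n : (j.+1 < n)%N ->
  word_mean q n (fun L => (adjacencies (pred1 j) L)%:R)
  <= 4 / qnat (Num.min q q^-1) n.
Proof.
move=> jn; set b := Num.min q q^-1.
have qi0 : 0 < q^-1 by rewrite invr_gt0.
have b0 : 0 < b by rewrite lt_min q0.
have b1 : b <= 1.
  rewrite ge_min; have [//|/ltW q1] := leP q 1.
  by rewrite invf_le1.
have atomP q' k c : q' = q \/ q' = q^-1 -> (c <= k)%N -> code_weight q' k c <= (qnat b k.+1)^-1.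
  move=> q'E ck; have q'0 : 0 < q' by case: q'E => ->.
  have [bq|bq] : b = q' \/ b = q'^-1.
    by rewrite /b; case: q'E => ->; rewrite ?invrK; case: leP; auto.
  - by rewrite bq; apply: code_weight_le; rewrite -?bq.
  - rewrite -[q']invrK -bq code_weight_inv//.
    by apply: code_weight_le; rewrite ?leq_subr.
have half q' i : q' = q \/ q' = q^-1 -> (i.+1 < n)%N ->
    word_mean q' n (fun L => (adjacencies (pred1 i) L)%:R) <= 2 / qnat b (n - i).
  move=> q'E in_; have q'0 : 0 <= q' by apply: ltW; case: q'E => ->.
  have -> : word_mean q' n (fun L => (adjacencies (pred1 i) L)%:R)
     = word_mean q' n (fun L => (suffix_adjacencies (fun M => M == n - i)%N L)%:R).
    apply: eq_word_mean => L pL; congr (_%:R); apply: eq_adjacencies => k kL /=.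
    by move: kL; rewrite (perm_size pL) size_iota => kL; lia.
  have ilt : ((n - i).-1 < n)%N by lia.
  have iE : (n - i).-1.+1 = (n - i)%N by lia.
  apply: le_trans (mean_suffix_adjacencies (atom := fun m => (qnat b m)^-1) q'0
    (fun k c => @atomP q' k c q'E) _ _) _.
  rewrite /atom_sum (bigD1 (Ordinal ilt))//= iE eqxx mul1r big1 ?addr0// => k.
  rewrite -val_eqE/= => ki.
  by rewrite (_ : (_ == _) = false) ?mul0r//; lia.
have final m : (n <= m.*2)%N -> 2 / qnat b m <= 4 / qnat b n.
  case: m => [|m]; first by lia. move=> nm.
  have Q : 0 < qnat b n by case: (n) jn => // n' _; rewrite qnatS_gt0// ltW.
  have Qm : 0 < qnat b m.+1 := qnatS_gt0 m (ltW b0).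
  rewrite ler_pdivlMr// mulrAC ler_pdivrMr//.
  have := qnat_double m.+1 (ltW b0) b1; have := ler_qnat (ltW b0) nm; lra.
have [h|h] := leqP n (n - j).*2.
  by apply: le_trans (final _ h); apply: half; auto.
rewrite (word_mean_rev n _ q0).
rewrite (_ : word_mean _ _ _ = word_mean q^-1 n (fun L => (adjacencies (pred1 (n - j.+2)%N) L)%:R)); last first.
  apply: eq_word_mean => L pL; rewrite adjacencies_rev (perm_size pL) size_iota.
  rewrite !adjacencies_slots; congr (_%:R); apply: eq_bigr => i _.
  have sL : size L = n by rewrite (perm_size pL) size_iota.
  have ilt : (nat_of_ord i < n.-1)%N by rewrite -[n]sL ltn_ord.
  by congr (nat_of_bool (_ && _)) => /=; lia.
apply: le_trans (half _ _ _ _) _; [by right|lia|].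
by apply: final; lia.
Qed.

End VarianceAdjacencies.

(** * Descents read off the code *)

Lemma index_insert_at r x y L : (r <= size L)%N -> x \notin L ->
  index y (insert_at r x L) =
  if y == x then r else if (index y L < r)%N then index y L else (index y L).+1.
Proof.
move=> rL xL; rewrite /insert_at index_cat size_takel//=.
have [->|yx] := eqVneq y x.
  rewrite ifF ?eqxx ?addn0//; apply/negbTE; apply: contra xL; exact: mem_take.
rewrite ?(negbTE yx) ?[x == y]eq_sym ?(negbTE yx).
have iE : index y L = (if y \in take r L then index y (take r L) else r + index y (drop r L))%N.
  by rewrite -[in LHS](cat_take_drop r L) index_cat size_takel.
case: ifP iE => yt ->; last by rewrite ltnNge leq_addr addnS.
suff -> : (index y (take r L) < r)%N by [].
by rewrite -[X in (_ < X)%N](size_takel rL) index_mem.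
Qed.

Definition before (L : seq nat) (x y : nat) := (index x L < index y L)%N.

(** The letter [k.+1] enters right after [k], and it lands to the left of [k] exactly when it leaves
    more letters on its right than [k] did. Later insertions keep their order. *)
Lemma before_word s k : is_code succn s -> (k.+1 < size s)%N ->
  before (word s) k.+1 k = (nth 0 s k < nth 0 s k.+1)%N.
Proof.
elim/last_ind: s => // s c IH; rewrite is_code_rcons size_rcons !ltnS => /andP[sc cs].
have nin : size s \notin word s by apply/negP => /word_lt; rewrite ltnn.
rewrite leq_eqVlt => /predU1P[ks|ks]; last first.
  rewrite !nth_rcons ks (ltnW ks) -IH// /before word_rcons.
  rewrite !index_insert_at ?size_word ?leq_subr// !ltn_eqF// ?(ltnW ks)//.
  by case: (ltnP (index k.+1 _)); case: (ltnP (index k _)); lia.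
rewrite /before word_rcons !nth_rcons -ks ltnSn ltnn eqxx.
rewrite !index_insert_at ?size_word -?ks ?leq_subr// ?ks// eqxx ltn_eqF -?ks//.
case/lastP: s IH sc cs nin ks => // s c0 _ sc + nin; rewrite size_rcons => cs [ks].
move: sc; rewrite is_code_rcons => /andP[_ c0s].
have nin' : size s \notin word s by apply/negP => /word_lt; rewrite ltnn.
rewrite word_rcons index_insert_at ?size_word ?leq_subr// ks eqxx nth_rcons ltnn eqxx.
by case: (ltnP (size s - c0)); lia.
Qed.

(** For the word that lists positions by increasing value, [before L k.+1 k] is a descent between
    the positions [k] and [k.+1]; see [boundary_switches_Dperm]. *)
Definition switches (n : nat) (L : seq nat) : nat :=
  (\sum_(k < n.-2) (before L k.+1 k != before L k.+2 k.+1))%N.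

Section Switches.
Variable R : realFieldType.

Lemma variance_switches (q : R) n : 0 < q ->
  word_mean q n (fun L => (switches n L)%:R ^+ 2)
  - word_mean q n (fun L => (switches n L)%:R) ^+ 2 <= 9 / 2 * n%:R.
Proof.
move=> q0; have q0' := ltW q0.
pose t s k := ((nth 0 s k < nth 0 s k.+1) != (nth 0 s k.+1 < nth 0 s k.+2))%N.
pose F s : R := (\sum_(k < n.-2) t s k)%N%:R.
have FE (f : R -> R) : word_mean q n (fun L => f (switches n L)%:R)
    = code_mean succn (code_weight q) n (fun s => f (F s)).
  apply: eq_code_mean => s sn sc; congr (f _%:R); apply: eq_bigr => k _.
  by rewrite !before_word ?sn//; have := ltn_ord k; lia.
rewrite (FE (fun x => x ^+ 2)) (FE id).
apply: le_trans (efron_stein _ _ _ _) _.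
- by move=> k c; exact: code_weight_ge0.
- by move=> k; exact: code_weight_sum.
(* 9 is the square of 3: the entry [i] occurs in the summands [k = i], [i - 1] and [i - 2] only. *)
rewrite (_ : 9 / 2 * n%:R = 2^-1 * \sum_(k < n) 9); last first.
  by rewrite sumr_const card_ord -mulr_natr; field.
rewrite ler_pM2l ?invr_gt0//; apply: ler_sum => i _.
rewrite -[leRHS](@code_mean_cst _ succn (code_weight q) _ n); last first.
  by move=> k; exact: code_weight_sum.
apply: ler_code_mean => [k c|s sn _]; first exact: code_weight_ge0.
rewrite -[leRHS]mul1r -[X in X * _](code_weight_sum i q0') mulr_suml.
apply: ler_sum => c _; rewrite ler_wpM2l ?code_weight_ge0//.
set s' := set_nth _ _ _ _.
have le1 y : (\sum_(k < n.-2) (k == y :> nat) <= 1)%N.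
  have [yk|yk] := ltnP y n.-2.
    by rewrite (bigD1 (Ordinal yk))//= eqxx big1// => k /negbTE; rewrite -val_eqE/= => ->.
  by rewrite big1// => k _; rewrite ltn_eqF// (leq_trans _ yk).
pose D := (\sum_(k < n.-2) ((k == i :> nat) + (k.+1 == i :> nat) + (k.+2 == i :> nat)))%N.
have D3 : (D <= 3)%N.
  rewrite /D !big_split/=; apply: (@leq_trans (1 + 1 + 1)%N) => //.
  apply: leq_add; first (apply: leq_add; first exact: le1).
    by apply: leq_trans (le1 i.-1); apply: leq_sum => k _; lia.
  by apply: leq_trans (le1 i.-2); apply: leq_sum => k _; lia.
have tt k : (t s k <= t s' k + ((k == i :> nat) + (k.+1 == i :> nat) + (k.+2 == i :> nat)))%N
          /\ (t s' k <= t s k + ((k == i :> nat) + (k.+1 == i :> nat) + (k.+2 == i :> nat)))%N.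
  rewrite /t /s' !nth_set_nth/=.
  have [->|?] := eqVneq k i; first by case: (_ != _); case: (_ != _); lia.
  have [->|?] := eqVneq k.+1 i; first by case: (_ != _); case: (_ != _); lia.
  have [->|?] := eqVneq k.+2 i; first by case: (_ != _); case: (_ != _); lia.
  by case: (_ != _); lia.
have := @close_sqr R 3 (\sum_(k < n.-2) t s k)%N (\sum_(k < n.-2) t s' k)%N.
rewrite -natrX => h; apply: le_trans (h _) _; last by rewrite ler_nat.
apply/andP; split; apply: leq_trans (leq_add (leqnn _) D3); rewrite /D -big_split/=;
  by apply: leq_sum => k _; have [] := tt k.
Qed.

End Switches.

(** * Permutations as words *)

Fixpoint inversion_number (s : seq nat) : nat :=
  if s is x :: s' then count (fun y => y < x)%N s' + inversion_number s' else 0%N.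

Lemma inversion_numberE s : inversion_number s =
  (\sum_(a < size s) \sum_(b < size s) ((a < b)%N && (nth 0 s b < nth 0 s a)))%N.
Proof.
elim: s => [|x s IH]; first by rewrite big_ord0.
rewrite [LHS]/= IH big_ord_recl /=; congr addn.
  rewrite big_ord_recl /= add0n -sum1_count big_mkcond/= (big_nth 0%N) big_mkord.
  by apply: eq_bigr => i _; case: ifP.
by apply: eq_bigr => a _; rewrite big_ord_recl.
Qed.

Lemma inversion_number_insert r k L : (r <= size L)%N -> all (fun y => y < k)%N L ->
  inversion_number (insert_at r k L) = (inversion_number L + (size L - r))%N.
Proof.
rewrite /insert_at; elim: L r => [|y L IH] [|r]//= rL /andP[yk Lk].
  by rewrite yk (eqP (_ : count _ L == size L)) -?all_count// subn0; lia.
rewrite IH// subSS addnA; congr (_ + _ + _)%N.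
rewrite -[in RHS](cat_take_drop r L) !count_cat /=.
by rewrite (_ : (k < y)%N = false) ?add0n//; lia.
Qed.

Fixpoint codes (n : nat) : seq (seq nat) :=
  if n is m.+1 then [seq rcons s c | s <- codes m, c <- iota 0 m.+1] else [:: [::]].

Lemma codesS n : codes n.+1 = [seq rcons s c | s <- codes n, c <- iota 0 n.+1].
Proof. by []. Qed.

Lemma codesP n s : s \in codes n -> size s = n /\ is_code succn s.
Proof.
elim: n s => [|n IH] s; first by rewrite inE => /eqP->.
rewrite codesS; case/allpairsP => -[t c] [tM + ->]; have [tn tc] := IH t tM.
rewrite [X in X \in _ -> _]/= [X in size X]/= [X in is_code _ X]/=.
by rewrite mem_iota size_rcons tn is_code_rcons tc tn => /andP[_].
Qed.

Lemma size_codes n : size (codes n) = n`!.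
Proof. by elim: n => // n IH; rewrite factS codesS size_allpairs size_iota IH mulnC. Qed.

Lemma uniq_codes n : uniq (codes n).
Proof.
elim: n => // n IH; rewrite codesS; apply: allpairs_uniq => //; first exact: iota_uniq.
by move=> [s c] [s' c'] _ _ /= /rcons_inj[-> ->].
Qed.

(** A largest letter inserted with [c] letters on its right creates exactly [c] inversions. *)
Lemma inversion_number_word s : is_code succn s -> inversion_number (word s) = sumn s.
Proof.
elim/last_ind: s => // s c IH; rewrite is_code_rcons => /andP[sc cs].
rewrite word_rcons inversion_number_insert ?size_word ?leq_subr//; last first.
  by apply/allP => y /word_lt.
by rewrite IH// sumn_rcons subKn.
Qed.

Lemma word_inj n : {in codes n &, injective word}.
Proof.
elim: n => [|n IH] s t; first by rewrite !inE => /eqP-> /eqP->.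
rewrite codesS; case/allpairsP => -[s1 c] [s1M cM ->].
have {s1M} s1n : s1 \in codes n := s1M; have {cM} : c \in iota 0 n.+1 := cM.
rewrite mem_iota => /andP[_ cn].
case/allpairsP => -[t1 d] [t1M dM ->].
have {t1M} t1n : t1 \in codes n := t1M; have {dM} : d \in iota 0 n.+1 := dM.
rewrite mem_iota => /andP[_ dn].
have [ss _] := codesP s1n; have [st _] := codesP t1n.
rewrite [rcons _ _]/= [X in _ = _ X -> _]/= [X in _ -> _ = X]/= !word_rcons ss st => e.
have nis : n \notin word s1 by apply/negP => /word_lt; rewrite ss ltnn.
have nit : n \notin word t1 by apply/negP => /word_lt; rewrite st ltnn.
have := congr1 (index n) e; rewrite !index_insert_at ?size_word ?ss ?st ?leq_subr// eqxx => cd.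
have fl r L : n \notin L -> seq.filter (predC1 n) (insert_at r n L) = L.
  move=> nL; rewrite filter_cat/= eqxx -filter_cat cat_take_drop.
  by apply/all_filterP/allP => x xL /=; apply: contraNneq nL => <-.
congr rcons; last by lia.
by apply: IH => //; have := congr1 (seq.filter (predC1 n)) e; rewrite !fl.
Qed.

Section PermWords.
Variable n : nat.
Implicit Type u : 'S_n.

Definition perm_word u : seq nat := [seq (u a : nat) | a <- enum 'I_n].

Lemma size_perm_word u : size (perm_word u) = n.
Proof. by rewrite size_map size_enum_ord. Qed.

Lemma nth_perm_word u (a : 'I_n) : nth 0%N (perm_word u) a = u a.
Proof. by rewrite (nth_map a) ?size_enum_ord// nth_ord_enum. Qed.

Lemma perm_word_inj : injective perm_word.
Proof.
by move=> u v uv; apply/permP => a; apply: val_inj; rewrite /= -!nth_perm_word uv.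
Qed.

Lemma perm_word_iota u : perm_eq (perm_word u) (iota 0 n).
Proof.
apply: uniq_perm; rewrite ?iota_uniq//.
  by rewrite map_inj_uniq ?enum_uniq// => a b /val_inj/perm_inj.
move=> x; rewrite mem_iota/= add0n; apply/mapP/idP => [[a _ ->]//|xn].
by exists (u^-1%g (Ordinal xn)); rewrite ?mem_enum ?permKV.
Qed.

Lemma inversion_number_perm u : inversion_number (perm_word u) =
  (\sum_(a < n) \sum_(b < n) ((a < b)%N && (u b < u a)))%N.
Proof.
rewrite inversion_numberE size_perm_word; apply: eq_bigr => a _.
by apply: eq_bigr => b _; rewrite !nth_perm_word.
Qed.

Lemma before_perm_word u (i j : 'I_n) : before (perm_word u) i j = (u^-1%g i < u^-1%g j)%N.
Proof.
have ix (k : 'I_n) : index (k : nat) (perm_word u) = u^-1%g k.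
  rewrite -{1}[k](permKV u) -nth_perm_word index_uniq ?size_perm_word//.
  by rewrite (perm_uniq (perm_word_iota u)) iota_uniq.
by rewrite /before !ix.
Qed.

(** Both lists consist of [n!] distinct words, so one inclusion is enough. *)
Lemma words_perm : perm_eq [seq word s | s <- codes n] [seq perm_word u | u <- index_enum 'S_n].
Proof.
have uw : uniq [seq word s | s <- codes n].
  by rewrite map_inj_in_uniq ?uniq_codes//; exact: word_inj.
have up : uniq [seq perm_word u | u <- index_enum 'S_n].
  by rewrite map_inj_uniq ?index_enum_uniq//; exact: perm_word_inj.
apply: uniq_perm => //.
have sub : {subset [seq word s | s <- codes n] <= [seq perm_word u | u <- index_enum 'S_n]}.
  move=> L /mapP[s sn ->]; have [ss sc] := codesP sn.
  have pL := word_perm_iota s; rewrite ss in pL.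
  have Lb (a : 'I_n) : (nth 0%N (word s) a < n)%N.
    by have := @word_lt s (nth 0%N (word s) a); rewrite mem_nth ?size_word ss//; exact.
  have inj : injective (fun a : 'I_n => Ordinal (Lb a)).
    move=> a b [] /eqP; rewrite nth_uniq ?size_word ?ss// ?(perm_uniq (word_perm_iota s)) ?iota_uniq//.
    by move=> /eqP/val_inj.
  apply/mapP; exists (perm inj); first exact: mem_index_enum.
  apply: (@eq_from_nth _ 0%N); first by rewrite size_perm_word size_word.
  by move=> i; rewrite size_word ss => isz; rewrite (nth_perm_word _ (Ordinal isz)) permE.
have sz : (size [seq perm_word u | u <- index_enum 'S_n] <= size [seq word s | s <- codes n])%N.
  by rewrite !size_map size_codes -card_Sn -sum1_card -sum1_size.
by have [_] := uniq_min_size uw sub sz.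
Qed.

Variable R : realFieldType.

Lemma sum_codes (q : R) F k : 0 <= q ->
  \sum_(s <- codes k) q ^+ sumn s * F s
  = (\prod_(i < k) qnat q i.+1) * code_mean succn (code_weight q) k F.
Proof.
move=> q0; elim: k F => [|k IH] F; first by rewrite big_ord0 /= big_seq1 expr0.
rewrite codesS big_allpairs_dep/= big_ord_recr/= -mulrA -code_meanZ -IH.
apply: eq_bigr => s _; rewrite -[0%N :: _]/(iota 0 k.+1) -[k.+1]subn0 -/(index_iota 0 k.+1) big_mkord.
rewrite !mulr_sumr; apply: eq_bigr => c _; rewrite sumn_rcons exprD -!mulrA; congr (_ * _).
rewrite -[qnat q (_ - _)]/(qnat q k.+1).
by rewrite [RHS]mulrCA mulVKf// gt_eqF// qnatS_gt0.
Qed.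

(** The weight [q ^+ inversion_number] is a product over the code entries: this is why the entries
    are independent, and the product of q-numbers is the normalization. *)
Lemma sum_perm_words (q : R) G : 0 <= q ->
  \sum_(u : 'S_n) q ^+ inversion_number (perm_word u) * G (perm_word u)
  = (\prod_(i < n) qnat q i.+1) * word_mean q n G.
Proof.
move=> q0; rewrite -(big_map perm_word xpredT (fun L => q ^+ inversion_number L * G L)).
rewrite -(perm_big _ words_perm) big_map -sum_codes// big_seq [RHS]big_seq.
by apply: eq_bigr => s /codesP[_ sc]; rewrite inversion_number_word.
Qed.

End PermWords.

(** * Lengths and descents in D_n *)

Ltac split_ifs :=
  repeat match goal with
  | |- context [if ?b then _ else _] =>
      lazymatch b with context [if _ then _ else _] => fail | _ => idtac end;
      let h := fresh in case: (boolP b) => h; try (exfalso; lia)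
  end.

Section SignedPermutations.
Variable m : nat.
Local Notation n := m.+2.
Implicit Types (w : {perm signed_point n}) (a b : signed_point n) (i : 'I_n).

Definition signed_val a : int := if a.2 then - (a.1.+1)%:Z else (a.1.+1)%:Z.

Lemma signed_val_neg a : signed_val (neg_point a) = - signed_val a.
Proof. by case: a => j [] /=; rewrite /signed_val/= ?opprK. Qed.

Lemma signed_val_inj : injective signed_val.
Proof.
move=> [i b] [j c]; rewrite /signed_val/=; case: b; case: c => h; try lia;
  by congr pair; apply: val_inj => /=; lia.
Qed.

Lemma neg_pointK : involutive (@neg_point n).
Proof. by case=> j b; rewrite /neg_point/= negbK. Qed.

(** The generator of index [k] as a map on integers, which turns statements about reflections into
    linear integer arithmetic. *)
Definition simple_action (k : nat) (v : int) : int :=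
  if k == 0%N then
    (if v == -1 then 2 else if v == 2 then -1
     else if v == 1 then -2 else if v == -2 then 1 else v)
  else if v == k%:Z then (k.+1)%:Z else if v == (k.+1)%:Z then k%:Z
  else if v == - k%:Z then - (k.+1)%:Z else if v == - (k.+1)%:Z then - k%:Z else v.

Lemma signed_val_tperm x y a :
  signed_val (tperm x y a) = if signed_val a == signed_val x then signed_val y
    else if signed_val a == signed_val y then signed_val x else signed_val a.
Proof.
rewrite !(inj_eq signed_val_inj); case: tpermP => [->|->|/eqP/negbTE-> /eqP/negbTE->//].
  by rewrite eqxx.
by rewrite eqxx; case: eqP => [->|].
Qed.

Lemma val_ordS0 i : i = 0%N :> nat -> ordS i = 1%N :> nat.
Proof. by move=> i0; rewrite /= i0 modn_small. Qed.

Lemma val_ord_pred i : i != 0%N :> nat -> ord_pred i = i.-1 :> nat.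
Proof.
move=> i0; rewrite /= -[nat_of_ord i in LHS]prednK ?lt0n// addSn/= modnDr modn_small//.
exact: leq_ltn_trans (leq_pred _) (ltn_ord i).
Qed.

Lemma signed_val_generator i a :
  signed_val (Dgenerator i a) = simple_action i (signed_val a).
Proof.
rewrite /Dgenerator /simple_action; case: ifP => [/eqP i0|/negbT i0]; rewrite permM !signed_val_tperm.
  have := val_ordS0 i0; rewrite /signed_val /= i0 => ->.
  by case: a => j [] /=; split_ifs; lia.
have := val_ord_pred i0; rewrite /signed_val /= => ->.
by case: a => j [] /=; split_ifs; lia.
Qed.

(** [root_lo i] and [root_hi i] are the two points that encode the simple root of the generator [i];
    for [i = 0] they are -1 and 2. The generator exchanges them, and it exchanges their
    negatives. *)
Definition root_lo i : signed_point n := if i == 0%N :> nat then (i, true) else (ord_pred i, false).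
Definition root_hi i : signed_point n := if i == 0%N :> nat then (ordS i, false) else (i, false).

Lemma signed_val_lo i : signed_val (root_lo i) = if i == 0%N :> nat then -1 else (i : nat)%:Z.
Proof.
rewrite /root_lo; case: ifP => [/eqP i0|/negbT i0]; first by rewrite /signed_val/= i0.
by have := val_ord_pred i0; rewrite /signed_val/= => ->; lia.
Qed.

Lemma signed_val_hi i : signed_val (root_hi i) = if i == 0%N :> nat then 2 else (i : nat).+1%:Z.
Proof.
rewrite /root_hi; case: ifP => [/eqP i0|/negbT i0]; last by [].
by have := val_ordS0 i0; rewrite /signed_val/= => ->.
Qed.

(** A simple reflection permutes the positive roots other than its own. The condition [u != - v]
    leaves out the pairs of opposite integers, which are no roots in type D and which [s_0] may
    reverse. *)
Lemma simple_action_mono k (u v : int) : u < v -> u != - v -> u != 0 -> v != 0 ->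
  ~ (u = (if k == 0%N then -1 else k%:Z) /\ v = (if k == 0%N then 2 else k.+1%:Z)) ->
  ~ (u = - (if k == 0%N then 2 else k.+1%:Z) /\ v = - (if k == 0%N then -1 else k%:Z)) ->
  simple_action k u < simple_action k v.
Proof. rewrite /simple_action; case: (k =P 0%N) => [k0|k0]; split_ifs; lia. Qed.

Lemma signed_val_neq0 a : signed_val a != 0.
Proof. by case: a => j [] /=; rewrite /signed_val/=; lia. Qed.

Lemma generator_mono i a b : signed_val a < signed_val b -> a != neg_point b ->
  (a, b) != (root_lo i, root_hi i) -> (a, b) != (neg_point (root_hi i), neg_point (root_lo i)) ->
  signed_val (Dgenerator i a) < signed_val (Dgenerator i b).
Proof.
move=> ab nab h1 h2; rewrite !signed_val_generator; apply: simple_action_mono => //.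
- by apply: contra nab => /eqP e; apply/eqP/signed_val_inj; rewrite signed_val_neg.
- exact: signed_val_neq0.
- exact: signed_val_neq0.
- move=> [e1 e2]; move: h1; rewrite xpair_eqE => /negP; apply; apply/andP; split; apply/eqP;
    apply: signed_val_inj; by rewrite ?signed_val_lo ?signed_val_hi.
- move=> [e1 e2]; move: h2; rewrite xpair_eqE => /negP; apply; apply/andP; split; apply/eqP;
    apply: signed_val_inj; by rewrite signed_val_neg ?signed_val_lo ?signed_val_hi.
Qed.

Lemma generatorK i : involutive (Dgenerator i).
Proof.
move=> a; apply: signed_val_inj; rewrite !signed_val_generator.
by rewrite /simple_action; case: ((i : nat) =P 0%N) => ?; split_ifs; lia.
Qed.

Lemma generator_neg i a : Dgenerator i (neg_point a) = neg_point (Dgenerator i a).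
Proof.
apply: signed_val_inj; rewrite signed_val_neg !signed_val_generator signed_val_neg.
by rewrite /simple_action; case: ((i : nat) =P 0%N) => ?; split_ifs; lia.
Qed.

Lemma generator_lo i : Dgenerator i (root_lo i) = root_hi i.
Proof.
apply: signed_val_inj; rewrite signed_val_generator signed_val_lo signed_val_hi.
by rewrite /simple_action; case: ((i : nat) =P 0%N) => ?; split_ifs; lia.
Qed.

Lemma generator_hi i : Dgenerator i (root_hi i) = root_lo i.
Proof. by rewrite -generator_lo generatorK. Qed.

Lemma lo_lt_hi i : signed_val (root_lo i) < signed_val (root_hi i).
Proof. by rewrite signed_val_lo signed_val_hi; case: eqP; lia. Qed.

Lemma lo_neq_neg_hi i : root_lo i != neg_point (root_hi i).
Proof.
apply/eqP => /(congr1 signed_val); rewrite signed_val_neg signed_val_lo signed_val_hi.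
by case: eqP; lia.
Qed.

Definition odd_map w := forall a, w (neg_point a) = neg_point (w a).

(** Each positive root is represented twice, by [(a, b)] and by [(-b, -a)], so the cardinality is
    twice the length. *)
Definition inversions w : {set signed_point n * signed_point n} :=
  [set p | [&& signed_val p.1 < signed_val p.2, p.1 != neg_point p.2
            & signed_val (w p.2) < signed_val (w p.1)]].

Definition simple_pairs i : {set signed_point n * signed_point n} :=
  [set (root_lo i, root_hi i); (neg_point (root_hi i), neg_point (root_lo i))].

Definition is_descent w i := signed_val (w (root_hi i)) < signed_val (w (root_lo i)).

Lemma card_simple_pairs i : #|simple_pairs i| = 2%N.
Proof.
rewrite cards2 xpair_eqE negb_and lo_neq_neg_hi//.
Qed.

Lemma inversions_cap w i : odd_map w ->
  inversions w :&: simple_pairs i = if is_descent w i then simple_pairs i else finset.set0.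
Proof.
move=> wodd; apply/setP => -[a b]; rewrite !inE/=.
have [/eqP[-> ->]|h1] /= := boolP ((a, b) == (root_lo i, root_hi i)).
  rewrite andbT lo_lt_hi lo_neq_neg_hi/= -/(is_descent w i).
  by case: ifP => _; rewrite !inE ?eqxx.
have [/eqP[-> ->]|h2] /= := boolP ((a, b) == (neg_point (root_hi i), neg_point (root_lo i))).
  rewrite andbT !signed_val_neg !wodd !signed_val_neg !ltrN2 lo_lt_hi neg_pointK.
  rewrite -/(is_descent w i) eq_sym lo_neq_neg_hi/=.
  by case: ifP => _; rewrite !inE ?eqxx ?orbT.
by rewrite andbF; case: ifP => _; rewrite !inE ?(negbTE h1) ?(negbTE h2).
Qed.

Lemma inversions_generator w i p : p \in inversions w :\: simple_pairs i ->
  (Dgenerator i p.1, Dgenerator i p.2) \in inversions (Dgenerator i * w)%g :\: simple_pairs i.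
Proof.
case: p => a b; rewrite !inE/= !negb_or !permM => /andP[/andP[h1 h2] /and3P[ab nab wab]].
rewrite generator_mono// -generator_neg (inj_eq perm_inj) nab !generatorK wab !andbT.
apply/andP; split; apply/eqP => -[e1 e2]; move: ab.
  rewrite -[a](generatorK i) -[b](generatorK i) e1 e2 generator_lo generator_hi.
  by rewrite ltNge ltW// lo_lt_hi.
rewrite -[a](generatorK i) -[b](generatorK i) e1 e2 !generator_neg generator_lo generator_hi.
by rewrite !signed_val_neg ltrN2 ltNge ltW// lo_lt_hi.
Qed.

Lemma generator_mulK i w : (Dgenerator i * (Dgenerator i * w))%g = w.
Proof. by apply/permP => a; rewrite !permM generatorK. Qed.

Lemma card_inversions_other i w :
  #|inversions (Dgenerator i * w)%g :\: simple_pairs i| = #|inversions w :\: simple_pairs i|.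
Proof.
have le v : (#|inversions v :\: simple_pairs i| <=
    #|inversions (Dgenerator i * v)%g :\: simple_pairs i|)%N.
  rewrite -(card_imset _ (_ : injective (fun p => (Dgenerator i p.1, Dgenerator i p.2)))).
    by apply/subset_leq_card/fintype.subsetP => _ /imsetP[p pv ->]; exact: inversions_generator.
  by move=> [a b] [c d] /= -[/perm_inj-> /perm_inj->].
by apply/eqP; rewrite eqn_leq le andbT -{2}(generator_mulK i w) le.
Qed.

Lemma odd_map_generator i w : odd_map w -> odd_map (Dgenerator i * w)%g.
Proof. by move=> wodd a; rewrite !permM generator_neg wodd. Qed.

Lemma is_descent_generator i w : odd_map w ->
  is_descent (Dgenerator i * w)%g i = ~~ is_descent w i.
Proof.
move=> wodd; rewrite /is_descent !permM generator_lo generator_hi -leNgt lt_neqAle.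
by rewrite (inj_eq signed_val_inj) (inj_eq perm_inj) -(inj_eq signed_val_inj) lt_eqF ?lo_lt_hi.
Qed.

Lemma card_inversions_generator i w : odd_map w ->
  (#|inversions (Dgenerator i * w)%g| + (if is_descent w i then 2 else 0) =
   #|inversions w| + (if is_descent w i then 0 else 2))%N.
Proof.
move=> wodd; rewrite -(cardsID (simple_pairs i) (inversions w)).
rewrite -(cardsID (simple_pairs i) (inversions (_ * w)%g)) card_inversions_other.
rewrite !inversions_cap//; last exact: odd_map_generator.
rewrite is_descent_generator//; case: is_descent => /=; rewrite ?cards0 ?card_simple_pairs; lia.
Qed.

End SignedPermutations.

Section Length.
Variable m : nat.
Local Notation n := m.+2.
Implicit Types (w v : {perm signed_point n}) (a b : signed_point n) (i : 'I_n).

Definition sign_parity w : bool := \big[addb/false]_(j < n) (w (j, false)).2.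

Lemma sign_parityE w : odd #|[set j : 'I_n | (w (j, false)).2]%SET| = sign_parity w.
Proof.
rewrite /sign_parity -sum1dep_card big_mkcond/=.
rewrite (big_morph odd oddD (erefl : odd 0 = false)).
by apply: eq_bigr => j _; case: (w _).2.
Qed.

Lemma mem_Dgroup {w} : reflect (odd_map w /\ sign_parity w = false) (w \in Dgroup n).
Proof.
rewrite inE sign_parityE; apply: (iffP andP) => -[h1 h2]; split.
- by move=> a; apply/eqP; exact: (forallP h1 a).
- exact/negbTE.
- by apply/forallP => a; rewrite h1.
- by rewrite h2.
Qed.

Lemma odd_map_sign w : odd_map w -> forall j s, w (j, s) = ((w (j, false)).1, s (+) (w (j, false)).2).
Proof.
move=> wodd j []; last by rewrite addFb -surjective_pairing.
by rewrite (wodd (j, false)) /neg_point.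
Qed.

Lemma odd_map_abs_inj w : odd_map w -> injective (fun j => (w (j, false)).1).
Proof.
move=> wodd j k /= jk; suff : (j, false) = (k, (w (j, false)).2 (+) (w (k, false)).2) by case.
apply: (@perm_inj _ w); rewrite [RHS]odd_map_sign// -jk -addbA addbb addbF.
by rewrite -surjective_pairing.
Qed.

Lemma odd_mapM v w : odd_map v -> odd_map w -> odd_map (v * w)%g.
Proof. by move=> vo wo a; rewrite !permM vo wo. Qed.

Lemma sign_parityM v w : odd_map v -> odd_map w ->
  sign_parity (v * w)%g = sign_parity v (+) sign_parity w.
Proof.
move=> vo wo; rewrite /sign_parity [in X in _ = _ (+) X](reindex_inj (odd_map_abs_inj vo))/=.
rewrite -big_split/=; apply: eq_bigr => j _.
by rewrite permM [v _]surjective_pairing odd_map_sign.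
Qed.

Lemma odd_map1 : odd_map (1 : {perm signed_point n})%g.
Proof. by move=> a; rewrite !perm1. Qed.

Lemma sign_parity1 : sign_parity 1%g = false.
Proof. by rewrite /sign_parity big1// => j _; rewrite perm1. Qed.

Lemma odd_mapV w : odd_map w -> odd_map w^-1%g.
Proof. by move=> wo a; apply: (@perm_inj _ w); rewrite wo !permKV. Qed.

Lemma sign_parityV w : odd_map w -> sign_parity w^-1%g = sign_parity w.
Proof.
move=> wo; have := sign_parityM wo (odd_mapV wo); rewrite mulgV sign_parity1.
by case: sign_parity; case: sign_parity.
Qed.

Lemma DgroupM v w : v \in Dgroup n -> w \in Dgroup n -> (v * w)%g \in Dgroup n.
Proof.
move=> /mem_Dgroup[vo vp] /mem_Dgroup[wo wp]; apply/mem_Dgroup; split.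
  exact: odd_mapM.
by rewrite sign_parityM// vp wp.
Qed.

Lemma Dgroup1 : 1%g \in Dgroup n.
Proof. by apply/mem_Dgroup; split; [exact: odd_map1|exact: sign_parity1]. Qed.

Lemma DgroupV w : (w^-1%g \in Dgroup n) = (w \in Dgroup n).
Proof.
suff h v : v \in Dgroup n -> v^-1%g \in Dgroup n.
  by apply/idP/idP => /h//; rewrite invgK.
move=> /mem_Dgroup[vo vp]; apply/mem_Dgroup; split; first exact: odd_mapV.
by rewrite sign_parityV.
Qed.

Lemma signed_val_lt0 a : (signed_val a < 0) = a.2.
Proof. by case: a => j [] /=; rewrite /signed_val/=; lia. Qed.

Lemma generator_Dgroup i : Dgenerator i \in Dgroup n.
Proof.
apply/mem_Dgroup; split; first by move=> a; exact: generator_neg.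
rewrite /sign_parity; under eq_bigr do rewrite -signed_val_lt0 signed_val_generator.
have [i0|i0] := eqVneq (i : nat) 0%N; last first.
  rewrite big1// => j _; rewrite /simple_action (negbTE i0) /signed_val/=.
  by split_ifs; lia.
rewrite i0 !big_ord_recl/= big1 => [|j _]; first by [].
rewrite /simple_action /signed_val/= /bump/=.
by split_ifs; lia.
Qed.

Lemma Dgroup_generator i w : ((Dgenerator i * w)%g \in Dgroup n) = (w \in Dgroup n).
Proof.
apply/idP/idP => [h|]; last exact: DgroupM (generator_Dgroup i).
by rewrite -(generator_mulK i w) DgroupM// generator_Dgroup.
Qed.

Definition line w (j : nat) : int := signed_val (w (inord j, false)).

Definition line_descent (z : nat -> int) (k : nat) : bool :=
  if k == 0%N then z 1%N + z 0%N < 0 else z k < z k.-1.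

Lemma inord_eq (j : 'I_n) (k : nat) : j = k :> nat -> j = inord k.
Proof. by move=> jk; apply: val_inj; rewrite /= inordK// -jk. Qed.

Lemma is_descentE w i : odd_map w -> is_descent w i = line_descent (line w) i.
Proof.
move=> wo; rewrite /is_descent /line_descent /root_hi /root_lo /line; case: ifP => [/eqP i0|/negbT i0].
  rewrite (inord_eq (val_ordS0 i0)) (inord_eq i0) -[(inord 0, true)]/(neg_point (inord 0, false)).
  by rewrite wo signed_val_neg; lia.
by rewrite (inord_eq (val_ord_pred i0)) -(inord_eq erefl).
Qed.

Lemma line_bounds w j : `|line w j| <= n%:Z.
Proof. by rewrite /line /signed_val; case: ifP => _; have := ltn_ord (w (inord j, false)).1; lia. Qed.

Lemma line_neq0 w j : line w j != 0.
Proof. exact: signed_val_neq0. Qed.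

Lemma line_inj w j k : (j < n)%N -> (k < n)%N -> line w j = line w k -> j = k.
Proof.
move=> jn kn /signed_val_inj/perm_inj[] /(congr1 (@nat_of_ord _)).
by rewrite !inordK.
Qed.

(** Without descents the line increases and its first two entries have positive sum, so only the
    first entry can be negative; the even number of signs excludes this too. An increasing line of
    [n] positive integers up to [n] is the identity. *)
Lemma no_descent w : w \in Dgroup n -> (forall i, ~~ is_descent w i) -> w = 1%g.
Proof.
move=> /mem_Dgroup[wo wp] nd; set z := line w.
have zS k : (k.+1 < n)%N -> z k < z k.+1.
  move=> kn; have := nd (inord k.+1); rewrite is_descentE// inordK// /line_descent/= -leNgt => h.
  rewrite lt_neqAle h andbT; apply/eqP => /(line_inj (ltnW kn) kn)/eqP.
  by rewrite ltn_eqF.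
have z01 : 0 < z 1%N.
  have := nd ord0; rewrite is_descentE// /line_descent/= -/z.
  by have := zS 0%N isT; lia.
have zpos k : (0 < k < n)%N -> 0 < z k.
  elim: k => // -[|k] IH //= kn; have := zS _ kn.
  by have := IH (ltnW kn); lia.
have z0 : 0 < z 0%N.
  have : sign_parity w = (z 0%N < 0).
    rewrite /sign_parity big_ord_recl big1 ?addbF => [|j _].
      by rewrite -signed_val_lt0 /z /line (inord_eq (erefl : ord0 = 0%N :> nat)).
    rewrite -signed_val_lt0 [lift _ _](inord_eq erefl) -/(line w _) -/z.
    by have := zpos (lift ord0 j); rewrite ltn_ord => /(_ isT) h; rewrite lt_gtF.
  by rewrite wp; have := line_neq0 w 0; rewrite -/z; lia.
have zlo k : (k < n)%N -> k.+1%:Z <= z k.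
  elim: k => [|k IH] kn; first by lia.
  by have := zS _ kn; have := IH (ltnW kn); lia.
have zhi k : (k < n)%N -> z (n.-1 - k)%N <= (n - k)%N%:Z.
  elim: k => [|k IH] kn.
    by rewrite !subn0; have := line_bounds w n.-1; rewrite -/z; lia.
  have h : (n.-1 - k)%N = (n.-1 - k.+1).+1 by lia.
  have h2 : ((n.-1 - k.+1).+1 < n)%N by lia.
  have := zS _ h2; rewrite -h; have := IH (ltnW kn); lia.
have zE k : (k < n)%N -> z k = k.+1%:Z.
  move=> kn; have := zlo _ kn; have kn' : (n.-1 - k < n)%N by lia.
  have := zhi _ kn'; rewrite (_ : (n.-1 - (n.-1 - k) = k)%N); last by lia.
  by lia.
have wE j : w (j, false) = (j, false).
  apply: signed_val_inj; have := zE j (ltn_ord j); rewrite /z /line -(inord_eq erefl) => ->.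
  by [].
apply/permP => -[j s]; rewrite perm1 odd_map_sign// wE.
by rewrite addbF.
Qed.

Lemma word_inversions w k : is_word_of (Dgenerators n) w k ->
  odd_map w /\ (#|inversions w| <= k.*2)%N.
Proof.
case/existsP => t /andP[tS /eqP ->].
suff : odd_map (\prod_(s <- t) s)%g /\ (#|inversions (\prod_(s <- t) s)%g| <= (size t).*2)%N.
  by rewrite size_tuple.
elim: (tval t) tS => [_|s r IH /= /andP[/imsetP[i _ ->] /IH[ro rk]]].
  rewrite big_nil; split; first exact: odd_map1.
  rewrite leqn0 cards_eq0; apply/eqP/setP => p; rewrite !inE !perm1.
  by case: ltgtP => //; rewrite ?andbF.
rewrite big_cons; split; first exact: odd_map_generator.
have h := card_inversions_generator i ro.
have : (#|inversions (Dgenerator i * \prod_(s <- r) s)%g| <= #|inversions (\prod_(s <- r) s)%g| + 2)%N by move: h; case: is_descent; lia.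
by move=> h2; apply: leq_trans h2 (leq_trans (leq_add rk (leqnn 2)) _); rewrite doubleS addn2.
Qed.

Lemma inversions_word w : w \in Dgroup n ->
  exists2 k, is_word_of (Dgenerators n) w k & #|inversions w| = k.*2.
Proof.
have [N] := ubnP #|inversions w|; elim: N w => // N IH w wN wD.
have [i di|nd] := pickP (is_descent w); last first.
  have -> : w = 1%g by apply: no_descent => // i; rewrite nd.
  have w1 : is_word_of (Dgenerators n) 1 0.
    by apply/existsP; exists [tuple]; rewrite /= big_nil eqxx.
  exists 0%N => //; have [_] := word_inversions w1.
  by rewrite leqn0 => /eqP.
have [wo _] := mem_Dgroup wD; have := card_inversions_generator i wo; rewrite di => wc.
have [||k /existsP[t /andP[tS /eqP tE]] kE] := IH (Dgenerator i * w)%g.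
- by lia.
- by rewrite Dgroup_generator.
exists k.+1; last by lia.
apply/existsP; exists [tuple of Dgenerator i :: t]; rewrite /= tS andbT big_cons -tE generator_mulK eqxx andbT.
exact: imset_f.
Qed.

Lemma is_word_of_gen w k : is_word_of (Dgenerators n) w k -> w \in <<Dgenerators n>>%g.
Proof.
case/existsP => t /andP[/allP tS /eqP ->]; rewrite big_seq.
by apply: group_prod => s /tS; exact: mem_gen.
Qed.

(** A generator changes the number of inversions by 2, which bounds the length from below; as every
    element but the identity has a descent, removing descents one by one attains the bound. *)
Lemma Dlength_inversions w : w \in Dgroup n -> (Dlength w).*2 = #|inversions w|.
Proof.
move=> wD; have [k wk kE] := inversions_word wD.
rewrite /Dlength /word_length; destruct idP as [wS|nS]; last by case: nS; exact: is_word_of_gen wk.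
case: ex_minnP => l wl /(_ k wk) lk; have [_] := word_inversions wl.
by rewrite kE leq_double => kl; congr double; apply/eqP; rewrite eqn_leq lk kl.
Qed.

Lemma Dlength_generator i w : w \in Dgroup n ->
  (Dlength (Dgenerator i * w)%g + is_descent w i = Dlength w + ~~ is_descent w i)%N.
Proof.
move=> wD; have [wo _] := mem_Dgroup wD.
have := card_inversions_generator i wo.
rewrite -(Dlength_inversions wD) -Dlength_inversions ?Dgroup_generator//.
by case: is_descent => /=; lia.
Qed.

Lemma Dgenerator_inj : injective (@Dgenerator n).
Proof.
move=> i j ij; have e a := congr1 (fun s : {perm signed_point n} => signed_val (s a)) ij.
have {}e a : simple_action i (signed_val a) = simple_action j (signed_val a).
  by rewrite -!signed_val_generator; exact: e.
apply: val_inj => /=.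
have := e (root_hi i); have := e (root_hi j); rewrite !signed_val_hi /simple_action.
by case: ((i : nat) =P 0%N); case: ((j : nat) =P 0%N) => ? ?; split_ifs; lia.
Qed.

Lemma desE w : w \in Dgroup n -> des w = (\sum_(i < n) is_descent w i)%N.
Proof.
move=> wD; rewrite /des.
have -> : [set s in Dgenerators n | (Dlength (s * w)%g < Dlength w)%N]%SET
   = [set Dgenerator i | i in [set i | is_descent w i]%SET]%SET.
  apply/setP => s; rewrite !inE; apply/andP/imsetP => [[/imsetP[i _ ->]]|[i]].
    have h := Dlength_generator i wD => lt; exists i => //; rewrite inE.
    by apply: contraLR lt => /negbTE di; rewrite -leqNgt; move: h; rewrite di addn0 addn1 => ->.
  rewrite inE => di ->; split; first exact: imset_f.
  by have := Dlength_generator i wD; rewrite di addn0 addn1 => <-.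
rewrite card_imset; last exact: Dgenerator_inj.
by rewrite -sum1dep_card big_mkcond.
Qed.

Lemma card_inversionsV w : odd_map w -> #|inversions w^-1%g| = #|inversions w|.
Proof.
suff le v : odd_map v -> (#|inversions v^-1%g| <= #|inversions v|)%N.
  move=> wo; apply/eqP; rewrite eqn_leq le//= -{1}[w]invgK le//.
  exact: odd_mapV.
move=> vo; pose f (p : signed_point n * signed_point n) := (v^-1%g p.2, v^-1%g p.1).
rewrite -(card_imset _ (_ : injective f)); last by move=> [a b] [c d] /= -[/perm_inj-> /perm_inj->].
apply/subset_leq_card/fintype.subsetP => _ /imsetP[[a b] + ->]; rewrite !inE/= !permKV.
move=> /and3P[-> nab ->]; rewrite andbT/=; apply: contra nab => /eqP e; apply/eqP.
have := congr1 v e; rewrite vo !permKV => ->.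
by rewrite neg_pointK.
Qed.

Lemma DlengthV w : w \in Dgroup n -> Dlength w^-1%g = Dlength w.
Proof.
move=> wD; apply: double_inj; rewrite !Dlength_inversions ?DgroupV//.
by apply: card_inversionsV; have [] := mem_Dgroup wD.
Qed.

End Length.

(** * Jumps of the two-sided descent number *)

Definition line_action (k : nat) (z : nat -> int) (j : nat) : int :=
  if k == 0%N then (if j == 0%N then - z 1%N else if j == 1%N then - z 0%N else z j)
  else if j == k then z k.-1 else if j == k.-1 then z k else z j.

(** For [k > 0] the swap of an ascent raises the entry [k.-1] and lowers the entry [k]; for [k = 0]
    it lowers the first two entries and keeps their order. At the other indices this can only
    destroy descents. *)
Lemma line_action_other k t z : line_descent z k = false -> t != k ->
  line_descent (line_action k z) t -> line_descent z t.
Proof.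
rewrite /line_descent /line_action.
case: k => [|k] /=; case: t => [|t] //=.
- by case: t => [|[|t]] /=; lia.
- case: k => [|[|k]] /=; lia.
move=> h; rewrite eqSS => tk; rewrite (negbTE tk).
case: (t =P k.+1) => [->|?]; first by rewrite (_ : (k.+2 == k) = false); lia.
by case: (t.+1 =P k) => [kE|?]; [rewrite -kE in h *; lia|lia].
Qed.

(** The edges of the Coxeter diagram of type D: the path 1, 2, 3, ... with the node 0 attached to
    2. *)
Definition neighbours (k t : nat) : bool :=
  [|| (0 < k)%N && (t == k.+1), (0 < t)%N && (k == t.+1),
      (k == 0%N) && (t == 2%N) | (k == 2%N) && (t == 0%N)].

Lemma line_action_far k t z : t != k -> ~~ neighbours k t ->
  line_descent (line_action k z) t = line_descent z t.
Proof.
rewrite /neighbours /line_descent /line_action.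
case: k => [|k] /=; case: t => [|t] //=.
- by case: t => [|[|t]] //= _ _; lia.
- by case: k => [|[|k]] //= _ _; lia.
rewrite !eqSS => tk; rewrite (negbTE tk) => far.
have -> : (t == k.+1) = false by lia.
have -> : (t.+1 == k) = false by lia.
by [].
Qed.

(** Only the relative order of three consecutive letters matters. If they are monotone, neither swap
    affects the other descent; in the four other orders exactly one of the two swaps does. *)
Lemma line_action_edge k z : (0 < k)%N ->
  z k.-1 != z k -> z k != z k.+1 -> z k.-1 != z k.+1 ->
  (if line_descent z k then -1 else 1)
    * ((line_descent (line_action k z) k.+1)%:Z - (line_descent z k.+1)%:Z)
  + (if line_descent z k.+1 then -1 else 1)
    * ((line_descent (line_action k.+1 z) k)%:Z - (line_descent z k)%:Z)
  = - (line_descent z k != line_descent z k.+1)%:Z.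
Proof.
case: k => // k _ /=; rewrite /line_descent /line_action /= !eqxx.
have -> : (k.+2 == k.+1) = false by lia.
have -> : (k.+2 == k) = false by lia.
have -> : (k == k.+2) = false by lia.
have -> : (k == k.+1) = false by lia.
have -> : (k.+1 == k.+2) = false by lia.
move: (z k) (z k.+1) (z k.+2) => a b c ab bc ac.
by case: (ltgtP b a) => ?; case: (ltgtP c b) => ?; case: (ltgtP c a) => ? /=; lia.
Qed.

Section Jumps.
Variable m : nat.
Local Notation n := m.+2.
Implicit Types (w v : {perm signed_point n}) (a b : signed_point n) (i : 'I_n).

Lemma line_generator i w j : odd_map w -> (j < n)%N ->
  line (Dgenerator i * w)%g j = line_action i (line w) j.
Proof.
move=> wo jn; rewrite /line permM.
have sv k (b : bool) : (k < n)%N -> signed_val ((inord k, b) : signed_point n) = if b then - k.+1%:Z else k.+1%:Z.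
  by move=> kn; rewrite /signed_val/= inordK.
have pt k (b : bool) : (k < n)%N -> simple_action i j.+1%:Z = signed_val ((inord k, b) : signed_point n) ->
    Dgenerator i (inord j, false) = (inord k, b).
  by move=> kn e; apply: signed_val_inj; rewrite signed_val_generator sv.
rewrite /line_action; have in_ := ltn_ord i; have [i0|i0] := eqVneq (i : nat) 0%N.
  have [j0|j0] := eqVneq j 0%N.
    rewrite (pt 1%N true isT); first by rewrite (wo (inord 1, false)) signed_val_neg.
    by rewrite sv// i0 j0.
  have [j1|j1] := eqVneq j 1%N.
    rewrite (pt 0%N true isT); first by rewrite (wo (inord 0, false)) signed_val_neg.
    by rewrite sv// i0 j1.
  rewrite (pt j false jn)// sv// /simple_action i0/=; split_ifs; lia.
have i1n : (i.-1 < n)%N by lia.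
have [ji|ji] := eqVneq j i.
  rewrite (pt i.-1 false i1n)// sv// /simple_action (negbTE i0); split_ifs; lia.
have [ji1|ji1] := eqVneq j i.-1.
  rewrite (pt i false in_)// sv// /simple_action (negbTE i0); split_ifs; lia.
rewrite (pt j false jn)// sv// /simple_action (negbTE i0); split_ifs; lia.
Qed.

Lemma is_descent_line i w t : odd_map w ->
  is_descent (Dgenerator i * w)%g t = line_descent (line_action i (line w)) t.
Proof.
move=> wo; rewrite is_descentE; last exact: odd_map_generator.
rewrite /line_descent; case: eqP => [t0|t0].
  by rewrite !line_generator.
by rewrite !line_generator//; exact: leq_ltn_trans (leq_pred _) (ltn_ord t).
Qed.

(** The part of [jump] due to the descent at [t] of [w]; [left_jump] is the part due to the descent
    at [t] of the inverse. The sign orients both from the shorter to the longer element, so they are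
    functions of the pair alone. *)
Definition right_jump i (t : 'I_n) w : int := (if is_descent w i then -1 else 1)
  * ((is_descent (Dgenerator i * w)%g t)%:Z - (is_descent w t)%:Z).

Definition left_jump i (t : 'I_n) w : int := (if is_descent w i then -1 else 1)
  * ((is_descent (Dgenerator i * w)^-1%g t)%:Z - (is_descent w^-1%g t)%:Z).

(* The increase of the two-sided descent number from the shorter to the longer
   of w and s_i * w. *)
Definition jump i w : int := (if is_descent w i then -1 else 1)
  * ((two_sided_des (Dgenerator i * w)%g)%:Z - (two_sided_des w)%:Z).

Lemma natz_sum k (P : 'I_k -> bool) : (\sum_(t < k) P t)%N%:Z = \sum_(t < k) (P t)%:Z.
Proof. by rewrite -[LHS]natz natr_sum; apply: eq_bigr => t _; rewrite natz. Qed.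

Lemma jumpE i w : w \in Dgroup n ->
  jump i w = \sum_(t < n) right_jump i t w + \sum_(t < n) left_jump i t w.
Proof.
move=> wD; rewrite /jump /two_sided_des !desE ?DgroupV ?Dgroup_generator//.
rewrite /right_jump /left_jump -!mulr_sumr !sumrB -mulrDr; congr (_ * _).
by rewrite !PoszD !natz_sum; ring.
Qed.

Lemma right_jump_generator i t w : odd_map w ->
  right_jump i t (Dgenerator i * w)%g = right_jump i t w.
Proof.
move=> wo; rewrite /right_jump generator_mulK is_descent_generator//.
by case: is_descent => /=; lia.
Qed.

Lemma left_jump_generator i t w : odd_map w ->
  left_jump i t (Dgenerator i * w)%g = left_jump i t w.
Proof.
move=> wo; rewrite /left_jump generator_mulK is_descent_generator//.
by case: is_descent => /=; lia.
Qed.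

Lemma jump_generator i w : w \in Dgroup n -> jump i (Dgenerator i * w)%g = jump i w.
Proof.
move=> wD; have [wo _] := mem_Dgroup wD.
rewrite !jumpE ?Dgroup_generator//; congr (_ + _); apply: eq_bigr => t _.
  exact: right_jump_generator.
exact: left_jump_generator.
Qed.

Lemma right_jump_same i w : odd_map w -> right_jump i i w = 1.
Proof.
move=> wo; rewrite /right_jump is_descent_generator//.
by case: is_descent.
Qed.

Lemma right_jump_other i t w : odd_map w -> t != i ->
  - (neighbours i t)%:Z <= right_jump i t w <= 0.
Proof.
move=> wo ti; wlog nd : w wo / is_descent w i = false.
  move=> h; have [d|] := boolP (is_descent w i); last by move=> /negbTE /(h w wo).
  rewrite -right_jump_generator//; apply: h; first exact: odd_map_generator.
  by rewrite is_descent_generator// d.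
have := nd; rewrite is_descentE// => zi.
rewrite /right_jump nd mul1r is_descent_line// is_descentE//.
have := line_action_other zi ti.
have := @line_action_far i t (line w) ti.
case: neighbours => /= [_|/(_ isT)->]; last by lia.
by case: (line_descent (line_action _ _) _) => [/(_ isT)->|_] //; case: line_descent.
Qed.

Lemma sum_eq_le1 (y : nat) : (\sum_(k < n) (k == y :> nat) <= 1)%N.
Proof.
have [yk|yk] := ltnP y n.
  by rewrite (bigD1 (Ordinal yk))//= eqxx big1// => k /negbTE; rewrite -val_eqE/= => ->.
by rewrite big1// => k _; rewrite ltn_eqF// (leq_trans _ yk).
Qed.

(** The descent at [i] itself contributes 1, and each of its at most three neighbours in the Coxeter
    diagram contributes -1 or 0. *)
Lemma sum_right_jump_bounds i w : odd_map w ->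
  -2 <= \sum_(t < n) right_jump i t w <= 1.
Proof.
move=> wo; rewrite (bigD1 i)//= right_jump_same//; apply/andP; split; last first.
  rewrite gerDl sumr_le0// => t ti; by have /andP[] := right_jump_other wo ti.
have nb : (\sum_(t < n) neighbours i t <= 1 + 1 + 1)%N.
  apply: (@leq_trans (\sum_(t < n) ((t == i.+1 :> nat) + (t == i.-1 :> nat)
      + (t == (if i == 0%N :> nat then 2 else 0)%N :> nat)))%N).
    by apply: leq_sum => t _; rewrite /neighbours; case: ((i : nat) =P 0%N) => ?; lia.
  by rewrite !big_split/=; apply: leq_add; [apply: leq_add|]; exact: sum_eq_le1.
have : - (\sum_(t < n) neighbours i t)%N%:Z <= \sum_(t < n | t != i) right_jump i t w.
  rewrite natz_sum -sumrN (bigD1 i)//= -[leRHS]add0r; apply: lerD; first by case: neighbours.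
  by apply: ler_sum => t ti; have /andP[] := right_jump_other wo ti.
move: nb; set S := (\sum_(t < n) neighbours i t)%N => nb h.
have {}nb : S%:Z <= 3 by rewrite lez_nat.
by rewrite -[-2](_ : 1 - 3 = _)// lerD2l; apply: le_trans h; rewrite lerN2.
Qed.

Definition boundary_switches (w : {perm signed_point n}) : nat :=
  (\sum_(k < m) (line_descent (line w) k.+1 != line_descent (line w) k.+2))%N.

Lemma sum_pick (g : nat -> int) (y : nat) :
  \sum_(t < n) (t == y :> nat)%:R * g t = if (y < n)%N then g y else 0.
Proof.
case: ltnP => yn.
  rewrite (bigD1 (Ordinal yn))//= eqxx mul1r big1 ?addr0// => t /negbTE.
  by rewrite -val_eqE/= => ->; rewrite mul0r.
by rewrite big1// => t _; rewrite ltn_eqF ?mul0r// (leq_trans _ yn).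
Qed.

Lemma sum_shift (g : nat -> nat -> int) :
  \sum_(i < n) \sum_(t < n) ((0 < i)%N && (t == i.+1 :> nat))%:R * g i t
  = \sum_(k < m) g k.+1 k.+2.
Proof.
rewrite big_ord_recl big1 ?add0r => [|t _]; last by rewrite mul0r.
rewrite big_ord_recr/= [X in _ + X]big1 ?addr0 => [|t _]; last first.
  by rewrite /bump/= (_ : (t == m.+2 :> nat) = false) ?mul0r// ltn_eqF.
apply: eq_bigr => k _; rewrite /bump/= !add1n.
by rewrite sum_pick ifT//; have := ltn_ord k; lia.
Qed.

(** The diagonal gives [n]. Along the path the two directions of an edge add up to minus a switch,
    by [line_action_edge]. The edge between 0 and 2, taken in both directions, is the error 2. *)
Lemma sum_right_jump w : odd_map w ->
  `| \sum_(i < n) \sum_(t < n) right_jump i t w - (n%:Z - (boundary_switches w)%:Z) | <= 2.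
Proof.
move=> wo.
pose f (i t : nat) : int := right_jump (inord i) (inord t) w.
have fE i t : right_jump i t w = f i t by rewrite /f -(@inord_eq m i i)// -(@inord_eq m t t).
have split4 i t : right_jump i t w = (t == i)%:R + (((0 < i)%N && (t == i.+1 :> nat))%:R * f i t
   + ((0 < t)%N && (i == t.+1 :> nat))%:R * f i t) +
   (((i == 0%N :> nat) && (t == 2%N :> nat))%:R * f i t
     + ((t == 0%N :> nat) && (i == 2%N :> nat))%:R * f i t).
  rewrite -fE; have [->|ti] := eqVneq t i.
    rewrite right_jump_same// (_ : (i == i.+1 :> nat) = false); last by lia.
    rewrite !andbF !mul0r; case: ((i : nat) =P 0%N) => [->|]; rewrite ?mul0r ?addr0//.
  have ti' : (t != i :> nat) by [].
  rewrite add0r -!mulrDl -!natrD.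
  have -> : ((0 < i) && (t == i.+1 :> nat) + (0 < t) && (i == t.+1 :> nat)
     + ((i == 0 :> nat) && (t == 2%N :> nat) + (t == 0 :> nat) && (i == 2%N :> nat)))%N = neighbours i t :> nat.
    by rewrite /neighbours; lia.
  have := right_jump_other wo ti; case: neighbours; first by rewrite mul1r.
  by rewrite mul0r; lia.
rewrite (eq_bigr (fun i : 'I_n => 1 + (\sum_(t < n) ((0 < i)%N && (t == i.+1 :> nat))%:R * f i t
   + \sum_(t < n) ((0 < t)%N && (i == t.+1 :> nat))%:R * f i t) +
   ((i == 0%N :> nat)%:R * (if (2 < n)%N then f 0%N 2%N else 0)
     + (i == 2%N :> nat)%:R * (if (0 < n)%N then f 2%N 0%N else 0)))); last first.
  move=> i _; rewrite (eq_bigr _ (fun t _ => split4 i t)) !big_split/=.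
  congr (_ + _ + (_ + _)).
  - by rewrite (bigD1 i)//= eqxx big1 ?addr0// => t /negbTE->.
  - rewrite -(sum_pick (f 0%N)) mulr_sumr; apply: eq_bigr => t _; rewrite mulrA -natrM mulnb.
    by case: ((i : nat) =P 0%N) => [->|]; rewrite ?mul0r.
  - have e := sum_pick (f 2%N) 0%N; rewrite /= in e; rewrite -e mulr_sumr; apply: eq_bigr => t _; rewrite mulrA -natrM mulnb andbC.
    by case: ((i : nat) =P 2%N) => [->|]; rewrite ?andbF ?mul0r.
rewrite !big_split/= sumr_const card_ord sum_shift [X in _ + (_ + X) + _]exchange_big/= (sum_shift (fun i t : nat => f t i)).
rewrite (sum_pick (fun=> if (2 < n)%N then f 0%N 2%N else 0)) (sum_pick (fun=> if (0 < n)%N then f 2%N 0%N else 0)).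
have edge k : (k < m)%N -> f k.+1 k.+2 + f k.+2 k.+1
    = - (line_descent (line w) k.+1 != line_descent (line w) k.+2)%:Z.
  move=> km; rewrite /f /right_jump !is_descent_line// !is_descentE// !inordK; [|lia..].
  apply: line_action_edge => //=; apply/eqP => /line_inj; lia.
rewrite -big_split/= (eq_bigr (fun k : 'I_m => - (line_descent (line w) k.+1 != line_descent (line w) k.+2)%:Z)); last first.
  by move=> k _; rewrite edge.
have weaken i t : t != i -> -1 <= right_jump i t w <= 0.
  move=> ti; have /andP[h1 ->] := right_jump_other wo ti.
  by rewrite andbT; apply: le_trans h1; case: neighbours.
have b2 : (2 < n)%N -> -1 <= f 0%N 2%N <= 0.
  by move=> h; apply: weaken; rewrite -val_eqE/= !inordK.
have b3 : (2 < n)%N -> -1 <= f 2%N 0%N <= 0.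
  by move=> h; apply: weaken; rewrite -val_eqE/= !inordK.
rewrite sumrN -natz_sum -/(boundary_switches w) /=.
rewrite natz; move: (boundary_switches w) => S.
case: (ltnP 2 n) b2 b3 => [_ /(_ isT) b2 /(_ isT) b3|_ _ _]; lia.
Qed.

(** [w] carries the root of [i] to the root of [t] up to sign; in the usual notation
    [w s_i = s_t w]. *)
Definition link i (t : 'I_n) w : bool := (w (root_lo i), w (root_hi i)) \in
  [:: (root_lo t, root_hi t); (neg_point (root_hi t), neg_point (root_lo t));
      (root_hi t, root_lo t); (neg_point (root_lo t), neg_point (root_hi t))].

Lemma link_generator i t w : link i t (Dgenerator i * w)%g = link i t w.
Proof.
rewrite /link !permM generator_lo generator_hi !inE !xpair_eqE.
by do 8?[case: eqP => ?]; rewrite ?andbT ?andbF ?orbT ?orbF.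
Qed.

Lemma link_inverse i t w : odd_map w -> link i t w = link t i w^-1%g.
Proof.
move=> wo; have vo := odd_mapV wo.
have e a b : (w a == b) = (w^-1%g b == a).
  by apply/eqP/eqP => <-; rewrite ?permK ?permKV.
have ng a b : (neg_point a == b) = (a == neg_point b).
  by rewrite -(inj_eq (can_inj (@neg_pointK m))) neg_pointK.
rewrite /link !inE !xpair_eqE !e !vo !ng.
by do 8?[case: eqP => ?]; rewrite ?andbT ?andbF ?orbT ?orbF.
Qed.

Lemma generatorV i a : (Dgenerator i)^-1%g a = Dgenerator i a.
Proof. by apply: (@perm_inj _ (Dgenerator i)); rewrite permKV generatorK. Qed.

Lemma generator_lt i a b : a != b -> a != neg_point b ->
  (a, b) \notin [:: (root_lo i, root_hi i); (neg_point (root_hi i), neg_point (root_lo i));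
    (root_hi i, root_lo i); (neg_point (root_lo i), neg_point (root_hi i))] ->
  (signed_val (Dgenerator i b) < signed_val (Dgenerator i a)) = (signed_val b < signed_val a).
Proof.
move=> ab nab; rewrite !inE !negb_or => /and4P[h1 h2 h3 h4].
have sw (x y : signed_point n) (c d : signed_point n) : ((x, y) != (c, d)) = ((y, x) != (d, c)).
  by rewrite !xpair_eqE andbC.
case: (ltgtP (signed_val a) (signed_val b)) => [lt|lt|/signed_val_inj/eqP]; last by rewrite (negbTE ab).
  by rewrite ltNge ltW// generator_mono.
rewrite generator_mono// 1?sw//.
by apply: contra nab => /eqP->; rewrite neg_pointK.
Qed.

(** Passing to [s_i w] applies [s_i] to the values of the inverse. This reverses the order of the
    two values that decide the descent at [t] only if they form the root of [i] up to sign, and then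
    an ascent becomes a descent. *)
Lemma left_jumpE i t w : odd_map w -> left_jump i t w = (link i t w)%:Z.
Proof.
move=> wo; wlog nd : w wo / is_descent w i = false.
  move=> h; have [d|] := boolP (is_descent w i); last by move=> /negbTE /(h w wo).
  rewrite -left_jump_generator// -link_generator; apply: h; first exact: odd_map_generator.
  by rewrite is_descent_generator// d.
have vo := odd_mapV wo.
rewrite /left_jump nd mul1r /is_descent invMg !permM !generatorV.
have [|nl] := boolP (link i t w); last first.
  rewrite generator_lt ?subrr//.
  - by rewrite (inj_eq perm_inj) -(inj_eq (@signed_val_inj m)) lt_eqF// lo_lt_hi.
  - by rewrite -vo (inj_eq perm_inj) lo_neq_neg_hi.
  - by move: nl; rewrite link_inverse.
have nd' : signed_val (w (root_lo i)) <= signed_val (w (root_hi i)).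
  by rewrite leNgt; move: nd; rewrite /is_descent => ->.
have wK a b : w a = b -> w^-1%g b = a by move=> <-; rewrite permK.
rewrite /link !inE => /or4P[] /eqP[e1 e2].
- rewrite (wK _ _ e1) (wK _ _ e2) generator_lo generator_hi lo_lt_hi.
  by rewrite (lt_gtF (lo_lt_hi i)).
- have e3 : w (neg_point (root_lo i)) = root_hi t by rewrite wo e1 neg_pointK.
  have e4 : w (neg_point (root_hi i)) = root_lo t by rewrite wo e2 neg_pointK.
  rewrite (wK _ _ e3) (wK _ _ e4) !generator_neg generator_lo generator_hi !signed_val_neg !ltrN2 lo_lt_hi.
  by rewrite (lt_gtF (lo_lt_hi i)).
- by move: nd'; rewrite e1 e2 leNgt lo_lt_hi.
- by move: nd'; rewrite e1 e2 !signed_val_neg lerN2 leNgt lo_lt_hi.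
Qed.

Definition consecutive_links (w : {perm signed_point n}) : nat :=
  (\sum_(k < m.+1) (`|line w k.+1 - line w k| == 1))%N.

Lemma linkE i t w : link i t w =
  let p := signed_val (w (root_lo i)) in let r := signed_val (w (root_hi i)) in
  let x := signed_val (root_lo t) in let y := signed_val (root_hi t) in
  [|| (p == x) && (r == y), (p == - y) && (r == - x), (p == y) && (r == x) | (p == - x) && (r == - y)].
Proof.
rewrite /link !inE !xpair_eqE /= -!(inj_eq (@signed_val_inj m)) !signed_val_neg.
by [].
Qed.

Lemma sum_link_le1 i w : (\sum_(t < n) link i t w <= 1)%N.
Proof.
set p := signed_val (w (root_lo i)); set r := signed_val (w (root_hi i)).
(* [y] is the only possible [t]. A root with [t > 0] joins [t] and [t + 1] up to sign, so [t] is the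
   smaller absolute value; the root of 0 joins -1 and 2, whose difference is 3. *)
pose y : nat := if `|p - r| == 1 then minn `|p|%N `|r|%N else 0%N.
apply: leq_trans (sum_eq_le1 y); apply: leq_sum => t _.
rewrite linkE /= -/p -/r signed_val_lo signed_val_hi /y.
by case: ifP => t0; case: ifP => ?; lia.
Qed.

(** Links between generators of positive index are exactly neighbouring entries that differ by 1.
    The row and the column of the generator 0 add at most 1 each. *)
Lemma sum_link w : odd_map w ->
  (consecutive_links w <= \sum_(i < n) \sum_(t < n) link i t w <= consecutive_links w + 2)%N.
Proof.
move=> wo; rewrite big_ord_recl /=.
have A := sum_link_le1 ord0 w.
have B : (\sum_(i < n) link i ord0 w <= 1)%N.
  by apply: leq_trans (sum_link_le1 ord0 w^-1%g); apply: leq_sum => i _; rewrite link_inverse.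
have C (k : 'I_m.+1) : (\sum_(t < n) link (lift ord0 k) t w)%N
    = ((`|line w k.+1 - line w k| == 1) + link (lift ord0 k) ord0 w)%N.
  rewrite big_ord_recl addnC; congr addn.
  have kn : (k.+1 < n)%N by have := ltn_ord k; lia.
  have lo : signed_val (w (root_lo (lift ord0 k))) = line w k.
    by rewrite /root_lo /= /line (@inord_eq m (ord_pred _) k)// val_ord_pred.
  have hi : signed_val (w (root_hi (lift ord0 k))) = line w k.+1.
    by rewrite /root_hi /= /line -(@inord_eq m (lift ord0 k) k.+1).
  have b0 := line_bounds w k; have b1 := line_bounds w k.+1.
  have z0 := line_neq0 w k; have z1 := line_neq0 w k.+1.
  rewrite (eq_bigr (fun t : 'I_m.+1 => ((t == (minn `|line w k|%N `|line w k.+1|%N).-1 :> nat)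
     && (`|line w k.+1 - line w k|%N == 1%N)) : nat)); last first.
    move=> t _; rewrite linkE /= lo hi signed_val_lo signed_val_hi /= /bump/= add1n.
    by congr nat_of_bool; lia.
  case: (`|line w k.+1 - line w k|%N =P 1%N) => h; last by rewrite big1// => t _; rewrite andbF.
  have ylt : ((minn `|line w k|%N `|line w k.+1|%N).-1 < m.+1)%N by lia.
  rewrite (bigD1 (Ordinal ylt))//= eqxx big1// => t /negbTE.
  by rewrite -val_eqE/= => ->.
rewrite (eq_bigr _ (fun k _ => C k)) big_split/= -/(consecutive_links w).
move: B; rewrite big_ord_recl => /(leq_trans (leq_addl _ _)) B.
apply/andP; split; first by rewrite addnCA leq_addr.
by rewrite addnCA leq_add2l (leq_add A B).
Qed.

Theorem sum_jump w : w \in Dgroup n ->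
  `| \sum_(i < n) jump i w - (n%:Z - (boundary_switches w)%:Z + (consecutive_links w)%:Z) | <= 4.
Proof.
move=> wD; have [wo _] := mem_Dgroup wD.
rewrite (eq_bigr _ (fun i _ => jumpE i wD)) big_split/=.
have -> : \sum_(i < n) \sum_(t < n) left_jump i t w = (\sum_(i < n) \sum_(t < n) link i t w)%N%:Z.
  rewrite -natz natr_sum; apply: eq_bigr => i _; rewrite natr_sum; apply: eq_bigr => t _.
  by rewrite left_jumpE// natz.
move: (sum_link wo) (sum_right_jump wo).
move: (\sum_(i < n) \sum_(t < n) link i t w)%N => c.
move: (\sum_(i < n) \sum_(t < n) right_jump i t w) => d.
by move: (consecutive_links w) (boundary_switches w) => a b; lia.
Qed.

Theorem jump_bounds i w : w \in Dgroup n -> `|jump i w| <= 2.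
Proof.
move=> wD; have [wo _] := mem_Dgroup wD; rewrite jumpE//.
rewrite (eq_bigr _ (fun t _ => left_jumpE i t wo)) -natz_sum.
move: (sum_link_le1 i w) (sum_right_jump_bounds i wo).
move: (\sum_(t < n) link i t w)%N (\sum_(t < n) right_jump i t w) => c d; lia.
Qed.

End Jumps.

(** * D_n as signs times permutations *)

Lemma exists_sorting_perm k (f : 'I_k -> int) : injective f ->
  exists s : 'S_k, forall a b : 'I_k, (a < b)%N -> f (s a) < f (s b).
Proof.
move=> finj; pose r := sort (relpre f <=%O) (enum 'I_k).
have sr : size r = k by rewrite size_sort size_enum_ord.
have ur : uniq r by rewrite sort_uniq enum_uniq.
have rs : sorted (relpre f <%O) r.
  have : sorted (relpre f <=%O) r.
    by apply: sort_sorted => x y /=; exact: le_total.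
  rewrite -sorted_map => h; rewrite -sorted_map lt_sorted_uniq_le (map_inj_uniq finj) ur.
  exact: h.
case: k f finj r sr ur rs => [|k] f finj r sr ur rs.
  by exists 1%g => -[].
have inj : injective (fun a : 'I_k.+1 => nth ord0 r a).
  by move=> a b /eqP; rewrite nth_uniq ?sr// => /eqP/val_inj.
exists (perm inj) => a b ab; rewrite !permE.
have tr : transitive (relpre f <%O) by move=> y x z /=; exact: lt_trans.
by have := sorted_ltn_nth tr ord0 rs; apply; rewrite ?inE ?sr.
Qed.

Section Parametrization.
Variable m : nat.
Local Notation n := m.+2.
Implicit Types (w : {perm signed_point n}) (A : {set 'I_n}) (u l : 'S_n).

Definition sign_fun A u (x : signed_point n) : signed_point n :=
  (u x.1, x.2 (+) (u x.1 \in A)).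

Lemma sign_fun_inj A u : injective (sign_fun A u).
Proof. by move=> [i b] [j c] [/= /perm_inj<- /addIb->]. Qed.

(* The element of D_n that maps i to u i, with sign - exactly when u i is in A. *)
Definition signed_perm A u : {perm signed_point n} := perm (@sign_fun_inj A u).

Lemma signed_permE A u i b : signed_perm A u (i, b) = (u i, b (+) (u i \in A)).
Proof. by rewrite permE. Qed.

Lemma signed_perm_odd A u : odd_map (signed_perm A u).
Proof. by case=> i b; rewrite /neg_point !signed_permE/= -addTb -addbA addTb. Qed.

Lemma signed_perm_parity A u : sign_parity (signed_perm A u) = odd #|A|.
Proof.
transitivity (\big[addb/false]_(i < n) (i \in A)).
  rewrite [RHS](reindex_inj (@perm_inj _ u)) /sign_parity.
  by apply: eq_bigr => i _; rewrite signed_permE.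
rewrite -sum1_card (big_morph odd oddD (erefl : odd 0 = false)) [RHS]big_mkcond/=.
by apply: eq_bigr => i _; case: (i \in A).
Qed.

Lemma signed_perm_inj A B u v : signed_perm A u = signed_perm B v -> A = B /\ u = v.
Proof.
move=> e; have {}e i : (u i, u i \in A) = (v i, v i \in B).
  by have := congr1 (fun w : {perm signed_point n} => w (i, false)) e; rewrite /= !signed_permE !addFb.
have uv : u = v by apply/permP => i; case: (e i).
split=> //; apply/setP => p; have := e (u^-1%g p).
by rewrite -uv permKV => -[].
Qed.

Lemma Dgroup_signed_perm w : w \in Dgroup n ->
  exists A u, ~~ odd #|A| /\ w = signed_perm A u.
Proof.
move=> /mem_Dgroup[wo wp].
pose u := perm (odd_map_abs_inj wo).
pose A := [set p | (w (u^-1%g p, false)).2]%SET.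
have wE : w = signed_perm A u.
  apply/permP => -[i b]; rewrite odd_map_sign// signed_permE permE/=.
  by congr (_, _ (+) _); rewrite inE -[X in u^-1%g X](permE (odd_map_abs_inj wo) i) permK.
by exists A, u; split=> //; rewrite -(signed_perm_parity A u) -wE wp.
Qed.

Lemma sum_Dgroup (R : nmodType) (F : {perm signed_point n} -> R) :
  \sum_(w in Dgroup n) F w = \sum_(A : {set 'I_n} | ~~ odd #|A|) \sum_(u : 'S_n) F (signed_perm A u).
Proof.
rewrite pair_big_dep/=.
have -> : Dgroup n = [set signed_perm p.1 p.2 | p in [set p : {set 'I_n} * 'S_n | ~~ odd #|p.1|]]%SET.
  apply/setP => w; apply/idP/imsetP => [/Dgroup_signed_perm[A [u [Ae ->]]]|[p]].
    by exists (A, u); rewrite ?inE.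
  rewrite inE => pe ->; apply/mem_Dgroup; split; first exact: signed_perm_odd.
  by rewrite signed_perm_parity (negbTE pe).
rewrite big_imset/=; last first.
  by move=> [A u] [B v] _ _ /= /signed_perm_inj[-> ->].
by apply: eq_bigl => p; rewrite inE andbT.
Qed.

Definition signed_label A (p : 'I_n) : int := signed_val ((p, p \in A) : signed_point n).

Lemma signed_label_inj A : injective (signed_label A).
Proof. by move=> p r /signed_val_inj[]. Qed.

(** The absolute values, sorted by the signed values they stand for. The default [1%g] is never
    taken, by [exists_sorting_perm]. *)
Definition order_perm A : 'S_n := odflt 1%g [pick s : 'S_n |
  [forall a : 'I_n, forall b : 'I_n, (a < b)%N ==> (signed_label A (s a) < signed_label A (s b))]].

Lemma order_perm_lt A (a b : 'I_n) : (signed_label A (order_perm A a) < signed_label A (order_perm A b)) = (a < b)%N.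
Proof.
have lt (c d : 'I_n) : (c < d)%N -> signed_label A (order_perm A c) < signed_label A (order_perm A d).
  rewrite /order_perm; case: pickP => [s /forallP/(_ c)/forallP/(_ d)/implyP//|/= no].
  have [s sP] := exists_sorting_perm (@signed_label_inj A).
  have /negP[] := negbT (no s); apply/forallP => x; apply/forallP => y; apply/implyP; exact: sP.
case: (ltngtP a b) => [/lt->//|/lt/ltW|/val_inj->]; last by rewrite ltxx.
by rewrite leNgt => /negbTE.
Qed.

(* The element with set of negative values A whose positions, listed in the
   order of their values, form the word of l. *)
Definition Dperm A l : {perm signed_point n} := signed_perm A (l^-1 * order_perm A)%g.

Lemma line_Dperm A l (a : 'I_n) : line (Dperm A l) (l a) = signed_label A (order_perm A a).
Proof.
by rewrite /line -(@inord_eq m (l a) (l a))// signed_permE addFb permM permK.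
Qed.

Lemma lineE w (j : 'I_n) : line w j = signed_val (w (j, false)).
Proof. by rewrite /line -(@inord_eq m j j). Qed.

(** Two positions give two roots, seen by their difference and by their sum; the factor 2 is the
    double representation of roots in [inversions]. *)
Lemma card_inversions_line w : odd_map w -> #|inversions w| =
  (2 * \sum_(j < n) \sum_(k < n) (j < k) * ((line w k < line w j)%R + (line w j + line w k < 0)%R))%N.
Proof.
move=> wo; rewrite -sum1dep_card big_mkcond/=.
pose c (j k : 'I_n) : nat := ((j < k) * ((line w k < line w j)%R + (line w j + line w k < 0)%R))%N.
transitivity (\sum_(j < n) \sum_(k < n) (c j k + c k j))%N; last first.
  rewrite mul2n -addnn.
  rewrite [LHS](eq_bigr (fun j => \sum_(k < n) c j k + \sum_(k < n) c k j)%N); last by move=> j _; rewrite big_split.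
  by rewrite big_split/=; congr addn; rewrite exchange_big.
transitivity (\sum_(a : signed_point n) \sum_(b : signed_point n)
  [&& signed_val a < signed_val b, a != neg_point b & signed_val (w b) < signed_val (w a)]%R)%N.
  rewrite pair_bigA/=; apply: eq_bigr => p _; case: ifP => //.
transitivity (\sum_(j < n) \sum_(s : bool) \sum_(k < n) \sum_(t : bool)
  [&& signed_val ((j, s) : signed_point n) < signed_val ((k, t) : signed_point n),
      (j, s) != neg_point (k, t) & signed_val (w (k, t)) < signed_val (w (j, s))]%R)%N.
  have sp (G : signed_point n -> nat) : (\sum_a G a = \sum_(j < n) \sum_(s : bool) G (j, s))%N.
    by rewrite pair_bigA/=; apply: eq_bigr => -[].
  by rewrite sp; apply: eq_bigr => j _; apply: eq_bigr => s _; rewrite sp.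
apply: eq_bigr => j _; rewrite exchange_big/=; apply: eq_bigr => k _.
rewrite !big_bool/= -[(j, true)]/(neg_point (j, false)) -[(k, true)]/(neg_point (k, false)).
rewrite !wo !signed_val_neg -!lineE /c.
have zj := line_neq0 w j.
have -> : signed_val ((j, false) : signed_point n) = j.+1%:Z by [].
have -> : signed_val ((k, false) : signed_point n) = k.+1%:Z by [].
rewrite /neg_point/= !xpair_eqE/=.
have [->|jk] := eqVneq j k; first by rewrite ltnn /=; lia.
have zk := line_neq0 w k.
case: (ltngtP (j : nat) (k : nat)) => jk'; last by rewrite (val_inj jk') eqxx in jk.
  by rewrite mul1n mul0n /=; lia.
by rewrite mul1n mul0n /=; lia.
Qed.

End Parametrization.

Lemma sum_upper_sym k (v : 'S_k) (S : 'I_k -> 'I_k -> nat) : (forall i j, S i j = S j i) ->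
  (\sum_(i < k) \sum_(j < k) (i < j) * S (v i) (v j) = \sum_(i < k) \sum_(j < k) (i < j) * S i j)%N.
Proof.
move=> Ssym.
have dbl (T : 'I_k -> 'I_k -> nat) : (forall i j, T i j = T j i) ->
  (2 * \sum_(i < k) \sum_(j < k) (i < j) * T i j = \sum_(i < k) \sum_(j < k) (i != j) * T i j)%N.
  move=> Tsym; rewrite mul2n -addnn [X in (_ + X)%N = _]exchange_big -big_split/=.
  apply: eq_bigr => i _; rewrite -big_split/=; apply: eq_bigr => j _.
  rewrite [T j i]Tsym -mulnDl -val_eqE; congr muln.
  by case: ltngtP.
have e1 := dbl (fun i j => S (v i) (v j)) (fun i j => Ssym _ _).
apply/eqP; rewrite -(eqn_pmul2l (isT : (0 < 2)%N)) (dbl S Ssym); apply/eqP.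
rewrite [LHS]e1.
rewrite [RHS](reindex_inj (@perm_inj _ v)); apply: eq_bigr => i _.
rewrite [RHS](reindex_inj (@perm_inj _ v)); apply: eq_bigr => j _.
by rewrite (inj_eq perm_inj).
Qed.

Lemma sum_ltn k r : (r <= k)%N -> (\sum_(p < k) (p < r) = r)%N.
Proof.
move=> rk; rewrite -[RHS]card_ord -sum1_card (big_ord_widen _ (fun=> 1%N) rk) [RHS]big_mkcond/=.
by apply: eq_bigr => p _; case: (p < r)%N.
Qed.

Section Transfer.
Variable m : nat.
Local Notation n := m.+2.
Implicit Types (w : {perm signed_point n}) (A : {set 'I_n}) (u l : 'S_n).

Lemma Dperm_Dgroup A l : ~~ odd #|A| -> Dperm A l \in Dgroup n.
Proof.
move=> Ae; apply/mem_Dgroup; split; first exact: signed_perm_odd.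
by rewrite signed_perm_parity (negbTE Ae).
Qed.

Lemma signed_label_sum_lt0 A (p r : 'I_n) : (p < r)%N ->
  (signed_label A p + signed_label A r < 0) = (r \in A).
Proof. by rewrite /signed_label /signed_val/=; case: (r \in A); case: (p \in A) => /=; lia. Qed.

(** The additivity is what makes signs and permutation independent. A pair of values has negative
    sum exactly when its larger absolute value is in [A], and the absolute value indexed by [r] has
    [r] smaller partners. The remaining inversions depend only on the relative order of the values,
    hence on [l]. *)
Lemma Dlength_Dperm A l : ~~ odd #|A| ->
  Dlength (Dperm A l) = (\sum_(p in A) p + inversion_number (perm_word l))%N.
Proof.
move=> Ae; have wo : odd_map (Dperm A l) := signed_perm_odd _ _.
apply: double_inj; rewrite Dlength_inversions ?Dperm_Dgroup// card_inversions_line// mul2n.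
congr double.
set z := line (Dperm A l).
rewrite (eq_bigr (fun j : 'I_n => \sum_(k < n) (j < k) * (z k < z j)%R
    + \sum_(k < n) (j < k) * (z j + z k < 0)%R)%N); last first.
  by move=> j _; rewrite -big_split/=; apply: eq_bigr => k _; rewrite mulnDr.
rewrite big_split/= addnC; congr addn.
  pose v := (l^-1 * order_perm A)%g.
  rewrite (eq_bigr (fun j : 'I_n => \sum_(k < n) (j < k) * (signed_label A (v j) + signed_label A (v k) < 0)%R)%N); last first.
    move=> j _; apply: eq_bigr => k _; rewrite -[j](permKV l) -[k](permKV l) /z !line_Dperm.
    by rewrite /v !permM !permKV.
  rewrite (sum_upper_sym v (S := fun p r => (signed_label A p + signed_label A r < 0)%R : nat)); last first.
    by move=> i j; rewrite addrC.
  rewrite exchange_big [RHS]big_mkcond/=; apply: eq_bigr => r _.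
  rewrite (eq_bigr (fun p : 'I_n => (p < r)%N * (r \in A))%N); last first.
    by move=> p _; case: ltnP => pr; rewrite ?mul0n// signed_label_sum_lt0.
  case: (r \in A); last by rewrite big1// => p _; rewrite muln0.
  rewrite -[RHS](sum_ltn (ltnW (ltn_ord r))); apply: eq_bigr => p _.
  by rewrite muln1.
rewrite inversion_number_perm exchange_big/= (reindex_inj (@perm_inj _ l)); apply: eq_bigr => b _.
rewrite (reindex_inj (@perm_inj _ l)); apply: eq_bigr => a _.
by rewrite /z !line_Dperm order_perm_lt mulnb andbC.
Qed.

Lemma boundary_switches_Dperm A l : boundary_switches (Dperm A l) = switches n (perm_word l).
Proof.
apply: eq_bigr => k _; have km := ltn_ord k.
have d (x y : 'I_n) : (line (Dperm A l) x < line (Dperm A l) y) = before (perm_word l) x y.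
  by rewrite before_perm_word -(order_perm_lt A) -!(line_Dperm A l) !permKV.
have k0 : (k < n)%N by lia. have k1 : (k.+1 < n)%N by lia. have k2 : (k.+2 < n)%N by lia.
have := d (Ordinal k1) (Ordinal k0); have := d (Ordinal k2) (Ordinal k1).
by rewrite /line_descent /= => -> ->.
Qed.

Definition order_mask A (j : nat) : bool :=
  signed_label A (order_perm A (inord j.+1)) == signed_label A (order_perm A (inord j)) + 1.

Lemma sum_next (G : nat -> nat -> bool) :
  (\sum_(a < n) \sum_(b < n) ((b == a.+1 :> nat) && G a b) = \sum_(k < m.+1) G k k.+1)%N.
Proof.
rewrite big_ord_recr/= [X in (_ + X)%N]big1 ?addn0 => [|b _]; last first.
  by rewrite ltn_eqF.
apply: eq_bigr => k _ /=; have kn : (k.+1 < n)%N by have := ltn_ord k; lia.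
rewrite (bigD1 (Ordinal kn))//= eqxx big1 ?addn0// => b /negbTE.
by rewrite -val_eqE/= => ->.
Qed.

(** Read from the side of the values: a link is a pair of consecutive integers at neighbouring
    positions, so it sits in a slot of the word of positions at which the next larger value is the
    next integer. *)
Lemma consecutive_links_Dperm A l :
  consecutive_links (Dperm A l) = adjacencies (order_mask A) (perm_word l).
Proof.
set z := line (Dperm A l).
transitivity (\sum_(i < n) \sum_(j < n) ((z j == (z i + 1)%R) && adjacent i j))%N.
  transitivity (\sum_(k < m.+1) (z k.+1 == (z k + 1)%R) + \sum_(k < m.+1) (z k == (z k.+1 + 1)%R))%N.
    rewrite -big_split/=; apply: eq_bigr => k _; rewrite -/z.
    by do 3?[case: eqP => ? /=]; lia.
  rewrite -(sum_next (fun a b => z b == z a + 1)) -(sum_next (fun a b => z a == z b + 1)).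
  rewrite [X in (_ + X)%N]exchange_big/= -big_split/=; apply: eq_bigr => i _.
  rewrite -big_split/=; apply: eq_bigr => j _; rewrite /adjacent.
  case: ((i : nat) =P j.+1) => ij; case: ((j : nat) =P i.+1) => ji /=; rewrite ?andbT ?andbF ?addn0 ?add0n//; lia.
rewrite (reindex_inj (@perm_inj _ l))/=.
rewrite adjacencies_slots size_perm_word/=.
rewrite -(sum_next (fun a b => order_mask A a && adjacent (nth 0%N (perm_word l) a) (nth 0%N (perm_word l) b))).
apply: eq_bigr => a _; rewrite (reindex_inj (@perm_inj _ l))/=; apply: eq_bigr => b _.
rewrite /z !line_Dperm !nth_perm_word andbA; congr (nat_of_bool (_ && _)).
have lab c d : signed_label A (order_perm A c) = signed_label A (order_perm A d) -> c = d.
  by move=> /signed_label_inj/perm_inj.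
apply/eqP/andP => [ba|[/eqP ba /eqP]]; last first.
  by rewrite -(@inord_eq m b a.+1)// -(@inord_eq m a a).
have ab : (a < b)%N by rewrite -(order_perm_lt A) ba; lia.
have an : (a.+1 < n)%N by have := ltn_ord b; lia.
have bE : b = a.+1 :> nat.
  apply/eqP; rewrite eqn_leq ab andbT leqNgt; apply/negP => h.
  have h1 : (a < (inord a.+1 : 'I_n))%N by rewrite inordK.
  have h2 : ((inord a.+1 : 'I_n) < b)%N by rewrite inordK.
  move: h1 h2; rewrite -!(order_perm_lt A) ba; lia.
by rewrite bE eqxx /order_mask -(@inord_eq m b a.+1)// -(@inord_eq m a a)// ba.
Qed.

End Transfer.

(** * Expectations and variances under the Mallows measure *)

Section Expectation.
Variables (R : realType) (m : nat) (q : R).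
Local Notation n := m.+2.
Hypothesis q0 : 0 < q.
Implicit Types (X Y : {perm signed_point n} -> R).

Definition Dsum X : R := \sum_(w in Dgroup n) q ^+ Dlength w * X w.

Lemma Dsum1_gt0 : 0 < Dsum (fun=> 1).
Proof.
rewrite /Dsum (bigD1 1%g) ?Dgroup1//= mulr1 ltr_pwDl ?exprn_gt0// sumr_ge0// => w _.
by rewrite mulr1 exprn_ge0// ltW.
Qed.

Lemma DexpectationE X : Dexpectation q X = Dsum X / Dsum (fun=> 1).
Proof.
rewrite /Dexpectation /Dsum mulr_suml; apply: eq_bigr => w _.
rewrite /mallows mulrAC; congr (_ / _).
by apply: eq_bigr => v _; rewrite mulr1.
Qed.

Lemma Dexpectation_cst a : Dexpectation q (fun _ : {perm signed_point n} => a) = a.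
Proof.
rewrite DexpectationE /Dsum -mulr_suml mulrAC -[X in _ / X](eq_bigr _ (fun w _ => esym (mulr1 _))).
rewrite (eq_bigr (fun w => q ^+ Dlength w * 1)); last by move=> w _; rewrite mulr1.
by rewrite divff ?mul1r// gt_eqF// Dsum1_gt0.
Qed.

Lemma DexpectationD X Y :
  Dexpectation q (fun w => X w + Y w) = Dexpectation q X + Dexpectation q Y.
Proof. by rewrite /Dexpectation -big_split; apply: eq_bigr => w _; rewrite mulrDr. Qed.

Lemma DexpectationZ a X : Dexpectation q (fun w => a * X w) = a * Dexpectation q X.
Proof. by rewrite /Dexpectation mulr_sumr; apply: eq_bigr => w _; rewrite mulrCA. Qed.

Lemma eq_Dexpectation X Y : (forall w, w \in Dgroup n -> X w = Y w) ->
  Dexpectation q X = Dexpectation q Y.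
Proof. by move=> XY; apply: eq_bigr => w wD; rewrite XY. Qed.

Lemma ler_Dexpectation X Y : (forall w, w \in Dgroup n -> X w <= Y w) ->
  Dexpectation q X <= Dexpectation q Y.
Proof.
move=> XY; apply: ler_sum => w wD; rewrite ler_wpM2l ?XY//.
by rewrite divr_ge0 ?exprn_ge0 ?sumr_ge0 ?ltW// => v _; rewrite exprn_ge0 ?ltW.
Qed.

Lemma Dexpectation_sum (I : Type) (r : seq I) (P : pred I) (F : I -> {perm signed_point n} -> R) :
  Dexpectation q (fun w => \sum_(i <- r | P i) F i w)
  = \sum_(i <- r | P i) Dexpectation q (F i).
Proof.
rewrite /Dexpectation exchange_big/=; apply: eq_bigr => w _.
by rewrite mulr_sumr.
Qed.

Lemma DvarianceE X : Dvariance q X = Dexpectation q (fun w => X w ^+ 2) - Dexpectation q X ^+ 2.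
Proof.
rewrite /Dvariance; set a := Dexpectation q X.
rewrite (eq_Dexpectation (Y := fun w => X w ^+ 2 + (- (2 * a) * X w + a ^+ 2))); last first.
  by move=> w _; ring.
by rewrite !DexpectationD DexpectationZ Dexpectation_cst -/a; ring.
Qed.

Lemma Dvariance_ge0 X : 0 <= Dvariance q X.
Proof. by rewrite -(Dexpectation_cst 0); apply: ler_Dexpectation => w _; rewrite sqr_ge0. Qed.

Lemma Dvariance_le X a : Dvariance q X <= Dexpectation q (fun w => (X w - a) ^+ 2).
Proof.
rewrite DvarianceE (eq_Dexpectation (X := fun w => (X w - a) ^+ 2) (Y := fun w => X w ^+ 2 + (- (2 * a) * X w + a ^+ 2))); last first.
  by move=> w _; ring.
rewrite !DexpectationD DexpectationZ Dexpectation_cst.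
by have := sqr_ge0 (Dexpectation q X - a); lra.
Qed.

Lemma Dexpectation_abs_le X : Dexpectation q (fun w => `|X w|) <= Num.sqrt (Dexpectation q (fun w => X w ^+ 2)).
Proof.
have Y0 : 0 <= Dexpectation q (fun w => `|X w|).
  by rewrite -(Dexpectation_cst 0); apply: ler_Dexpectation => w _; rewrite normr_ge0.
rewrite -(@ler_pXn2r _ 2) ?nnegrE ?sqrtr_ge0// sqr_sqrtr; last first.
  by rewrite -(Dexpectation_cst 0); apply: ler_Dexpectation => w _; rewrite sqr_ge0.
have := Dvariance_ge0 (fun w => `|X w|); rewrite DvarianceE subr_ge0 => /le_trans; apply.
by apply: ler_Dexpectation => w _; rewrite real_normK ?num_real.
Qed.

Definition sign_weight (A : {set 'I_n}) : R := q ^+ (\sum_(p in A) p)%N.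
Definition sign_mean (F : {set 'I_n} -> R) : R :=
  (\sum_(A : {set 'I_n} | ~~ odd #|A|) sign_weight A * F A) /
  \sum_(A : {set 'I_n} | ~~ odd #|A|) sign_weight A.

Lemma sign_weight_gt0 A : 0 < sign_weight A.
Proof. exact: exprn_gt0. Qed.

Lemma sign_total_gt0 : 0 < \sum_(A : {set 'I_n} | ~~ odd #|A|) sign_weight A.
Proof.
rewrite (bigD1 finset.set0) ?cards0//= ltr_pwDl ?sign_weight_gt0// sumr_ge0// => A _.
exact/ltW/sign_weight_gt0.
Qed.

Lemma Dsum_words X (Phi : {set 'I_n} -> seq nat -> R) :
  (forall (A : {set 'I_n}) (l : 'S_n), ~~ odd #|A| -> X (Dperm A l) = Phi A (perm_word l)) ->
  Dsum X = (\prod_(i < n) qnat q i.+1) *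
    \sum_(A : {set 'I_n} | ~~ odd #|A|) sign_weight A * word_mean q n (Phi A).
Proof.
move=> XPhi; rewrite /Dsum sum_Dgroup mulr_sumr; apply: eq_bigr => A Ae.
have inj : injective (fun l : 'S_n => (l^-1 * order_perm A)%g).
  by move=> l l' /mulIg/invg_inj.
rewrite (reindex_inj inj) mulrCA -sum_perm_words ?ltW// mulr_sumr.
apply: eq_bigr => l _; rewrite -/(Dperm A l) Dlength_Dperm// XPhi// exprD.
by rewrite mulrA.
Qed.

Lemma Dexpectation_words X (Phi : {set 'I_n} -> seq nat -> R) :
  (forall (A : {set 'I_n}) (l : 'S_n), ~~ odd #|A| -> X (Dperm A l) = Phi A (perm_word l)) ->
  Dexpectation q X = sign_mean (fun A => word_mean q n (Phi A)).
Proof.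
move=> XPhi; rewrite DexpectationE (Dsum_words XPhi) (Dsum_words (Phi := fun _ _ => 1))//.
rewrite /sign_mean [in X in _ / X](eq_bigr sign_weight); last first.
  by move=> A _; rewrite word_mean_cst ?mulr1// ltW.
have C0 : 0 < \prod_(i < n) qnat q i.+1.
  by apply: prodr_gt0 => i _; rewrite qnatS_gt0// ltW.
by rewrite invfM mulrACA divff ?mul1r// gt_eqF.
Qed.

Lemma sign_mean_cst a : sign_mean (fun=> a) = a.
Proof. by rewrite /sign_mean -mulr_suml mulrAC divff ?mul1r// gt_eqF// sign_total_gt0. Qed.

Lemma sign_meanD F G : sign_mean (fun A => F A + G A) = sign_mean F + sign_mean G.
Proof.
rewrite /sign_mean -mulrDl -big_split/=; congr (_ / _).
by apply: eq_bigr => A _; rewrite mulrDr.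
Qed.

Lemma sign_meanZ a F : sign_mean (fun A => a * F A) = a * sign_mean F.
Proof.
rewrite /sign_mean mulrA mulr_sumr; congr (_ / _).
by apply: eq_bigr => A _; rewrite mulrCA.
Qed.

Lemma sign_mean_sum (I : Type) (r : seq I) (P : pred I) F :
  sign_mean (fun A => \sum_(i <- r | P i) F i A) = \sum_(i <- r | P i) sign_mean (F i).
Proof.
rewrite /sign_mean -mulr_suml exchange_big/=; congr (_ / _).
by apply: eq_bigr => A _; rewrite mulr_sumr.
Qed.

Lemma ler_sign_mean F G : (forall A : {set 'I_n}, ~~ odd #|A| -> F A <= G A) -> sign_mean F <= sign_mean G.
Proof.
move=> FG; rewrite ler_wpM2r ?invr_ge0 ?(ltW sign_total_gt0)//.
by apply: ler_sum => A Ae; rewrite ler_wpM2l ?FG// ltW// sign_weight_gt0.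
Qed.

Lemma variance_boundary_switches :
  Dvariance q (fun w : {perm signed_point n} => (boundary_switches w)%:R) <= 9 / 2 * n%:R.
Proof.
rewrite DvarianceE.
rewrite (Dexpectation_words (Phi := fun _ L => (switches n L)%:R ^+ 2)); last first.
  by move=> A l _; rewrite boundary_switches_Dperm.
rewrite (Dexpectation_words (Phi := fun _ L => (switches n L)%:R)); last first.
  by move=> A l _; rewrite boundary_switches_Dperm.
by rewrite !sign_mean_cst; exact: variance_switches.
Qed.

(** The absolute value [p] carries the sign that is the rarer one under the weight [q]. *)
Definition is_minority (A : {set 'I_n}) (p : 'I_n) : bool := if q <= 1 then p \in A else p \notin A.

(** If the value after the one of absolute value [p] is not the next integer, then [p] is a minority
    element, or the absolute value that the next integer would have is one, or that integer would be
    0. The last case accounts for the extra 1; the first two count each minority element at most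
    twice. *)
Lemma order_mask_zeros A :
  (\sum_(j < m.+1) ~~ order_mask A j <= 2 * \sum_(p < n) is_minority A p + 1)%N.
Proof.
have lt (a b : 'I_n) := order_perm_lt A a b.
pose s := order_perm A.
have step (a b : 'I_n) : signed_label A (s b) = signed_label A (s a) + 1 -> b = a.+1 :> nat.
  move=> ba; have ab : (a < b)%N by rewrite -lt -/s ba; lia.
  have an : (a.+1 < n)%N by have := ltn_ord b; lia.
  apply/eqP; rewrite eqn_leq ab andbT leqNgt; apply/negP => h.
  have h1 : (a < (inord a.+1 : 'I_n))%N by rewrite inordK.
  have h2 : ((inord a.+1 : 'I_n) < b)%N by rewrite inordK.
  by move: h1 h2; rewrite -!lt -/s ba; lia.
have sumle (H : 'I_n -> nat) : (\sum_(j < m.+1) H (s (inord j)) <= \sum_(p < n) H p)%N.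
  rewrite [leqRHS](reindex_inj (@perm_inj _ s)) [leqRHS]big_ord_recr/=.
  apply: leq_trans (leq_addr _ _); apply: eq_leq; apply: eq_bigr => j _; congr (H (s _)).
  by apply: val_inj; rewrite /= inordK// (leq_trans (ltn_ord j)).
pose M := is_minority A.
pose N (p : 'I_n) : nat := if q <= 1 then (p.+1 < n)%N && M (inord p.+1) else (0 < p)%N && M (inord p.-1).
have NM : (\sum_(p < n) N p <= \sum_(p < n) M p)%N.
  rewrite /N; case: (q <= 1).
    rewrite big_ord_recr/= ltnn/= addn0 [leqRHS]big_ord_recl; apply: leq_trans (leq_addl _ _).
    apply: leq_sum => k _; rewrite (_ : inord _ = lift ord0 k) ?leq_b1//; first by case: (_ < _)%N.
    by apply: val_inj; rewrite /= inordK// ltnS ltn_ord.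
  rewrite big_ord_recl/= add0n [leqRHS]big_ord_recr/=; apply: leq_trans (leq_addr _ _).
  apply: leq_sum => k _; rewrite (_ : inord _ = widen_ord (leqnSn _) k)//.
  by apply: val_inj; rewrite /= inordK// (leq_trans (ltn_ord k)).
have Z1 : (\sum_(p < n) (p == 0 :> nat) <= 1)%N := sum_eq_le1 m 0.
have charge (j : 'I_m.+1) : (~~ order_mask A j <=
    M (s (inord j)) + N (s (inord j)) + (s (inord j) == 0 :> nat))%N.
  case: (boolP (order_mask A j)) => //= nm.
  set p := s (inord j) in nm *.
  have maskT (r : 'I_n) : signed_label A r = signed_label A p + 1 -> False.
    move=> rE; have := rE; rewrite -[r](permKV s) /p => /step bE.
    have jn : (j < n)%N by have := ltn_ord j; lia.
    rewrite inordK// in bE; case/negP: nm.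
    by rewrite /order_mask -/s -bE inord_val permKV rE.
  have labE (r : 'I_n) : signed_label A r = if r \in A then - r.+1%:Z else r.+1%:Z by [].
  rewrite /N /M /is_minority; case: ifP => _.
    have [pA|pA] := boolP (p \in A); first by lia.
    have [pn|pn] := ltnP p.+1 n; last first.
      have j1 : (inord j.+1 : 'I_n) = j.+1 :> nat by rewrite inordK// ltnS ltn_ord.
      have jE : (inord j : 'I_n) = j :> nat by rewrite inordK// ltnW// ltnS ltn_ord.
      have : ((inord j : 'I_n) < (inord j.+1 : 'I_n))%N by rewrite jE j1.
      rewrite -lt -/s -/p (labE p) (negbTE pA) labE.
      by have := ltn_ord (s (inord j.+1)); case: ifP => _; lia.
    have [_|rA] := boolP (inord p.+1 \in A); first by [].
    by case: (maskT (inord p.+1)); rewrite !labE (negbTE pA) (negbTE rA) inordK//; lia.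
  have [pA|pA] := boolP (p \in A); last by lia.
  have [p0|p0] := eqVneq (p : nat) 0%N; first by lia.
  have pn : (p.-1 < n)%N by have := ltn_ord p; lia.
  have [rA|_] := boolP (inord p.-1 \in A); last by have -> : (0 < p)%N by rewrite lt0n.
  by case: (maskT (inord p.-1)); rewrite !labE pA rA inordK//; lia.
have h : (\sum_(j < m.+1) ~~ order_mask A j <= \sum_(j < m.+1)
    (M (s (inord j)) + N (s (inord j)) + (s (inord j) == 0 :> nat)))%N by apply: leq_sum => j _.
apply: leq_trans h _; rewrite !big_split/= mul2n -addnn.
apply: leq_add; last by apply: leq_trans Z1; apply: (sumle (fun p => (p == 0 :> nat) : nat)).
apply: leq_add; first exact: (sumle (fun p => M p : nat)).
by apply: leq_trans NM; exact: (sumle N).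
Qed.

Let b : R := Num.min q q^-1.

Lemma min_inv_gt0 : 0 < b.
Proof. by rewrite lt_min q0 invr_gt0. Qed.

(** Two signs are flipped at once so that the number of negative values stays even. *)
Definition toggle (a c : 'I_n) (A : {set 'I_n}) : {set 'I_n} :=
  [set p | (p \in A) (+) ((p == a) || (p == c))]%SET.

Lemma toggleK a c : involutive (toggle a c).
Proof. by move=> A; apply/setP => p; rewrite !inE -addbA addbb addbF. Qed.

Lemma odd_toggle (a c : 'I_n) (A : {set 'I_n}) : a != c -> odd #|toggle a c A| = odd #|A|.
Proof.
move=> ac; have oE (B : {set 'I_n}) : odd #|B| = \big[addb/false]_(p < n) (p \in B).
  rewrite -sum1_card (big_morph odd oddD (erefl : odd 0 = false)) big_mkcond/=.
  by apply: eq_bigr => p _; case: (p \in B).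
rewrite !oE; under eq_bigr do rewrite inE.
rewrite big_split/= -[RHS]addbF; congr addb.
transitivity (odd #|[set a; c]%SET|); last by rewrite cards2 ac.
by rewrite oE; apply: eq_bigr => p _; rewrite !inE.
Qed.

Lemma sum_toggle (a c : 'I_n) (A : {set 'I_n}) : a != c ->
  (\sum_(p in A) p + ((a \notin A) * a + (c \notin A) * c)
   = \sum_(p in toggle a c A) p + ((a \in A) * a + (c \in A) * c))%N.
Proof.
move=> ac; rewrite big_mkcond [X in _ = (X + _)%N]big_mkcond/=.
rewrite (bigD1 a)//= (bigD1 c) 1?eq_sym//= [in RHS](bigD1 a)//= [X in _ = (_ + X + _)%N](bigD1 c) 1?eq_sym//=.
rewrite !inE !eqxx orbT !addbT.
rewrite [X in _ = (_ + (_ + X) + _)%N](eq_bigr (fun p : 'I_n => if p \in A then p : nat else 0%N)); last first.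
  by move=> p /andP[/negbTE pa /negbTE pc]; rewrite inE pa pc addbF.
by case: (a \in A); case: (c \in A) => /=; lia.
Qed.

(* The toggle of a and c pairs the sets A in P with sets whose weight is larger
   by the factor b^-k. *)
Lemma sign_mean_toggle a c k (P : pred {set 'I_n}) : a != c ->
  (forall A, P A -> sign_weight A = b ^+ k * sign_weight (toggle a c A)) ->
  sign_mean (fun A => (P A)%:R) <= b ^+ k.
Proof.
move=> ac PT; rewrite /sign_mean ler_pdivrMr ?sign_total_gt0//.
apply: (@le_trans _ _ (b ^+ k * \sum_(A : {set 'I_n} | ~~ odd #|A|) sign_weight (toggle a c A))).
  rewrite mulr_sumr; apply: ler_sum => A _; have b0 := exprn_gt0 k min_inv_gt0.
  have := sign_weight_gt0 (toggle a c A); case: (boolP (P A)) => [/PT->|_] w0.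
    by rewrite mulr1.
  by rewrite mulr0 mulr_ge0 ?ltW.
apply: ler_wpM2l; first by rewrite exprn_ge0// ltW// min_inv_gt0.
rewrite [leRHS](reindex_inj (inv_inj (toggleK a c)))/=.
by rewrite le_eqVlt (eq_bigl (fun A => ~~ odd #|toggle a c A|)) ?eqxx// => A; rewrite odd_toggle.
Qed.

Lemma minority_pair (a c : 'I_n) : a != c ->
  sign_mean (fun A => (is_minority A a && is_minority A c)%:R) <= b ^+ (a + c).
Proof.
move=> ac; apply: (sign_mean_toggle ac) => A.
rewrite /is_minority /sign_weight /b; have := sum_toggle A ac.
set x := (\sum_(p in A) p)%N; set y := (\sum_(p in toggle a c A) p)%N.
case: (leP q 1) => q1 + /andP[aA cA].
  rewrite aA cA !mul1n !mul0n !addn0 => ->; rewrite min_l; first by rewrite addnC exprD.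
  by rewrite (le_trans q1)// invf_ge1.
rewrite (negbTE aA) (negbTE cA) !mul1n !mul0n !addn0 => <-; rewrite min_r; last first.
  by rewrite ltW// (lt_trans _ q1)// invf_lt1.
by move: (a + c)%N => k; rewrite exprVn [(x + _)%N]addnC exprD mulKf// expf_neq0// gt_eqF.
Qed.

(** The parity is repaired at the element [ord0], which contributes nothing to the weight. *)
Lemma minority_single (a : 'I_n) : sign_mean (fun A => (is_minority A a)%:R) <= b ^+ a.
Proof.
have [->|a0] := eqVneq a ord0.
  rewrite expr0 -[leRHS]sign_mean_cst; apply: ler_sign_mean => A _.
  by case: is_minority.
apply: (sign_mean_toggle a0) => A.
rewrite /is_minority /sign_weight /b; have := sum_toggle A a0.
set x := (\sum_(p in A) p)%N; set y := (\sum_(p in toggle a ord0 A) p)%N.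
rewrite !muln0 !addn0; case: (leP q 1) => q1 + aA.
  rewrite aA mul1n mul0n addn0 => ->; rewrite min_l; first by rewrite addnC exprD.
  by rewrite (le_trans q1)// invf_ge1.
rewrite (negbTE aA) mul1n mul0n addn0 => <-; rewrite min_r; last first.
  by rewrite ltW// (lt_trans _ q1)// invf_lt1.
by rewrite exprVn [(x + _)%N]addnC exprD mulKf// expf_neq0// gt_eqF.
Qed.

Lemma minority_count_sqr :
  sign_mean (fun A => (\sum_(p < n) is_minority A p)%:R ^+ 2) <= 2 * qnat b n ^+ 2.
Proof.
have b0 := ltW min_inv_gt0.
have -> : sign_mean (fun A => (\sum_(p < n) is_minority A p)%:R ^+ 2) =
    \sum_(p < n) \sum_(r < n) sign_mean (fun A => (is_minority A p && is_minority A r)%:R).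
  rewrite -[RHS](eq_bigr _ (fun p _ => sign_mean_sum _ _ _)) -sign_mean_sum.
  rewrite /sign_mean; congr (_ / _); apply: eq_bigr => A _; congr (_ * _).
  rewrite expr2 natr_sum mulr_suml; apply: eq_bigr => p _.
  by rewrite mulr_sumr; apply: eq_bigr => r _; rewrite -natrM mulnb.
apply: (@le_trans _ _ (\sum_(p < n) (b ^+ p + \sum_(r < n) b ^+ p * b ^+ r))).
  apply: ler_sum => p _; rewrite (bigD1 p)//=; apply: lerD.
    apply: le_trans (minority_single p); apply: ler_sign_mean => A _.
    by rewrite andbb.
  rewrite [leRHS](bigD1 p)//= -[leLHS]add0r; apply: lerD; first by rewrite mulr_ge0 ?exprn_ge0.
  by apply: ler_sum => r rp; rewrite -exprD minority_pair// eq_sym.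
rewrite big_split/= -/(qnat b n); under eq_bigr do rewrite -mulr_sumr.
rewrite -mulr_suml -/(qnat b n); have := qnatS_ge1 m.+1 b0.
by set Q := qnat b n; nra.
Qed.

Lemma adjacencies_masked g L : size L = n -> (adjacencies g L)%:R =
  \sum_(j < m.+1) (g j)%:R * (adjacencies (pred1 (j : nat)) L)%:R :> R.
Proof.
move=> sL; rewrite adjacencies_slots sL natr_sum; apply: eq_bigr => j _ /=.
rewrite -mulnb natrM; congr (_ * _%:R); rewrite adjacencies_slots sL (bigD1 j)//= eqxx big1 ?addn0// => k /negbTE.
by rewrite -val_eqE/= => ->.
Qed.

(** Law of total variance over [A]. The conditional variance is at most [77 * n%:R]. The conditional
    mean [mu A] falls short of its unmasked value [c] by at most [4 / qnat b n] per masked slot, and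
    there are at most [2 S + 1] of these for [S] minority elements. With [(2 S + 1)^2 <= 8 S^2 + 2]
    this gives 288 = 16 * (8 * 2 + 2). *)
Lemma variance_consecutive_links :
  Dvariance q (fun w : {perm signed_point n} => (consecutive_links w)%:R) <= 77 * n%:R + 288.
Proof.
pose mu (A : {set 'I_n}) := word_mean q n (fun L => (adjacencies (order_mask A) L)%:R) : R.
pose p j := word_mean q n (fun L => (adjacencies (pred1 (j : nat)) L)%:R) : R.
pose c := \sum_(j < m.+1) p j.
have Q : 0 < qnat b n by rewrite qnatS_gt0// ltW// min_inv_gt0.
have Q1 : 1 <= qnat b n by rewrite qnatS_ge1// ltW// min_inv_gt0.
have muE A : c - mu A = \sum_(j < m.+1) (~~ order_mask A j)%:R * p j.
  have -> : mu A = \sum_(j < m.+1) (order_mask A j)%:R * p j.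
    rewrite /mu /p; under [RHS]eq_bigr do rewrite -word_meanZ.
    rewrite -word_mean_sum; apply: eq_word_mean => L pL; rewrite adjacencies_masked//.
    by rewrite (perm_size pL) size_iota.
  rewrite /c -sumrB; apply: eq_bigr => j _.
  by case: order_mask => /=; ring.
have p0 j : 0 <= p j.
  rewrite -(word_mean_cst n 0 (ltW q0)); apply: ler_word_mean; first exact: ltW.
  by move=> L _; rewrite ler0n.
have mu_le A : (mu A - c) ^+ 2 <= 16 / qnat b n ^+ 2 * (8 * (\sum_(p < n) is_minority A p)%:R ^+ 2 + 2).
  rewrite -opprB sqrrN muE.
  set S := (\sum_(p < n) is_minority A p)%N.
  have le : \sum_(j < m.+1) (~~ order_mask A j)%:R * p j <= 4 / qnat b n * (2 * S%:R + 1).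
    apply: (@le_trans _ _ (\sum_(j < m.+1) (~~ order_mask A j)%:R * (4 / qnat b n))).
      apply: ler_sum => j _; apply: ler_wpM2l; first exact: ler0n.
      by apply: word_mean_slot => //; rewrite ltnS ltn_ord.
    rewrite -mulr_suml mulrC ler_wpM2l ?divr_ge0 ?(ltW Q)// -natr_sum -natrM -(natrD _ _ 1) ler_nat.
    exact: order_mask_zeros.
  have ge0 : 0 <= \sum_(j < m.+1) (~~ order_mask A j)%:R * p j.
    by apply: sumr_ge0 => j _; rewrite mulr_ge0.
  apply: (@le_trans _ _ ((4 / qnat b n * (2 * S%:R + 1)) ^+ 2)).
    by rewrite lerXn2r// nnegrE// (le_trans ge0).
  rewrite exprMn expr_div_n (_ : 4 ^+ 2 = 16 :> R); last by ring.
  rewrite ler_wpM2l// ?divr_ge0 ?exprn_ge0 ?(ltW Q)//.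
  by have := sqr_ge0 (2 * S%:R - 1 : R); lra.
rewrite DvarianceE.
rewrite (Dexpectation_words (Phi := fun A L => (adjacencies (order_mask A) L)%:R ^+ 2)); last first.
  by move=> A l _; rewrite consecutive_links_Dperm.
rewrite (Dexpectation_words (Phi := fun A L => (adjacencies (order_mask A) L)%:R)); last first.
  by move=> A l _; rewrite consecutive_links_Dperm.
rewrite -[X in _ - X ^+ 2]/(sign_mean mu).
apply: (@le_trans _ _ (sign_mean (fun A => 77 * n%:R + (mu A - c) ^+ 2 + (2 * c * mu A + - c ^+ 2)) - sign_mean mu ^+ 2)).
  rewrite lerB//; apply: ler_sign_mean => A _.
  have := variance_adjacencies q0 (order_mask A) n; rewrite -/(mu A); lra.
rewrite !sign_meanD !sign_meanZ !sign_mean_cst.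
have : sign_mean (fun A => (mu A - c) ^+ 2) <= 288.
  apply: (@le_trans _ _ (sign_mean (fun A => 16 / qnat b n ^+ 2 * (8 * (\sum_(p < n) is_minority A p)%:R ^+ 2 + 2)))).
    by apply: ler_sign_mean => A _; exact: mu_le.
  rewrite sign_meanZ sign_meanD sign_meanZ sign_mean_cst mulrAC ler_pdivrMr ?exprn_gt0//.
  by have := minority_count_sqr; have : 1 <= qnat b n ^+ 2 by [rewrite exprn_ege1]; lra.
rewrite -/(sign_mean mu).
have := sqr_ge0 (sign_mean mu - c); lra.
Qed.

End Expectation.

(** * Pairing with a generator, and the moments of the total jump *)

Section Pairing.
Variables (R : realType) (m : nat) (q : R).
Local Notation n := m.+2.
Hypothesis q0 : 0 < q.
Implicit Types (w : {perm signed_point n}) (X Y G H : {perm signed_point n} -> R).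

Lemma Dexpectation_descent (i : 'I_n) G :
  Dexpectation q (fun w => (is_descent w i)%:R * G w)
  = q * Dexpectation q (fun w => (~~ is_descent w i)%:R * G (Dgenerator i * w)%g).
Proof.
rewrite !DexpectationE mulrA; congr (_ / _); rewrite /Dsum mulr_sumr.
rewrite (reindex_inj (mulgI (Dgenerator i)))/= (eq_bigl (fun w => w \in Dgroup n)); last first.
  by move=> w; rewrite Dgroup_generator.
apply: eq_bigr => w wD; have [wo _] := mem_Dgroup wD.
have := Dlength_generator i wD; rewrite is_descent_generator//.
case: is_descent => /= l; first by rewrite !mul0r !mulr0.
by move: l; rewrite addn0 addn1 => ->; rewrite !mul1r mulrA -exprS.
Qed.

Lemma Dexpectation_pair (i : 'I_n) G : Dexpectation q G
  = Dexpectation q (fun w => (~~ is_descent w i)%:R * (G w + q * G (Dgenerator i * w)%g)).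
Proof.
transitivity (Dexpectation q (fun w => (~~ is_descent w i)%:R * G w)
    + Dexpectation q (fun w => (is_descent w i)%:R * G w)).
  rewrite -DexpectationD; apply: eq_Dexpectation => w _.
  by case: is_descent => /=; ring.
rewrite Dexpectation_descent -DexpectationZ -DexpectationD; apply: eq_Dexpectation => w _.
by ring.
Qed.

Lemma Dexpectation_ascent (i : 'I_n) :
  Dexpectation q (fun w => (~~ is_descent w i)%:R) = (1 + q)^-1.
Proof.
have q1 : 1 + q != 0 by rewrite gt_eqF// addr_gt0.
have := Dexpectation_pair i (fun=> 1); rewrite Dexpectation_cst// => e.
apply: (mulIf q1); rewrite mulVf// [RHS]e mulrC -DexpectationZ; apply: eq_Dexpectation => w _.
by ring.
Qed.

Lemma Dexpectation_inverse G : Dexpectation q (fun w => G w^-1%g) = Dexpectation q G.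
Proof.
rewrite !DexpectationE; congr (_ / _); rewrite /Dsum [RHS](reindex_inj invg_inj)/=.
apply: eq_big => w; first by rewrite DgroupV.
by move=> wD; rewrite DlengthV.
Qed.

(** Swapping neighbours relates the six orders of three letters, whose probabilities are [x], [q x]
    and [q^2 x] twice each, and [q^3 x]. The switches have the share [2 (q + q^2)] of
    [1 + 2 q + 2 q^2 + q^3], at most 2/3 since [1 + q^3 - q - q^2 = (1 + q) (1 - q)^2]. *)
Lemma switch_mean (k : nat) : (k < m)%N ->
  Dexpectation q (fun w => (line_descent (line w) k.+1 != line_descent (line w) k.+2)%:R) <= 2 / 3.
Proof.
move=> km; have k1 : (k.+1 < n)%N by lia. have k2 : (k.+2 < n)%N by lia.
pose W (P : int -> int -> int -> bool) :=
  Dexpectation q (fun w => (P (line w k) (line w k.+1) (line w k.+2))%:R) : R.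
have swap1 (P : int -> int -> int -> bool) : (forall a b c : int, P a b c -> b < a) -> W P = q * W (fun a b c => P b a c).
  move=> Pba.
  rewrite /W (eq_Dexpectation q (Y := fun w => (is_descent w (Ordinal k1))%:R * (P (line w k) (line w k.+1) (line w k.+2))%:R)).
    rewrite Dexpectation_descent; congr (_ * _); apply: eq_Dexpectation => w /mem_Dgroup[wo _].
    rewrite !line_generator//; last by lia.
    rewrite /line_action/= eqxx is_descentE// /line_descent/=.
    have -> : (k == k.+1) = false by lia. have -> : (k.+2 == k.+1) = false by lia.
    have -> : (k.+2 == k) = false by lia. rewrite eqxx.
    case: (boolP (P _ _ _)) => [/Pba ba|_]; last by rewrite mulr0.
    by rewrite mulr1 -leNgt ltW.
  move=> w /mem_Dgroup[wo _]; rewrite is_descentE// /line_descent/=.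
  case: (boolP (P _ _ _)) => [/Pba->|_]; by rewrite ?mulr0 ?mulr1.
have swap2 (P : int -> int -> int -> bool) : (forall a b c : int, P a b c -> c < b) -> W P = q * W (fun a b c => P a c b).
  move=> Pcb.
  rewrite /W (eq_Dexpectation q (Y := fun w => (is_descent w (Ordinal k2))%:R * (P (line w k) (line w k.+1) (line w k.+2))%:R)).
    rewrite Dexpectation_descent; congr (_ * _); apply: eq_Dexpectation => w /mem_Dgroup[wo _].
    rewrite !line_generator//; last by lia.
    rewrite /line_action/= !eqxx is_descentE// /line_descent/=.
    have -> : (k == k.+2) = false by lia. have -> : (k == k.+1) = false by lia.
    have -> : (k.+1 == k.+2) = false by lia.
    case: (boolP (P _ _ _)) => [/Pcb cb|_]; last by rewrite mulr0.
    by rewrite mulr1 -leNgt ltW.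
  move=> w /mem_Dgroup[wo _]; rewrite is_descentE// /line_descent/=.
  case: (boolP (P _ _ _)) => [/Pcb->|_]; by rewrite ?mulr0 ?mulr1.
pose x := W (fun a b c => (a < b) && (b < c)).
have x213 : W (fun a b c => (b < a) && (a < c)) = q * x.
  by rewrite swap1// => a b c /andP[].
have x132 : W (fun a b c => (a < c) && (c < b)) = q * x.
  by rewrite swap2// => a b c /andP[].
have x231 : W (fun a b c => (c < a) && (a < b)) = q * (q * x).
  by rewrite swap2 ?x213// => a b c /andP[]; exact: lt_trans.
have x312 : W (fun a b c => (b < c) && (c < a)) = q * (q * x).
  by rewrite swap1 ?x132// => a b c /andP[]; exact: lt_trans.
have x321 : W (fun a b c => (c < b) && (b < a)) = q * (q * (q * x)).
  by rewrite swap1 ?x231// => a b c /andP[].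
have dist w : w \in Dgroup n -> [/\ line w k <> line w k.+1, line w k.+1 <> line w k.+2 & line w k <> line w k.+2].
  by move=> _; split => /line_inj; lia.
have sw : Dexpectation q (fun w => (line_descent (line w) k.+1 != line_descent (line w) k.+2)%:R)
    = q * x + q * x + (q * (q * x) + q * (q * x)).
  transitivity (W (fun a b c => (b < a) && (a < c)) + W (fun a b c => (a < c) && (c < b))
    + (W (fun a b c => (c < a) && (a < b)) + W (fun a b c => (b < c) && (c < a)))); last first.
    by rewrite x213 x132 x231 x312.
  rewrite /W -!DexpectationD; apply: eq_Dexpectation => w /dist[].
  rewrite /line_descent/= -!natrD; move: (line w k) (line w k.+1) (line w k.+2) => a b c ab bc ac.
  congr (_%:R); lia.
have tot : 1 = x + q * (q * (q * x)) + (q * x + q * x + (q * (q * x) + q * (q * x))).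
  rewrite -sw -x321 /x /W -!DexpectationD -[LHS](Dexpectation_cst m q0); apply: eq_Dexpectation => w /dist[].
  rewrite /line_descent/= -!natrD; move: (line w k) (line w k.+1) (line w k.+2) => a b c ab bc ac.
  by rewrite -[LHS]/(1%:R); congr (_%:R); lia.
have x0 : 0 <= x.
  by rewrite /x /W -(Dexpectation_cst m q0 0); apply: ler_Dexpectation => // w _; rewrite ler0n.
rewrite sw; have : 0 <= x * ((1 + q) * (1 - q) ^+ 2).
  by apply: mulr_ge0 => //; apply: mulr_ge0; [rewrite addr_ge0// ltW|exact: sqr_ge0].
by have := tot; nra.
Qed.

Definition jump_total w : R := \sum_(i < n) (jump i w)%:~R.

Lemma jump_total_le w : w \in Dgroup n ->
  `|jump_total w - (n%:R - (boundary_switches w)%:R + (consecutive_links w)%:R)| <= 4.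
Proof.
move=> wD; have := sum_jump wD; rewrite -(ler_int R) intr_norm !rmorphB /= rmorphD rmorphB/= rmorph_sum/=.
by rewrite -/(jump_total w).
Qed.

Lemma Dexpectation_jump_total : n%:R / 3 - 8 / 3 <= Dexpectation q jump_total.
Proof.
have h : Dexpectation q (fun w : {perm signed_point n} => (boundary_switches w)%:R) <= m%:R * (2 / 3).
  rewrite /boundary_switches; under eq_Dexpectation do rewrite natr_sum.
  rewrite Dexpectation_sum (_ : m%:R * _ = \sum_(k < m) 2 / 3); last first.
    by rewrite sumr_const card_ord mulr_natl.
  by apply: ler_sum => k _; exact: switch_mean.
(* With [n - 2] possible switches: [n - 4 - 2/3 (n - 2) = n/3 - 8/3]. *)
apply: (@le_trans _ _ (Dexpectation q (fun w => (n%:R - 4) + -1 * (boundary_switches w)%:R))).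
  rewrite DexpectationD DexpectationZ Dexpectation_cst//.
  have : (n%:R : R) = m%:R + 2 by rewrite -addn2 natrD.
  lra.
apply: ler_Dexpectation => // w wD; have := jump_total_le wD; rewrite ler_norml => /andP[+ _].
have : 0 <= (consecutive_links w)%:R :> R by rewrite ler0n.
lra.
Qed.

(** [(x + y + z)^2 <= 3 (x^2 + y^2 + z^2)] for the two counts and the error of [jump_total_le],
    whose square is at most 16. *)
Lemma variance_jump_total : Dvariance q jump_total <= 3 * (9 / 2 * n%:R + (77 * n%:R + 288) + 16).
Proof.
set a := Dexpectation q (fun w : {perm signed_point n} => (boundary_switches w)%:R) : R.
set c := Dexpectation q (fun w : {perm signed_point n} => (consecutive_links w)%:R) : R.
apply: le_trans (Dvariance_le q0 _ (n%:R - a + c)) _.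
apply: (@le_trans _ _ (Dexpectation q (fun w => 3 * (((boundary_switches w)%:R - a) ^+ 2
    + ((consecutive_links w)%:R - c) ^+ 2 + 16)))).
  apply: ler_Dexpectation => // w wD; have := jump_total_le wD.
  set x := (boundary_switches w)%:R; set y := (consecutive_links w)%:R; set t := jump_total w.
  rewrite ler_norml => /andP[h1 h2].
  set d := t - (n%:R - x + y) in h1 h2.
  have -> : t - (n%:R - a + c) = d - (x - a) + (y - c) by rewrite /d; ring.
  have : 0 <= (4 - d) * (4 + d) by rewrite mulr_ge0//; lra.
  have := sqr_ge0 (d + (x - a)); have := sqr_ge0 (d - (y - c)); have := sqr_ge0 ((x - a) + (y - c)).
  nra.
rewrite DexpectationZ ler_pM2l// !DexpectationD Dexpectation_cst// lerD2r lerD//.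
  exact: variance_boundary_switches.
exact: variance_consecutive_links.
Qed.

End Pairing.

(** * Stein's identity *)

Section SteinPairing.
Variables (R : realType) (m : nat) (q : R).
Local Notation n := m.+2.
Hypothesis q0 : 0 < q.
Implicit Types (w : {perm signed_point n}) (G H : {perm signed_point n} -> R) (i : 'I_n).

Let X w : R := (two_sided_des w)%:R.
Let mu := Dexpectation q X.
Let p := q / (1 + q).
Let v := q / (1 + q) ^+ 2.
Let ascent i w : R := (~~ is_descent w i)%:R.

Let q1_neq0 : 1 + q != 0.
Proof. by rewrite gt_eqF// addr_gt0. Qed.

Lemma descent_covariance i G :
  Dexpectation q (fun w => (is_descent w i)%:R * G w) - p * Dexpectation q G
  = p * Dexpectation q (fun w => ascent i w * (G (Dgenerator i * w)%g - G w)).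
Proof.
rewrite Dexpectation_descent// [Dexpectation q G](Dexpectation_pair q i).
have -> : Dexpectation q (fun w => (~~ is_descent w i)%:R * (G w + q * G (Dgenerator i * w)%g))
  = Dexpectation q (fun w => ascent i w * G w) + q * Dexpectation q (fun w => ascent i w * G (Dgenerator i * w)%g).
  by rewrite -DexpectationZ -DexpectationD; apply: eq_Dexpectation => w _; rewrite /ascent; ring.
have -> : Dexpectation q (fun w => ascent i w * (G (Dgenerator i * w)%g - G w))
  = Dexpectation q (fun w => ascent i w * G (Dgenerator i * w)%g) + -1 * Dexpectation q (fun w => ascent i w * G w).
  by rewrite -DexpectationZ -DexpectationD; apply: eq_Dexpectation => w _; ring.
by rewrite /p -/(ascent i); field.
Qed.

(** Both [X] and the measure are invariant under inversion, so [des w^-1] contributes as much as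
    [des w]: this is the factor 2. The constant function gives the value of [mu]. *)
Lemma two_sided_des_covariance (F : R -> R) :
  Dexpectation q (fun w => (X w - mu) * F (X w))
  = 2 * p * \sum_(i < n) Dexpectation q (fun w => ascent i w * (F (X (Dgenerator i * w)%g) - F (X w))).
Proof.
have XV w : X w^-1%g = X w by rewrite /X /two_sided_des invgK addnC.
have key (F' : R -> R) : Dexpectation q (fun w => X w * F' (X w)) - 2 * n%:R * p * Dexpectation q (fun w => F' (X w))
   = 2 * p * \sum_(i < n) Dexpectation q (fun w => ascent i w * (F' (X (Dgenerator i * w)%g) - F' (X w))).
  have half : Dexpectation q (fun w => (des w)%:R * F' (X w)) - n%:R * p * Dexpectation q (fun w => F' (X w))
     = p * \sum_(i < n) Dexpectation q (fun w => ascent i w * (F' (X (Dgenerator i * w)%g) - F' (X w))).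
    rewrite [RHS]mulr_sumr [RHS](eq_bigr (fun i => Dexpectation q (fun w => (is_descent w i)%:R * F' (X w))
      - p * Dexpectation q (fun w => F' (X w)))); last first.
      by move=> i _; rewrite (descent_covariance i (fun w => F' (X w))).
    rewrite sumrB sumr_const card_ord; congr (_ - _); last by rewrite -[RHS]mulr_natl mulrA.
    rewrite -Dexpectation_sum; apply: eq_Dexpectation => w wD.
    by rewrite desE// natr_sum mulr_suml.
  have half' : Dexpectation q (fun w => (des w^-1%g)%:R * F' (X w)) = Dexpectation q (fun w => (des w)%:R * F' (X w)).
    rewrite -[RHS]Dexpectation_inverse//; apply: eq_Dexpectation => w _.
    by rewrite XV.
  have -> : Dexpectation q (fun w => X w * F' (X w)) = Dexpectation q (fun w => (des w)%:R * F' (X w)) + Dexpectation q (fun w => (des w^-1%g)%:R * F' (X w)).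
    rewrite -DexpectationD; apply: eq_Dexpectation => w _.
    by rewrite /X /two_sided_des natrD mulrDl.
  by rewrite half' -[RHS]mulrA -half; ring.
have muE : mu = 2 * n%:R * p.
  have := key (fun=> 1); rewrite Dexpectation_cst// mulr1 big1 ?mulr0 => [/eqP|i _]; last first.
    rewrite -[RHS](Dexpectation_cst m q0); apply: eq_Dexpectation => w _.
    by rewrite subrr mulr0.
  rewrite subr_eq0 => /eqP <-; apply: eq_Dexpectation => w _.
  by rewrite mulr1.
rewrite -key -muE -mulNr -DexpectationZ -DexpectationD; apply: eq_Dexpectation => w _.
by ring.
Qed.

Lemma jump_ascent i w : ascent i w * (X (Dgenerator i * w)%g - X w) = ascent i w * (jump i w)%:~R.
Proof.
rewrite /ascent /jump; case: is_descent => /=; first by rewrite !mul0r.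
by rewrite mul1r rmorphB.
Qed.

Lemma Dexpectation_jump i H : Dexpectation q (fun w => (jump i w)%:~R * H w)
  = Dexpectation q (fun w => ascent i w * ((jump i w)%:~R * (H w + q * H (Dgenerator i * w)%g))).
Proof.
rewrite (Dexpectation_pair q i); apply: eq_Dexpectation => w wD.
by rewrite jump_generator// /ascent; ring.
Qed.

Lemma two_sided_des_variance : Dvariance q X = 2 * v * Dexpectation q (@jump_total R m).
Proof.
have c0 : Dexpectation q (fun w => X w - mu) = 0.
  rewrite (eq_Dexpectation q (Y := fun w => X w + -1 * mu)); last by move=> w _; ring.
  by rewrite DexpectationD Dexpectation_cst// -/mu; ring.
transitivity (Dexpectation q (fun w => (X w - mu) * X w)).
  rewrite /Dvariance -/mu (eq_Dexpectation q (Y := fun w => (X w - mu) * X w + - mu * (X w - mu))).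
    by rewrite DexpectationD DexpectationZ c0 mulr0 addr0.
  by move=> w _; ring.
rewrite (two_sided_des_covariance id) /jump_total Dexpectation_sum !mulr_sumr; apply: eq_bigr => i _.
have -> : Dexpectation q (fun w => (jump i w)%:~R) = (1 + q) * Dexpectation q (fun w => ascent i w * (jump i w)%:~R).
  rewrite -(eq_Dexpectation q (X := fun w => (jump i w)%:~R * 1)); last by move=> w _; rewrite mulr1.
  by rewrite Dexpectation_jump -DexpectationZ; apply: eq_Dexpectation => w _; ring.
rewrite (eq_Dexpectation q (Y := fun w => ascent i w * (jump i w)%:~R)); last by move=> w _; exact: jump_ascent.
by rewrite /p /v; field.
Qed.

Variables (f g : R -> R) (L M : R).
Hypothesis fg : forall x y, `|f y - f x - (y - x) * g x| <= L * (y - x) ^+ 2.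
Hypothesis gM : forall x, `|g x| <= M.
Let sigma := Num.sqrt (Dvariance q X).
Hypothesis sigma0 : 0 < sigma.
Let W w : R := (X w - mu) / sigma.

(* Both ends of a jump are expanded, with weights 1/(1+q) and q/(1+q): these are
   the conditional probabilities of w and s_i w given the pair. *)
Lemma stein_discrepancy :
  `|Dexpectation q (fun w => g (W w) - W w * f (W w))|
  <= M * Num.sqrt (Dvariance q (@jump_total R m)) / Dexpectation q (@jump_total R m)
     + 8 * n%:R * v * L / sigma ^+ 3.
Proof.
have L0 : 0 <= L.
  have := fg 0 1; rewrite subr0 expr1n mulr1; apply: le_trans; exact: normr_ge0.
have v0 : 0 < v by rewrite divr_gt0// exprn_gt0// addr_gt0.
have p0 : 0 < p by rewrite divr_gt0// addr_gt0.
set Y := @jump_total R m; set EY := Dexpectation q Y.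
have sE : sigma ^+ 2 = 2 * v * EY.
  by rewrite sqr_sqrtr ?Dvariance_ge0// two_sided_des_variance.
have EY0 : 0 < EY.
  by have := exprn_gt0 2 sigma0; rewrite sE pmulr_rgt0// mulr_gt0.
have s0 : sigma != 0 by rewrite gt_eqF.
have EYn : EY != 0 by rewrite gt_eqF.
(* [A] holds the fluctuation of [Y] about its mean, [B] the first-order Taylor remainders of [f]
   along the jumps. *)
pose A := Dexpectation q (fun w => (1 - Y w / EY) * g (W w)).
pose B := Dexpectation q (fun w => Y w / EY * g (W w) - W w * f (W w)).
have -> : Dexpectation q (fun w => g (W w) - W w * f (W w)) = A + B.
  by rewrite -DexpectationD; apply: eq_Dexpectation => w _; ring.
apply: le_trans (ler_normD _ _) _; apply: lerD.
  have absE G : `|Dexpectation q G| <= Dexpectation q (fun w => `|G w|).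
    rewrite ler_norml -mulN1r -DexpectationZ; apply/andP; split; apply: ler_Dexpectation => // w _.
      by rewrite mulN1r lerNl -normrN ler_norm.
    exact: ler_norm.
  have M0 : 0 <= M by apply: le_trans (gM 0); exact: normr_ge0.
  apply: le_trans (absE _) _.
  apply: (@le_trans _ _ (Dexpectation q (fun w => M / EY * `|Y w - EY|))).
    apply: ler_Dexpectation => // w _; rewrite normrM mulrC.
    have -> : 1 - Y w / EY = - ((Y w - EY) / EY) by field.
    rewrite normrN normrM normfV [`|EY|]gtr0_norm// -[leRHS]mulrA ler_pM ?mulr_ge0 ?invr_ge0 ?normr_ge0 ?(ltW EY0)//.
    by rewrite mulrC.
  rewrite DexpectationZ [leRHS]mulrAC; apply: ler_wpM2l; first by rewrite divr_ge0 ?(ltW EY0).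
  exact: Dexpectation_abs_le.
have BE : B = - (2 * p / sigma) * \sum_(i < n) Dexpectation q (fun w => ascent i w *
   (f (W (Dgenerator i * w)%g) - f (W w) - (jump i w)%:~R / sigma / (1 + q) * (g (W w) + q * g (W (Dgenerator i * w)%g)))).
  have -> : B = EY^-1 * Dexpectation q (fun w => Y w * g (W w)) - sigma^-1 * Dexpectation q (fun w => (X w - mu) * f (W w)).
    rewrite -mulNr -!DexpectationZ -DexpectationD; apply: eq_Dexpectation => w _.
    by rewrite /W; ring.
  rewrite (two_sided_des_covariance (fun x => f ((x - mu) / sigma))).
  rewrite /Y /jump_total (eq_Dexpectation q (Y := fun w => \sum_(i < n) (jump i w)%:~R * g (W w))); last first.
    by move=> w _; rewrite mulr_suml.
  rewrite Dexpectation_sum !mulr_sumr -sumrB; apply: eq_bigr => i _.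
  rewrite Dexpectation_jump -!DexpectationZ -[- Dexpectation _ _]mulN1r -DexpectationZ -DexpectationD.
  apply: eq_Dexpectation => w _; rewrite /W.
  have -> : EY^-1 = 2 * v / sigma ^+ 2 by rewrite sE; field; rewrite EYn gt_eqF.
  by rewrite /v /p; field; rewrite q1_neq0 s0.
rewrite BE normrM normrN [`|2 * p / sigma|]gtr0_norm; last by apply: divr_gt0 => //; apply: mulr_gt0.
have -> : 8 * n%:R * v * L / sigma ^+ 3 = 2 * p / sigma * \sum_(i < n) (L * 4 / sigma ^+ 2 * (1 + q)^-1).
  by rewrite sumr_const card_ord -mulr_natl /v /p; field; rewrite q1_neq0 s0.
apply: ler_wpM2l; first by apply: ltW; apply: divr_gt0 => //; apply: mulr_gt0.
apply: le_trans (ler_norm_sum _ _ _) _; apply: ler_sum => i _.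
rewrite -[in leRHS](Dexpectation_ascent q0 i) -DexpectationZ ler_norml -mulN1r -DexpectationZ.
have bound w : w \in Dgroup n -> `|ascent i w *
   (f (W (Dgenerator i * w)%g) - f (W w) - (jump i w)%:~R / sigma / (1 + q) * (g (W w) + q * g (W (Dgenerator i * w)%g)))|
   <= L * 4 / sigma ^+ 2 * (~~ is_descent w i)%:R.
  move=> wD; have := jump_ascent i w; rewrite /ascent; case: is_descent => /=; first by move=> _; rewrite mul0r normr0 mulr0.
  rewrite !mul1r mulr1 => jE; set y := W _; set x := W w.
  have yx : y - x = (jump i w)%:~R / sigma by rewrite /y /x /W -jE; field.
  have j4 : (y - x) ^+ 2 <= 4 / sigma ^+ 2.
    rewrite yx expr_div_n ler_wpM2r ?invr_ge0 ?exprn_ge0 ?(ltW sigma0)//.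
    have := jump_bounds i wD; rewrite -(ler_int R) intr_norm => j2.
    rewrite -[_ ^+ 2]ger0_norm ?sqr_ge0// normrX (_ : 4 = 2 ^+ 2); last by ring.
    by rewrite lerXn2r ?nnegrE.
  have h1 := fg x y; have h2 := fg y x.
  rewrite -yx; set u := f y - f x - _ * _.
  have -> : u = (1 + q)^-1 * (f y - f x - (y - x) * g x) - q / (1 + q) * (f x - f y - (x - y) * g y).
    by rewrite /u; field.
  apply: le_trans (ler_normB _ _) _; rewrite !normrM.
  rewrite [`|(1 + q)^-1|]gtr0_norm ?invr_gt0 ?addr_gt0// [`|q|]gtr0_norm//.
  apply: (@le_trans _ _ ((1 + q)^-1 * (L * (4 / sigma ^+ 2)) + q / (1 + q) * (L * (4 / sigma ^+ 2)))).
    apply: lerD; rewrite ler_wpM2l ?divr_ge0 ?invr_ge0 ?addr_ge0 ?(ltW q0)//.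
      by apply: le_trans h1 _; rewrite ler_wpM2l.
    by apply: le_trans h2 _; rewrite -opprB sqrrN ler_wpM2l.
  by rewrite le_eqVlt; apply/orP; left; apply/eqP; field; rewrite s0.
apply/andP; split; apply: ler_Dexpectation => // w /bound; rewrite ler_norml => /andP[h1 h2].
  by rewrite mulN1r.
exact: h2.
Qed.

End SteinPairing.

(** * Stein's equation *)

Section SteinEquation.
Variable R : realType.
Implicit Types (F H b d : R -> R) (a x y t K : R).
Local Open Scope classical_set_scope.

Local Notation phi := (normal_pdf (0 : R) 1).

Lemma normal_pdf01E x : phi x = normal_peak 1 * expR (- (x ^+ 2 / 2)).
Proof. by rewrite normal_pdfE// /normal_fun subr0 expr1n mulNr. Qed.

Lemma normal_pdf01_gt0 x : 0 < phi x.
Proof. by rewrite normal_pdf01E mulr_gt0 ?expR_gt0 ?normal_peak_gt0. Qed.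

Lemma normal_pdf01N x : phi (- x) = phi x.
Proof. by rewrite !normal_pdf01E sqrrN. Qed.

Lemma is_derive_normal_pdf01 x : is_derive x 1 phi (- x * phi x).
Proof.
have -> : phi = normal_peak 1 *: (expR \o ((- 2^-1) *: (id * id))).
  by apply/funext => y; rewrite normal_pdf01E; congr (_ * expR _); change (- (y ^+ 2 / 2) = - 2^-1 * (y * y)); field.
have d2 := is_deriveM (is_derive_id x (1 : R)) (is_derive_id x 1).
have d3 := is_deriveZ (- 2^-1) d2.
have := is_deriveZ (normal_peak 1) (is_derive1_comp (is_derive_expR _) d3).
move=> /is_derive_eq; apply; set e := expR _.
change (normal_peak 1 * (e * (- 2^-1 * (x * 1 + x * 1))) = - x * (normal_peak 1 * e)).
by field.
Qed.

Lemma normal_pdf01_cvgy : phi x @[x --> +oo] --> (0 : R).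
Proof.
have -> : phi = (fun x => normal_peak 1 * expR (- (x ^+ 2 / 2))).
  by apply/funext => x; rewrite normal_pdf01E.
rewrite -[X in _ --> X](mulr0 (normal_peak 1)); apply: cvgMr.
apply: (@squeeze_cvgr _ _ _ _ (fun=> 0) (fun x => expR (- x))).
- near=> x; rewrite expR_ge0/= ler_expR lerN2 expr2.
  have x2 : 2 <= x by near: x; apply: nbhs_pinfty_ge; rewrite num_real.
  nra.
- exact: cvg_cst.
- exact: cvgr_expR.
Unshelve. all: by end_near.
Qed.

Lemma tail_ge0 (G d : R -> R) a : (forall t, a <= t -> is_derive t 1 G (d t)) ->
  (forall t, a <= t -> d t <= 0) -> G x @[x --> +oo] --> (0 : R) -> 0 <= G a.
Proof.
move=> dG d0 G0.
apply: (cvgr_to_le G0); near=> t.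
have at_ : a <= t by near: t; apply: nbhs_pinfty_ge; rewrite num_real.
have dG' x : x \in `]a, t[%R -> is_derive x 1 G (d x).
  by move=> xat; apply: dG; rewrite (itvP xat).
have cG : {within `[a, t], continuous G}.
  by apply: derivable_within_continuous => x /itvP xat; apply: ex_derive; apply: dG; rewrite xat.
have [c] := MVT_segment at_ dG' cG.
move=> cat_ E; rewrite -subr_le0 E mulr_le0_ge0 ?subr_ge0//.
by apply: d0; rewrite (itvP cat_).
Unshelve. all: by end_near.
Qed.

(* [F + b * phi] decreases to 0. *)
Lemma barrier F H b d a C : (forall t, is_derive t 1 F (H t * phi t)) ->
  F x @[x --> +oo] --> (0 : R) ->
  (forall t, a <= t -> is_derive t 1 b (d t)) ->
  (forall t, a <= t -> `|b t| <= C) ->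
  (forall t, a <= t -> H t + d t - t * b t <= 0) ->
  - (b a * phi a) <= F a.
Proof.
move=> dF F0 db bC le0.
rewrite -subr_ge0 opprK.
apply: (@tail_ge0 (fun t => F t + b t * phi t) (fun t => (H t + d t - t * b t) * phi t)).
- move=> t /db dbt.
  have /is_derive_eq := is_deriveD (dF t) (is_deriveM dbt (is_derive_normal_pdf01 t)).
  by apply; rewrite /GRing.scale/=; ring.
- by move=> t /le0 h; rewrite mulr_le0_ge0 ?(ltW (normal_pdf01_gt0 _)).
- rewrite -[X in _ --> X](addr0 0); apply: cvgD => //.
  apply: (@squeeze_cvgr _ _ _ _ (fun x => - (C * phi x)) (fun x => C * phi x)).
  + near=> x; rewrite -ler_norml normrM [`|phi x|]gtr0_norm ?normal_pdf01_gt0//.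
    by rewrite ler_pM2r ?normal_pdf01_gt0//; apply: bC; near: x; apply: nbhs_pinfty_ge; rewrite num_real.
  + rewrite -[X in _ --> X](oppr0); apply: cvgN; rewrite -[X in _ --> X](mulr0 C); exact: cvgMr normal_pdf01_cvgy.
  + rewrite -[X in _ --> X](mulr0 C); exact: cvgMr normal_pdf01_cvgy.
Unshelve. all: by end_near.
Qed.

Lemma is_derive_reflect F t a : is_derive (- t) 1 F a ->
  is_derive t 1 (fun x => F (- x)) (- a).
Proof.
move=> dF.
have h := is_derive1_comp dF (is_deriveN (is_derive_id t (1 : R))).
have : is_derive t 1 (fun x => F (- x)) (a * -1) := h.
by rewrite mulrN1.
Qed.

(* [F / phi] is then the bounded solution of Stein's equation f' x - x * f x = H x. *)
Definition stein_datum K (B : R) H F :=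
  [/\ forall t, is_derive t 1 F (H t * phi t),
      F x @[x --> -oo] --> (0 : R),
      F x @[x --> +oo] --> (0 : R),
      forall x y, `|H x - H y| <= K * `|x - y|
    & forall x, `|H x| <= B].

Lemma stein_datumN K B H F : stein_datum K B H F -> stein_datum K B (fun x => - H x) (fun x => - F x).
Proof.
move=> [dF FNy Fy HK HB]; split.
- move=> t; rewrite mulNr; exact: is_deriveN (dF t).
- by rewrite -[X in _ --> X]oppr0; exact: cvgN.
- by rewrite -[X in _ --> X]oppr0; exact: cvgN.
- by move=> x y; rewrite -opprD normrN; exact: HK.
- by move=> x; rewrite normrN.
Qed.

(** Together with [stein_datumN], this symmetry reduces two-sided bounds on the whole line to lower
    bounds on the right half-line, where barriers apply. *)
Lemma stein_datum_reflect K B H F : stein_datum K B H F ->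
  stein_datum K B (fun x => H (- x)) (fun x => - F (- x)).
Proof.
move=> [dF FNy Fy HK HB]; split.
- move=> t; have := is_deriveN (is_derive_reflect (dF (- t))).
  by rewrite opprK normal_pdf01N.
- rewrite -[X in _ --> X]oppr0; apply: cvgN; apply/cvgNy_compNP.
  by rewrite /comp; under eq_fun do rewrite opprK.
- rewrite -[X in _ --> X]oppr0; apply: cvgN; exact/(@cvgNy_compNP _ _ F).
- by move=> x y; rewrite (le_trans (HK _ _))// opprK addrC distrC.
- by [].
Qed.

Lemma is_derive_inv_shift c t : 0 < t + c ->
  is_derive t 1 (fun x => (x + c)^-1) (- ((t + c) ^+ 2)^-1).
Proof.
move=> tc0.
have d1 := is_deriveD (is_derive_id t (1 : R)) (is_derive_cst c t 1).
have := @is_deriveV _ (id + cst c) t _ 1 (lt0r_neq0 tc0) d1.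
move=> /@is_derive_eq; apply.
change (- (t + c) ^- 2 * (1 + 0) = - ((t + c) ^+ 2)^-1).
by rewrite addr0 mulr1.
Qed.

Section Bounds.
Variables K B : R.

Lemma lip_ge0 H F : stein_datum K B H F -> 0 <= K.
Proof.
move=> [_ _ _ HK _]; have := HK 1 0; rewrite subr0 normr1 mulr1.
by apply: le_trans; exact: normr_ge0.
Qed.

(* If H 0 > K then F / phi would be negative at 0 from the right, and positive
   from the left. *)
Lemma stein_datum_half0 H F : stein_datum K B H F -> 0 <= H 0 ->
  F 0 <= (K - H 0) * phi 0.
Proof.
move=> HF c0; have K0 := lip_ge0 HF; case: (HF) => _ _ _ HK _.
have [dF FNy Fy _ _] := stein_datumN HF.
set c := H 0 in c0 *.
(* Chosen to start at [K - c]. After [H t >= c - K t], the barrier inequality leaves [c] times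
   [-1 + 1/(t+1)^2 + t/(t+1)], which is [- t/(t+1)^2]. *)
pose b : R -> R := fun t => K - c * (t + 1)^-1.
rewrite -lerN2 -mulNr; have -> : - (K - c) = - (b 0) by rewrite /b add0r invr1 mulr1.
rewrite mulNr; apply: (@barrier _ _ b (fun t => c * ((t + 1) ^+ 2)^-1) 0 (K + c) dF Fy).
- move=> t t0.
  have d1 := is_deriveZ c (@is_derive_inv_shift 1 t (ltr_wpDl t0 ltr01)).
  have := is_deriveB (is_derive_cst K t (1 : R)) d1.
  move=> /@is_derive_eq; apply.
  change (0 - c * - ((t + 1) ^+ 2)^-1 = c * ((t + 1) ^+ 2)^-1).
  by rewrite sub0r mulrN opprK.
- move=> t t0; rewrite /b (le_trans (ler_normB _ _))// ger0_norm// lerD2l ger0_norm.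
    by rewrite ler_piMr// invf_le1 ?lerDr// ltr_wpDl.
  by rewrite mulr_ge0// invr_ge0 addr_ge0.
- move=> t t0; have := HK 0 t; rewrite -/c sub0r normrN [`|t|]ger0_norm// ler_norml => /andP[_ h].
  rewrite /b; set i := (t + 1)^-1.
  have t1 : t + 1 != 0 by rewrite gt_eqF// ltr_wpDl.
  have -> : - H t + c * ((t + 1) ^+ 2)^-1 - t * (K - c * i) = (c - H t - K * t) - c * t * i ^+ 2.
    by rewrite /i; field.
  have : 0 <= c * t * i ^+ 2 by rewrite mulr_ge0 ?sqr_ge0// mulr_ge0.
  lra.
Qed.

(** The bounds on [F 0] from the right and from the left add up to [0 <= 2 (K - H 0) phi 0]. For
    [H = h - E h(Z)] this controls [h 0 - E h(Z)] without computing the mean of [|Z|]. *)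
Lemma stein_datum0 H F : stein_datum K B H F -> `|H 0| <= K.
Proof.
have le H' F' : stein_datum K B H' F' -> H' 0 <= K.
  move=> HF; have K0 := lip_ge0 HF.
  have [c0|/ltW c0] := leP 0 (H' 0); last exact: le_trans c0 K0.
  have h1 := stein_datum_half0 HF c0.
  have := stein_datum_half0 (stein_datum_reflect HF); rewrite oppr0 => /(_ c0) h2.
  rewrite -subr_ge0 -(pmulr_lge0 _ (normal_pdf01_gt0 0)).
  by move: h1 h2; set y := _ * phi 0; lra.
move=> HF; rewrite ler_norml lerNl (le _ _ HF) andbT.
exact: le _ _ (stein_datumN HF).
Qed.

Lemma stein_datum_growth H F x : stein_datum K B H F -> `|H x| <= K * (`|x| + 1).
Proof.
move=> HF; rewrite -[H x](subrK (H 0)) (le_trans (ler_normD _ _))// mulrDr mulr1 lerD ?(stein_datum0 HF)//.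
by case: HF => _ _ _ HK _; rewrite -{2}[x]subr0.
Qed.

Lemma stein_barrier H F b d a C : stein_datum K B H F ->
  (forall t, a <= t -> is_derive t 1 b (d t)) ->
  (forall t, a <= t -> `|b t| <= C) ->
  (forall t, a <= t -> H t + d t - t * b t <= 0) ->
  - b a <= F a / phi a.
Proof.
move=> [dF _ Fy _ _] db bC le0.
by rewrite ler_pdivlMr ?normal_pdf01_gt0// mulNr; exact: (barrier dF Fy db bC le0).
Qed.

(** The barrier is [B / t]: its product with [t] is exactly the bound on [H], and it decreases. *)
Lemma stein_mul_ge H F a : stein_datum K B H F -> 0 < a -> - B <= a * (F a / phi a).
Proof.
move=> HF a0; case: (HF) => _ _ _ _ HB.
have B0 : 0 <= B by apply: le_trans (HB 0); exact: normr_ge0.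
rewrite mulrC -ler_pdivrMr// mulNr.
have -> : B / a = B * (a + 0)^-1 by rewrite addr0.
apply: (@stein_barrier H F (fun t => B * (t + 0)^-1) (fun t => B * - ((t + 0) ^+ 2)^-1) a (B / a)) => // t at_.
- by apply: is_deriveZ; apply: is_derive_inv_shift; rewrite addr0 (lt_le_trans a0).
- by rewrite addr0 ger0_norm ?ler_wpM2l ?lef_pV2 ?posrE ?divr_ge0 ?(lt_le_trans a0)// ltW// (lt_le_trans a0).
- have t0 : 0 < t by exact: lt_le_trans at_.
  rewrite addr0; have := HB t; rewrite ler_norml => /andP[_ h].
  have -> : t * (B / t) = B by field; rewrite gt_eqF.
  have : 0 <= B * (t ^+ 2)^-1 by rewrite mulr_ge0// invr_ge0 sqr_ge0.
  by rewrite mulrN; move: h; lra.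
Qed.

(** The barrier [2 K + K / (t + 1)] is at most [3 K], and it beats the linear growth [K (t + 1)] of
    [H]. *)
Lemma stein_solution_ge H F a : stein_datum K B H F -> 0 <= a -> - (3 * K) <= F a / phi a.
Proof.
move=> HF a0; have K0 := lip_ge0 HF.
have i1 t : a <= t -> 0 <= (t + 1)^-1 <= 1.
  move=> at_; have t0 := le_trans a0 at_.
  by rewrite invr_ge0 addr_ge0//= invf_le1 ?lerDr// ltr_wpDl.
apply: (@le_trans _ _ (- (2 * K + K * (a + 1)^-1))).
  by have /andP[_ h] := i1 a (lexx a); rewrite lerN2; nra.
apply: (@stein_barrier H F (fun t => 2 * K + K * (t + 1)^-1) (fun t => K * - ((t + 1) ^+ 2)^-1) a (3 * K)) => // t at_.
- have t1 : 0 < t + 1 by rewrite ltr_wpDl// (le_trans a0).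
  have := is_deriveD (is_derive_cst (2 * K) t (1 : R)) (is_deriveZ K (is_derive_inv_shift t1)).
  by move=> /@is_derive_eq; apply; rewrite add0r.
- have /andP[h0 h1] := i1 t at_.
  by rewrite ger0_norm; nra.
- have /andP[h0 h1] := i1 t at_.
  have t0 : 0 <= t by exact: le_trans at_.
  have := stein_datum_growth t HF; rewrite [`|t|]ger0_norm// ler_norml => /andP[_ h].
  set i := (t + 1)^-1 in h0 h1 *.
  have t1 : t + 1 != 0 by rewrite gt_eqF// ltr_wpDl.
  have -> : H t + K * - ((t + 1) ^+ 2)^-1 - t * (2 * K + K * i) = (H t - K * (t + 1)) - K * t * (1 - i ^+ 2).
    by rewrite /i; field.
  have : 0 <= K * t * (1 - i ^+ 2) by rewrite mulr_ge0 ?mulr_ge0// subr_ge0 expr_le1.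
  by move: h; lra.
Qed.

(** [t / (1 + t^2)] and [1 / t] are the classical lower and upper bounds for the Mills ratio: as [b]
    they make [1 + b' - t b] positive and negative, respectively. *)
Lemma is_derive_mills t : is_derive t 1 (fun x : R => x / (1 + x ^+ 2)) ((1 - t ^+ 2) / (1 + t ^+ 2) ^+ 2).
Proof.
have t1 : 1 + t ^+ 2 != 0 by rewrite gt_eqF// ltr_pwDl// sqr_ge0.
have d1 := is_deriveD (is_derive_cst (1 : R) t (1 : R)) (is_deriveM (is_derive_id t (1 : R)) (is_derive_id t 1)).
have t1' : (cst (1 : R) + id * id : R -> R) t != 0 by [].
have := is_deriveM (is_derive_id t (1 : R)) (@is_deriveV _ (cst (1 : R) + id * id) t _ 1 t1' d1).
have -> : (id * (fun y : R => ((cst (1 : R) + id * id) y)^-1)) = (fun x : R => x / (1 + x ^+ 2)) by [].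
move=> /@is_derive_eq; apply.
change (t * (- (1 + t ^+ 2) ^- 2 * (0 + (t * 1 + t * 1))) + (1 + t ^+ 2)^-1 * 1 = (1 - t ^+ 2) / (1 + t ^+ 2) ^+ 2).
by field.
Qed.

Lemma mills_bound t : 0 < t -> 0 <= t / (1 + t ^+ 2) <= 1.
Proof.
move=> t0; have t2 : 0 < 1 + t ^+ 2 by rewrite ltr_pwDl// sqr_ge0.
rewrite ler_pdivrMr// mul1r; apply/andP; split; first by rewrite divr_ge0 ?ltW.
by have := sqr_ge0 (t - 1); nra.
Qed.

(* The second part 1 - a * t / (1 + t^2) of the barrier absorbs H t - H a <= K * (t - a). *)
Lemma stein_frozen_ge H F a b d C : stein_datum K B H F -> 0 < a ->
  (forall t, a <= t -> is_derive t 1 b (d t)) ->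
  (forall t, a <= t -> `|b t| <= C) ->
  (forall t, a <= t -> H a * (1 + d t - t * b t) <= 0) ->
  - (H a * b a + K / (1 + a ^+ 2)) <= F a / phi a.
Proof.
move=> HF a0 db bC le0; have K0 := lip_ge0 HF; set c := H a in le0 *.
have a2 : 0 < 1 + a ^+ 2 by rewrite ltr_pwDl// sqr_ge0.
have -> : K / (1 + a ^+ 2) = K + - (K * a) * (a / (1 + a ^+ 2)) by field; rewrite gt_eqF.
have Ka0 : 0 <= K * a by rewrite mulr_ge0 ?(ltW a0).
apply: (@stein_barrier H F (fun t => c * b t + (K + - (K * a) * (t / (1 + t ^+ 2))))
   (fun t => c * d t + (0 + - (K * a) * ((1 - t ^+ 2) / (1 + t ^+ 2) ^+ 2))) a (`|c| * C + (K + K * a)) HF) => t at_.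
- apply: is_deriveD; first exact: is_deriveZ (db t at_).
  by apply: is_deriveD; exact: is_deriveZ (is_derive_mills t).
- have /andP[h0 h1] := mills_bound (lt_le_trans a0 at_).
  rewrite (le_trans (ler_normD _ _))// normrM lerD ?ler_wpM2l ?bC//.
  rewrite (le_trans (ler_normD _ _))// normrM normrN [`|K|]ger0_norm// [`|K * a|]ger0_norm//.
  by rewrite lerD2l ger0_norm// ler_piMr.
- have t2 : 0 < 1 + t ^+ 2 by rewrite ltr_pwDl// sqr_ge0.
  have -> : H t + (c * d t + (0 + - (K * a) * ((1 - t ^+ 2) / (1 + t ^+ 2) ^+ 2)))
      - t * (c * b t + (K + - (K * a) * (t / (1 + t ^+ 2))))
    = (H t - (c + K * (t - a))) + c * (1 + d t - t * b t) - 2 * (K * a * (1 + t ^+ 2)^-1 ^+ 2).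
    by field; rewrite !gt_eqF.
  have Ht : H t <= c + K * (t - a).
    case: (HF) => _ _ _ /(_ t a) + _; rewrite [`|t - a|]ger0_norm ?subr_ge0// ler_norml => /andP[_].
    by rewrite lerBlDl.
  have := le0 t at_; have : 0 <= K * a * (1 + t ^+ 2)^-1 ^+ 2 by apply: mulr_ge0 (sqr_ge0 _).
  lra.
Qed.

(** The sign of [H a] selects the Mills bound, so that [stein_frozen_ge] applies. The barrier
    [1 / t] loses at most [K]; the other one loses [3/2 K] more, from [|H a| <= K (a + 1)] and
    [a (a + 1) <= 3/2 (1 + a^2)]. *)
Lemma stein_derivative_ge H F a : stein_datum K B H F -> 0 < a ->
  - (5 / 2 * K) <= a * (a * (F a / phi a) + H a).
Proof.
move=> HF a0; have K0 := lip_ge0 HF.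
have a2 : 0 < 1 + a ^+ 2 by rewrite ltr_pwDl// sqr_ge0.
set c := H a; set f := F a / phi a; set u := (1 + a ^+ 2)^-1.
have Ku : 0 <= K * u by rewrite mulr_ge0 ?invr_ge0// ltW.
have aaf : a ^+ 2 * f = a * (a * f + c) - a * c by ring.
have [c0|c0] := leP 0 c.
- have d t : a <= t -> is_derive t 1 (fun t => (t + 0)^-1) (- ((t + 0) ^+ 2)^-1).
    by move=> at_; apply: is_derive_inv_shift; rewrite addr0 (lt_le_trans a0).
  have bC t : a <= t -> `|(t + 0)^-1| <= a^-1.
    by move=> at_; rewrite addr0 ger0_norm ?invr_ge0 ?lef_pV2 ?posrE ?(lt_le_trans a0)// ltW// (lt_le_trans a0).
  have le0 t : a <= t -> c * (1 + - ((t + 0) ^+ 2)^-1 - t * (t + 0)^-1) <= 0.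
    move=> at_; have t0 : 0 < t by rewrite (lt_le_trans a0).
    have -> : 1 + - ((t + 0) ^+ 2)^-1 - t * (t + 0)^-1 = - (t^-1 ^+ 2).
      by rewrite addr0; field; rewrite gt_eqF.
    by rewrite mulrN oppr_le0; exact: mulr_ge0 c0 (sqr_ge0 _).
  have := stein_frozen_ge HF a0 d bC le0; rewrite addr0 -/c -/f => /(ler_wpM2l (sqr_ge0 a)).
  have -> : a ^+ 2 * - (c / a + K / (1 + a ^+ 2)) = K * u - K - a * c.
    by rewrite /u; field; rewrite !gt_eqF.
  by rewrite aaf; lra.
- have le0 t : a <= t -> c * (1 + (1 - t ^+ 2) / (1 + t ^+ 2) ^+ 2 - t * (t / (1 + t ^+ 2))) <= 0.
    move=> at_; have t2 : 0 < 1 + t ^+ 2 by rewrite ltr_pwDl// sqr_ge0.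
    have -> : 1 + (1 - t ^+ 2) / (1 + t ^+ 2) ^+ 2 - t * (t / (1 + t ^+ 2)) = 2 * (1 + t ^+ 2)^-1 ^+ 2.
      by field; rewrite gt_eqF.
    apply: mulr_le0_ge0; first exact: ltW.
    exact: mulr_ge0 (ler0n _ _) (sqr_ge0 _).
  have bC t : a <= t -> `|t / (1 + t ^+ 2)| <= 1.
    by move=> at_; have /andP[h0 h1] := mills_bound (lt_le_trans a0 at_); rewrite ger0_norm.
  have := stein_frozen_ge HF a0 (fun t _ => is_derive_mills t) bC le0.
  rewrite -/c -/f => /(ler_wpM2l (sqr_ge0 a)).
  have -> : a ^+ 2 * - (c * (a / (1 + a ^+ 2)) + K / (1 + a ^+ 2)) = a * c * u + K * u - K - a * c.
    by rewrite /u; field; rewrite gt_eqF.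
  have : - (3 / 2 * K) <= a * c * u.
    rewrite ler_pdivlMr//.
    have := stein_datum_growth a HF; rewrite -/c [`|a|]gtr0_norm// ler_norml => /andP[h _].
    have : a * - (K * (a + 1)) <= a * c by rewrite ler_wpM2l ?(ltW a0).
    have : 0 <= K * (a - 1) ^+ 2 by apply: mulr_ge0 (sqr_ge0 _).
    have : 0 <= K * a ^+ 2 by apply: mulr_ge0 (sqr_ge0 _).
    nra.
  by rewrite aaf; lra.
Qed.

End Bounds.
End SteinEquation.

(** * Two-sided bounds for the Stein solution *)

Section SteinSolution.
Variable R : realType.
Implicit Types (F H f g : R -> R) (a x y t K B M : R).
Local Open Scope classical_set_scope.

Local Notation phi := (normal_pdf (0 : R) 1).

Lemma mean_value_le f g M x y : (forall t, is_derive t 1 f (g t)) -> (forall t, `|g t| <= M) ->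
  `|f y - f x| <= M * `|y - x|.
Proof.
move=> df gM; wlog xy : x y / x <= y => [wl|].
  have [/wl//|/ltW/wl] := leP x y; by rewrite distrC [`|x - y|]distrC.
have df' z : z \in `]x, y[%R -> is_derive z 1 f (g z) by [].
have cf : {within `[x, y], continuous f}.
  by apply: derivable_within_continuous => z _; apply: ex_derive; exact: df.
by have [c _ ->] := MVT_segment xy df' cf; rewrite normrM ler_wpM2r.
Qed.

Section Solution.
Variables (K B : R) (H F : R -> R).
Hypothesis HF : stein_datum K B H F.
Let f x := F x / phi x.
Let g x := x * f x + H x.

Lemma stein_solution_le x : `|f x| <= 3 * K.
Proof.
have le H' F' y : stein_datum K B H' F' -> 0 <= y -> `|F' y / phi y| <= 3 * K.
  move=> HF' y0; rewrite ler_norml (stein_solution_ge HF')//= -lerN2 -[- (F' y / _)]mulNr.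
  exact: stein_solution_ge (stein_datumN HF') y0.
have [x0|x0] := leP 0 x; first exact: le HF x0.
have := le _ _ (- x) (stein_datum_reflect HF); rewrite oppr_ge0 => /(_ (ltW x0)).
by rewrite opprK normal_pdf01N mulNr normrN.
Qed.

Lemma stein_mul_le x : `|x * f x| <= B.
Proof.
have le H' F' y : stein_datum K B H' F' -> 0 < y -> `|y * (F' y / phi y)| <= B.
  move=> HF' y0; rewrite ler_norml (stein_mul_ge HF')//= -lerN2 -mulrN -mulNr.
  exact: stein_mul_ge (stein_datumN HF') y0.
have [x0|x0|<-] := ltgtP 0 x; first exact: le HF x0.
  have := le _ _ (- x) (stein_datum_reflect HF); rewrite oppr_gt0 => /(_ x0).
  by rewrite opprK normal_pdf01N [- F x / _]mulNr mulrNN.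
by rewrite mul0r normr0; case: HF => _ _ _ _ /(_ 0); apply: le_trans; exact: normr_ge0.
Qed.

Lemma stein_mul_derivative_le x : `|x * g x| <= 5 / 2 * K.
Proof.
have le H' F' y : stein_datum K B H' F' -> 0 < y -> `|y * (y * (F' y / phi y) + H' y)| <= 5 / 2 * K.
  move=> HF' y0; rewrite ler_norml (stein_derivative_ge HF')//= -lerN2.
  have := stein_derivative_ge (stein_datumN HF') y0.
  by rewrite mulNr mulrN -opprD mulrN.
have [x0|x0|<-] := ltgtP 0 x; first exact: le HF x0.
  have := le _ _ (- x) (stein_datum_reflect HF); rewrite oppr_gt0 => /(_ x0).
  by rewrite opprK normal_pdf01N [- F x / _]mulNr mulrNN mulNr normrN.
by rewrite mul0r normr0 mulr_ge0// (lip_ge0 HF).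
Qed.

Lemma is_derive_stein_solution x : is_derive x 1 f (g x).
Proof.
have p0 : phi x != 0 by rewrite gt_eqF// normal_pdf01_gt0.
case: (HF) => dF _ _ _ _.
have := is_deriveM (dF x) (@is_deriveV _ phi x _ 1 p0 (is_derive_normal_pdf01 x)).
have -> : F * (fun y : R => (phi y)^-1) = f by [].
move=> /@is_derive_eq; apply.
change (F x * (- (phi x) ^- 2 * (- x * phi x)) + (phi x)^-1 * (H x * phi x) = x * (F x / phi x) + H x).
by field.
Qed.

(** 13/2 = 3 + 5/2 + 1. The function [H] is merely Lipschitz, so [g] is split into [x * f x], with
    derivative [f x + x * g x], and [H] itself. *)
Lemma stein_solution_lipschitz x y : `|g y - g x| <= 13 / 2 * K * `|y - x|.
Proof.
have d t : is_derive t 1 (fun x => x * f x) (f t + t * g t).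
  have := is_deriveM (is_derive_id t (1 : R)) (is_derive_stein_solution t).
  move=> /@is_derive_eq; apply.
  change (t * g t + f t * 1 = f t + t * g t); ring.
have b t : `|f t + t * g t| <= 11 / 2 * K.
  rewrite (le_trans (ler_normD _ _))//.
  by have := stein_solution_le t; have := stein_mul_derivative_le t; lra.
have h1 := mean_value_le x y d b.
case: HF => _ _ _ /(_ y x) h2 _.
have -> : g y - g x = (y * f y - x * f x) + (H y - H x) by rewrite /g; ring.
by rewrite (le_trans (ler_normD _ _))//; move: h1 h2; lra.
Qed.

Lemma stein_solution : exists f g : R -> R,
  [/\ forall x, g x - x * f x = H x, forall x, `|g x| <= 2 * B
    & forall x y, `|f y - f x - (y - x) * g x| <= 13 / 2 * K * (y - x) ^+ 2].
Proof.
exists f, g; split.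
- by move=> x; rewrite /g; ring.
- move=> x; rewrite (le_trans (ler_normD _ _))//.
  by have := stein_mul_le x; case: HF => _ _ _ _ /(_ x); lra.
- move=> x y.
  have K0 : 0 <= 13 / 2 * K by rewrite mulr_ge0// (lip_ge0 HF).
  have df z : z \in `]Num.min x y, Num.max x y[%R -> is_derive z 1 f (g z).
    by move=> _; exact: is_derive_stein_solution.
  have cf : {within `[Num.min x y, Num.max x y], continuous f}.
    by apply: derivable_within_continuous => z _; apply: ex_derive; exact: is_derive_stein_solution.
  have mM : Num.min x y <= Num.max x y by rewrite ge_min le_max lexx.
  have [z zin E] := MVT_segment mM df cf.
  have {}E : f y - f x = g z * (y - x).
    move: E; have [xy|xy] := leP x y => //.
    by move=> E; lra.
  have -> : f y - f x - (y - x) * g x = (y - x) * (g z - g x) by rewrite E; ring.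
  rewrite normrM -[_ ^+ 2]ger0_norm ?sqr_ge0// normrX expr2 mulrA mulrC; apply: ler_wpM2r => //.
  apply: (le_trans (stein_solution_lipschitz x z)); apply: ler_wpM2l => //.
  move: zin; rewrite in_itv/=; have [xy|xy] := leP x y => /andP[z1 z2].
    by rewrite !ger0_norm ?subr_ge0// lerB.
  by rewrite !ler0_norm ?subr_le0 ?(ltW xy)// lerN2 lerB.
Qed.

End Solution.
End SteinSolution.

(** * The normal expectation as a Lebesgue integral, and the Stein datum of h *)

Section NormalExpectation.
Variable R : realType.
Local Open Scope classical_set_scope.
Local Notation phi := (normal_pdf (0 : R) 1).
Local Notation lambda := (@lebesgue_measure R).
Local Notation P := (normal_prob (0 : R) 1).

Lemma integral_normal_prob (f : measurableTypeR R -> \bar R) : measurable_fun [set: measurableTypeR R] f ->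
  (\int[P]_x `|f x| < +oo)%E ->
  (\int[P]_x f x = \int[lambda]_x (f x * (phi x)%:E))%E.
Proof.
move=> mf finf.
rewrite -(Radon_Nikodym_change_of_variables (@normal_prob_dominates R 0 1))//=; last first.
  by apply/integrableP; split.
apply: ae_eq_integral => //.
- apply: emeasurable_funM => //; apply: (measurable_int lambda).
  by apply: Radon_Nikodym_integrable; exact: normal_prob_dominates.
- apply: emeasurable_funM => //=; apply/measurableT_comp => //=.
  exact: measurable_normal_pdf.
- apply: ae_eqe_mul2l => /=.
  rewrite Radon_NikodymE//=; first exact: normal_prob_dominates.
  move=> abmu.
  case: cid => /= h [h1 h2 h3].
  apply: integral_ae_eq => //=.
  + by apply/measurableT_comp => //; exact: measurable_normal_pdf.
  + by move=> E E01 mE; rewrite -h3.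
Qed.

Lemma cvg0_of_norm_le (Fl : set_system R) {FF : Filter Fl} (f e : R -> R) :
  (forall x, `|f x| <= e x) -> e x @[x --> Fl] --> (0 : R) -> f x @[x --> Fl] --> (0 : R).
Proof.
move=> fe e0; apply: (squeeze_cvgr _ _ e0); last by rewrite -oppr0; exact: cvgN e0.
by apply: nearW => x; rewrite -ler_norml.
Qed.

Variable h : R -> R.
Variable B : R.
Hypothesis ch : continuous h.
Hypothesis hB : forall x, `|h x| <= B.

Let B0 : 0 <= B. Proof. by apply: le_trans (hB 0); exact: normr_ge0. Qed.

Let mh : measurable_fun [set: measurableTypeR R] (h : measurableTypeR R -> R).
Proof. exact: continuous_measurable_fun. Qed.

Let integrable_hphi : lambda.-integrable setT (fun x => (h x * phi x)%:E).
Proof.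
have := @integrableMr _ _ _ lambda setT measurableT h _ mh _ (integrable_normal_pdf (0 : R) 1).
apply.
exists B; split; first by rewrite num_real.
by move=> M BM x _ /=; rewrite (le_trans (hB x))// ltW.
Qed.

Lemma normal_expectation : exists2 N : R, ('E_P[h] = N%:E)%E & `|N| <= B /\ (\int[lambda]_x (h x * phi x) = N)%R.
Proof.
have fin : (\int[P]_x `|(h x)%:E| <= B%:E)%E.
  rewrite -[leRHS]mule1 -(@probability_setT _ _ _ P) -integral_cst//.
  apply: ge0_le_integral => //=; first by apply/measurable_EFinP; exact: measurableT_comp.
  by move=> x _; rewrite lee_fin.
have E : ('E_P[h] = \int[lambda]_x (h x * phi x)%:E)%E.
  rewrite unlock integral_normal_prob//; first exact/measurable_EFinP.
  exact: le_lt_trans fin (ltry _).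
have Ni := integrable_fin_num measurableT integrable_hphi.
exists (fine (\int[lambda]_x (h x * phi x)%:E)); first by rewrite E fineK.
split => //; rewrite -lee_fin -[leLHS]/(`|(fine _)%:E|%E) fineK// -E unlock (le_trans _ fin)//.
by apply: le_abse_integral => //; exact/measurable_EFinP.
Qed.

Lemma normal_prob_halfline x : (\int[lambda]_(t in `]-oo, x]) phi t)%R = fine (P `]-oo, x]).
Proof. by []. Qed.

(** The identity as a random variable: its distribution function is the normal probability of
    half-lines, so the limits of distribution functions apply. *)
Let idTR : measurableTypeR R -> R := idfun.

#[local] HB.instance Definition _ :=
  @isMeasurableFun.Build _ _ _ _ idTR (@measurable_id _ _ setT).

Lemma cvg_normal_probNy : fine (P `]-oo, x]) @[x --> -oo] --> (0 : R).
Proof. exact/fine_cvg/(@cvg_cdfNy0 _ _ _ P (idTR : {RV P >-> R})). Qed.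

Lemma cvg_normal_proby : fine (P `]-oo, x]) @[x --> +oo] --> (1 : R).
Proof. exact/fine_cvg/(@cvg_cdfy1 _ _ _ P (idTR : {RV P >-> R})). Qed.

Variables (N K : R).
Hypothesis hN : ('E_P[h] = N%:E)%E.
Hypothesis hK : forall x y, `|h x - h y| <= K * `|x - y|.

Let H x := h x - N.
Let F x := (\int[lambda]_(t in `]-oo, x]) (H t * phi t))%R.

Let NB : `|N| <= B /\ (\int[lambda]_x (h x * phi x) = N)%R.
Proof. by have [N' /esym] := normal_expectation; rewrite hN => -[<-]. Qed.

Let HB x : `|H x| <= 2 * B.
Proof. by rewrite (le_trans (ler_normB _ _))// mulr_natl mulr2n lerD//; case: NB. Qed.

Let integrable_phi : lambda.-integrable setT (EFin \o phi).
Proof. exact: integrable_normal_pdf. Qed.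

Let integrable_scale (A : set (measurableTypeR R)) k f : measurable A ->
  lambda.-integrable A (EFin \o f) -> lambda.-integrable A (EFin \o (fun x => k * f x)%R).
Proof. by move=> mA fi; exact: (integrableZl mA k fi). Qed.

Let integrable_F : lambda.-integrable setT (EFin \o (fun x => H x * phi x)).
Proof.
rewrite (_ : _ \o _ = ((EFin \o (fun x => h x * phi x)%R) \- (EFin \o (fun x => N * phi x)%R))%E).
  by apply: integrableB => //; exact: integrable_scale.
by apply/funext => x/=; rewrite -EFinB -mulrBl.
Qed.

Let total : (\int[lambda]_x (H x * phi x))%R = 0.
Proof.
under eq_Rintegral do rewrite mulrBl.
rewrite RintegralB//; last exact: integrable_scale.
rewrite RintegralZl//; case: NB => _ ->.
by rewrite /Rintegral integral_normal_pdf mulr1 subrr.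
Qed.

Let sub_bound (A : set R) : measurable (A : set (measurableTypeR R)) ->
  `|\int[lambda]_(t in A) (H t * phi t)|%R <= 2 * B * (\int[lambda]_(t in A) phi t)%R.
Proof.
move=> mA.
have iA : lambda.-integrable A (EFin \o phi) by exact: integrableS integrable_phi.
have iH : lambda.-integrable A (EFin \o (fun x => H x * phi x)) by exact: integrableS integrable_F.
apply: le_trans (le_normr_Rintegral mA iH) _.
rewrite -RintegralZl//; apply: le_Rintegral => //.
- exact: integrable_norm iH.
- exact: integrable_scale.
- move=> x _; rewrite normrM [`|phi x|]ger0_norm ?normal_pdf_ge0//.
  by rewrite ler_wpM2r ?normal_pdf_ge0.
Qed.

Let halfline_bound x : `|F x| <= 2 * B * fine (P `]-oo, x]).
Proof. rewrite -normal_prob_halfline /F; apply: sub_bound; exact: measurable_itv. Qed.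

Lemma stein_datum_integral : stein_datum K (2 * B) H F.
Proof.
split=> //.
- move=> x.
  have cF : {for x, continuous (fun t => H t * phi t)}.
    apply: cvgM; last exact: continuous_normal_pdf.
    by apply: cvgB; [exact: ch|exact: cvg_cst].
  have iF : lambda.-integrable `]-oo, (x + 1)] (EFin \o (fun x => H x * phi x)) by exact: integrableS integrable_F.
  have x1 : x < x + 1 by rewrite ltrDl.
  have [|dF dFE] := continuous_FTC1 x1 iF _ cF; first by rewrite ltNyr.
  by apply: DeriveDef; [exact: dF|rewrite -derive1E; exact: dFE].
- apply: (cvg0_of_norm_le halfline_bound).
  rewrite -[X in _ --> X](mulr0 (2 * B)); exact: cvgMr cvg_normal_probNy.
(* Since [H] has normal mean 0, [F] is also minus the integral over the upper tail, which is what
   vanishes at [+oo]. *)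
- have FE x : F x = - (\int[lambda]_(t in `]x, +oo[) (H t * phi t))%R.
    apply/eqP; rewrite -addr_eq0 -Rintegral_setU//.
    + by rewrite -itv_bndbnd_setU// set_itvNyy total.
    + by rewrite -itv_bndbnd_setU// set_itvNyy.
    + by apply/disj_setPS => y [/=]; rewrite !in_itv/= andbT => /le_lt_trans h1 /h1; rewrite ltxx.
  have phiE x : (\int[lambda]_(t in `]x, +oo[) phi t)%R = 1 - fine (P `]-oo, x]).
    apply/eqP; rewrite eq_sym subr_eq addrC -normal_prob_halfline -Rintegral_setU//.
    + by rewrite -itv_bndbnd_setU// set_itvNyy /Rintegral integral_normal_pdf.
    + by rewrite -itv_bndbnd_setU// set_itvNyy.
    + by apply/disj_setPS => y [/=]; rewrite !in_itv/= andbT => /le_lt_trans h1 /h1; rewrite ltxx.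
  have lim0 : 2 * B * (1 - fine (P `]-oo, x])) @[x --> +oo] --> (0 : R).
    rewrite -[X in _ --> X](mulr0 (2 * B)); apply: cvgMr; rewrite -[X in _ --> X](subrr 1).
    by apply: cvgB; [exact: cvg_cst|exact: cvg_normal_proby].
  apply: cvg0_of_norm_le lim0 => x.
  by rewrite FE normrN -phiE; apply: sub_bound; exact: measurable_itv.
- by move=> x y; rewrite /H opprB addrA subrK.
Qed.

End NormalExpectation.

(** * Normal approximation *)

Section PiecewiseLipschitz.
Variable R : realType.
Local Open Scope classical_set_scope.
Implicit Types (h : R -> R) (K : R).

Lemma piecewise_C1_lipschitz h K : piecewise_C1 h ->
  (forall x, derivable h x 1 -> `|h^`() x| <= K) ->
  forall x y, x <= y -> `|h y - h x| <= K * (y - x).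
Proof.
move=> [ch [B [Bfin Bd _]]] hK x y xy.
have [s] : exists s : seq R, forall z, z \in `]x, y[%R -> B z -> z \in s.
  have [s Es] := (finite_seqP _).1 (Bfin x y); exists s => z zxy Bz.
  have : [set` s] z by rewrite -Es; split => //; apply: subset_itv_oo_cc zxy.
  by [].
elim: s x y xy => [|c s IH] x y xy Bs.
  move: xy; rewrite le_eqVlt => /predU1P[->|xy]; first by rewrite !subrr normr0 mulr0.
  have dh z : z \in `]x, y[%R -> derivable h z 1.
    by move=> zxy; have [|//] := Bd z _ => /(Bs z zxy).
  have dh' z : z \in `]x, y[%R -> is_derive z 1 h (h^`() z).
    by move=> /dh zd; rewrite derive1E; exact: derivableP.
  have [c cxy ->] := MVT xy dh' (continuous_subspaceT ch).
  by rewrite normrM [`|y - x|]gtr0_norm ?subr_gt0// ler_wpM2r ?subr_ge0 ?(ltW xy)//; apply: hK; exact: dh.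
have [/andP[xc cy]|cxy] := boolP (x < c < y); last first.
  apply: IH => // z zxy /(Bs z zxy); rewrite inE => /predU1P[zc|//].
  by move: zxy; rewrite zc in_itv/= (negbTE cxy).
have -> : h y - h x = (h y - h c) + (h c - h x) by ring.
have -> : K * (y - x) = K * (y - c) + K * (c - x) by ring.
rewrite (le_trans (ler_normD _ _))// lerD//; apply: IH; rewrite ?ltW// => z /[dup] zin.
  rewrite in_itv/= => /andP[cz zy] /(Bs z); rewrite in_itv/= zy (lt_trans xc)// inE => /(_ isT) /predU1P[zc|//].
  by move: cz; rewrite zc ltxx.
rewrite in_itv/= => /andP[xz zc] /(Bs z); rewrite in_itv/= xz (lt_trans zc)// inE => /(_ isT) /predU1P[e|//].
by move: zc; rewrite e ltxx.
Qed.

Lemma supnorm_le h B : (supnorm h = B%:E)%E -> forall x, `|h x| <= B.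
Proof.
move=> hB x; rewrite -lee_fin -hB; apply: ereal_sup_ubound.
by exists x.
Qed.

Lemma supnorm_ge0 h : (0 <= supnorm h)%E.
Proof.
apply: (@le_trans _ _ (`|h 0|%:E)); first by rewrite lee_fin.
by apply: ereal_sup_ubound; exists 0.
Qed.

Lemma supnorm_derive_le h K : (supnorm_derive h <= K%:E)%E -> forall x, derivable h x 1 -> `|h^`() x| <= K.
Proof.
move=> hK x dx; rewrite -lee_fin (le_trans _ hK)//; apply: ereal_sup_ubound.
by exists x.
Qed.

(** The supremum could be [-oo] if [h] were nowhere derivable. A negative value would make [h]
    Lipschitz with a negative constant. *)
Lemma supnorm_derive_ge0 h : piecewise_C1 h -> (0 <= supnorm_derive h)%E.
Proof.
move=> hh; rewrite leNgt; apply/negP => lt0.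
have [K K0 hK] : exists2 K, K < 0 & (supnorm_derive h <= K%:E)%E.
  case: (supnorm_derive h) lt0 => [r| |] //.
    by rewrite lte_fin => r0; exists r.
  by move=> _; exists (-1); rewrite ?ltrN10// leNye.
have := piecewise_C1_lipschitz hh (supnorm_derive_le hK) (@ler01 R).
by rewrite subr0 mulr1 leNgt (lt_le_trans K0).
Qed.

End PiecewiseLipschitz.

(** * Numerical constants *)

Section SteinBound.
Local Open Scope classical_set_scope.
Variable R : realType.
Variables (m : nat) (q : R) (h : R -> R) (K B : R).
Local Notation n := m.+2.
Hypothesis q0 : 0 < q.
Hypothesis n30 : (30 <= n)%N.
Hypothesis hh : piecewise_C1 h.
Hypothesis hB : forall x, `|h x| <= B.
Hypothesis hK : forall x, derivable h x 1 -> `|h^`() x| <= K.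

Let X (w : {perm signed_point n}) : R := (two_sided_des w)%:R.
Let mu := Dexpectation q X.
Let sigma := Num.sqrt (Dvariance q X).
Let v := q / (1 + q) ^+ 2.
Let r := Num.sqrt (n%:R : R).
Let EY := Dexpectation q (@jump_total R m).

Let n30R : 30 <= n%:R :> R. Proof. by rewrite ler_nat. Qed.
Let r0 : 0 < r. Proof. by rewrite sqrtr_gt0; have := n30R; lra. Qed.
Let rE : r ^+ 2 = n%:R. Proof. by rewrite sqr_sqrtr// ler0n. Qed.
Let v0 : 0 < v. Proof. by rewrite divr_gt0// exprn_gt0// addr_gt0. Qed.

(** [n/3 - 8/3] is at least [24/100 n] for [n >= 200/7]. *)
Let EY_ge : 24 / 100 * r ^+ 2 <= EY.
Proof. by have [h1 _] := (@Dexpectation_jump_total R m q q0, tt); move: h1 n30R; rewrite rE -/EY; lra. Qed.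

(** Here 17 squared is 289, while the variance is at most [244.5 n + 912]. *)
Let VY_le : Num.sqrt (Dvariance q (@jump_total R m)) <= 17 * r.
Proof.
have r17 : 0 <= 17 * r by rewrite mulr_ge0// ltW.
rewrite -(ger0_norm r17) -sqrtr_sqr; apply: ler_wsqrtr.
have h1 := @variance_jump_total R m q q0; apply: le_trans h1 _.
by rewrite exprMn rE; move: n30R; lra.
Qed.

(** The factor 2 * 24/100 of [v * r ^+ 2] is rounded down to the square of 2/3. *)
Let sigma_ge : 2 / 3 * Num.sqrt v * r <= sigma.
Proof.
have s0 : 0 <= 2 / 3 * Num.sqrt v * r by rewrite !mulr_ge0 ?sqrtr_ge0 ?(ltW r0).
rewrite -(ger0_norm s0) -sqrtr_sqr; apply: ler_wsqrtr.
rewrite two_sided_des_variance// -/v -/EY !exprMn sqr_sqrtr ?(ltW v0)//.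
have : 0 <= v * (EY - 24 / 100 * r ^+ 2) by rewrite mulr_ge0 ?(ltW v0)// subr_ge0.
have : 0 <= v * r ^+ 2 by rewrite mulr_ge0 ?sqr_ge0 ?(ltW v0).
lra.
Qed.

Lemma two_sided_des_normal_approximation : exists2 N : R, ('E_(normal_prob (0 : R) 1)[h] = N%:E)%E &
  `|Dexpectation q (fun w => h ((X w - mu) / sigma)) - N|
  <= (768 * B + 666 * K * Num.max (q `^ (- 2^-1)) (q `^ (2^-1))) * (n%:R `^ (- 2^-1)).
Proof.
have ch : continuous h by case: hh.
have lip x y : `|h x - h y| <= K * `|x - y|.
  wlog xy : x y / y <= x => [wl|].
    by have [/wl//|/ltW/wl] := leP y x; rewrite distrC [`|y - x|]distrC.
  by rewrite [`|x - y|]ger0_norm ?subr_ge0//; exact: piecewise_C1_lipschitz.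
have [N EN [NB _]] := normal_expectation ch hB; exists N => //.
have [f [g [fgH gM fg]]] := stein_solution (stein_datum_integral ch hB EN lip).
have B0 : 0 <= B by apply: le_trans (hB 0); exact: normr_ge0.
have K0 : 0 <= K by have := lip 1 0; rewrite subr0 normr1 mulr1; apply: le_trans; exact: normr_ge0.
have sv0 : 0 < Num.sqrt v by rewrite sqrtr_gt0.
have s0 : 0 < sigma by apply: lt_le_trans sigma_ge; rewrite !mulr_gt0.
have -> : Dexpectation q (fun w => h ((X w - mu) / sigma)) - N
  = Dexpectation q (fun w => g ((X w - mu) / sigma) - (X w - mu) / sigma * f ((X w - mu) / sigma)).
  rewrite -{1}(Dexpectation_cst m q0 N) -[- Dexpectation _ _]mulN1r -DexpectationZ -DexpectationD.
  by apply: eq_Dexpectation => w _; rewrite fgH; ring.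
apply: le_trans (stein_discrepancy q0 fg gM s0) _.
have -> : (n%:R : R) `^ (- 2^-1) = r^-1 by rewrite powRN powR12_sqrt ?ler0n.
rewrite -/v -/EY -/mu -/X -/sigma [leRHS]mulrDl; apply: lerD.
  have EY0 : 0 < EY by apply: lt_le_trans EY_ge; rewrite mulr_gt0// exprn_gt0.
  rewrite ler_pdivrMr//.
  (* [H = h - E h(Z)] is bounded by [2 * B], hence [g] by [4 * B]; the quotient 4 * 17 / (24/100) is
     below 284, within 768. *)
  apply: (@le_trans _ _ (2 * (2 * B) * (17 * r))).
    by apply: ler_wpM2l VY_le; rewrite !mulr_ge0.
  apply: (@le_trans _ _ (768 * B / r * (24 / 100 * r ^+ 2))).
    have -> : 768 * B / r * (24 / 100 * r ^+ 2) = 768 * 24 / 100 * (B * r) by field; rewrite gt_eqF.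
    have : 0 <= B * r by rewrite mulr_ge0 ?(ltW r0).
    lra.
  apply: ler_wpM2l EY_ge; apply: divr_ge0; last exact: ltW r0.
  by apply: mulr_ge0 B0; exact: ler0n.
(* The inverse of the square root of [v] equals [q^(-1/2) + q^(1/2)], at most twice the larger
   summand. *)
have vmax : (Num.sqrt v)^-1 <= 2 * Num.max (q `^ (- 2^-1)) (q `^ 2^-1).
  have sq0 : 0 < Num.sqrt q by rewrite sqrtr_gt0.
  have -> : (Num.sqrt v)^-1 = q `^ (- 2^-1) + q `^ 2^-1.
    rewrite powRN powR12_sqrt ?(ltW q0)// /v sqrtrM ?(ltW q0)// sqrtrV ?sqr_ge0// sqrtr_sqr gtr0_norm ?addr_gt0//.
    have -> : Num.sqrt q / (1 + q) = Num.sqrt q / (1 + Num.sqrt q ^+ 2) by rewrite sqr_sqrtr// ltW.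
    by field; rewrite !gt_eqF// addr_gt0// exprn_gt0.
  have := le_max (q `^ (- 2^-1)) (q `^ (- 2^-1)) (q `^ 2^-1); rewrite lexx/= => h1.
  have := le_max (q `^ 2^-1) (q `^ (- 2^-1)) (q `^ 2^-1); rewrite lexx orbT => h2.
  by move: h1 h2; set M := Num.max _ _; lra.
rewrite ler_pdivrMr ?exprn_gt0//.
have sge := sigma_ge.
set s := Num.sqrt v in sge sv0 vmax *.
have vE : v = s ^+ 2 by rewrite sqr_sqrtr// ltW.
have s3 : (2 / 3 * s * r) ^+ 3 <= sigma ^+ 3.
  by rewrite lerXn2r ?nnegrE ?(ltW s0)// !mulr_ge0 ?(ltW sv0) ?(ltW r0).
(* Half of 666 times the cube of 2/3 is 888/9; it has to exceed 8 * 13/2 = 52. *)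
apply: (@le_trans _ _ (666 * K * (2^-1 * s^-1) / r * (2 / 3 * s * r) ^+ 3)).
  rewrite vE -rE.
  have -> : 666 * K * (2^-1 * s^-1) / r * (2 / 3 * s * r) ^+ 3 = 888 / 9 * (K * s ^+ 2 * r ^+ 2).
    by field; rewrite !gt_eqF.
  have : 0 <= K * s ^+ 2 * r ^+ 2 by apply: (mulr_ge0 _ (sqr_ge0 _)); apply: mulr_ge0 K0 (sqr_ge0 _).
  have -> : 8 * r ^+ 2 * s ^+ 2 * (13 / 2 * K) = 52 * (K * s ^+ 2 * r ^+ 2) by field.
  lra.
have K666 : 0 <= 666 * K by apply: mulr_ge0 K0; exact: ler0n.
apply: ler_pM; last exact: s3.
- apply: divr_ge0; last exact: ltW r0.
  by apply: mulr_ge0 => //; rewrite mulr_ge0 ?invr_ge0 ?(ltW sv0).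
- by rewrite exprn_ge0// !mulr_ge0 ?(ltW r0) ?(ltW sv0).
- apply: ler_wpM2r; first by rewrite invr_ge0 ltW.
  apply: ler_wpM2l; first exact: K666.
  by move: vmax; lra.
Qed.

End SteinBound.

Theorem theorem1p3 (R : realType) (n : nat) (q : R) (hn : (30 <= n)%N)
    (hq : 0 < q) (h : R -> R) (hh : piecewise_C1 h) :
  let X := fun w : {perm signed_point n} => (two_sided_des w)%:R : R in
  let mu := Dexpectation q X in
  let sigma := Num.sqrt (Dvariance q X) in
  (`| (Dexpectation q (fun w => h ((X w - mu) / sigma)))%:E
      - 'E_(normal_prob (0 : R) (1 : R))[h] |
   <= ((768 : R)%:E * supnorm h
       + (666 : R)%:E * supnorm_derive h
         * (Num.max (q `^ (- 2^-1)) (q `^ (2^-1)))%:E)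
      * ((n%:R : R) `^ (- 2^-1))%:E)%E.
Proof.
case: n hn => [//|[//|m]] hn; cbv zeta.
have n0 : (0 : R) < (m.+2%:R) `^ (- 2^-1) by rewrite powR_gt0.
have M0 : (0 : R) < Num.max (q `^ (- 2^-1)) (q `^ (2^-1)) by rewrite lt_max powR_gt0.
have n0e : (0 < ((m.+2%:R : R) `^ (- 2^-1))%:E)%E by rewrite lte_fin.
have M0e : (0 < (Num.max (q `^ (- 2^-1)) (q `^ (2^-1)))%:E)%E by rewrite lte_fin.
have c1 : (0 < (768 : R)%:E)%E by rewrite lte_fin ltr0n.
have c2 : (0 < (666 : R)%:E)%E by rewrite lte_fin ltr0n.
have D0 := supnorm_derive_ge0 hh.
have := supnorm_ge0 h; case hBE : (supnorm h) => [B| |] Bge0; last by [].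
  case hKE : (supnorm_derive h) D0 => [K| |] Kge0; last by [].
    have hK : (supnorm_derive h <= K%:E)%E by rewrite hKE.
    have [N EN le] := two_sided_des_normal_approximation hq hn hh (supnorm_le hBE) (supnorm_derive_le hK).
    rewrite EN -EFinB abse_EFin -!EFinM lee_fin; exact: le.
  (* The derivative is unbounded here, and the right-hand side is [+oo]. *)
  rewrite (gt0_muley c2) (gt0_mulye M0e) -EFinM addey; last by [].
  by rewrite (gt0_mulye n0e); exact: leey.
(* Here [supnorm h] is [+oo]; the other summand is nonnegative, so it is not [-oo] and the sum is
   [+oo]. *)
rewrite (gt0_muley c1) addye; first by rewrite (gt0_mulye n0e); exact: leey.
apply/negbT/gt_eqF; apply: (lt_le_trans (ltNyr 0)); apply: mule_ge0; last exact: ltW M0e.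
by apply: mule_ge0 D0; exact: ltW c2.
Qed.
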